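(* Let $M$ be an oriented closed connected manifold with fundamental group $\Gamma$ and let $\alpha = \Gamma \curvearrowright (X,\mu)$ be an essentially free ergodic standard $\Gamma$-space. Then $$\mathrm{Cost}_\mu\, \alpha - 1 \leq |M|^{\alpha},$$ where $\mathrm{Cost}_\mu\,\alpha$ is the cost of the orbit relation of $\alpha$ and $|M|^{\alpha}$ is the $\alpha$-parametrised simplicial volume of $M$. In particular, $$\mathrm{Cost}\, \Gamma - 1 \leq |M|,$$ where $\mathrm{Cost}\,\Gamma$ is the cost of the group $\Gamma$ and $|M|$ is the integral foliated simplicial volume of $M$.
   Context: **Standard spaces.** A standard Borel measure [probability] space is a measure [probability] space $(X,\mu)$ whose underlying measurable space is isomorphic to a Polish space with its Borel $\sigma$-algebra; only finite total measure is considered. For a countable group $\Gamma$, a standard $\Gamma$-space is a standard Borel probability space $(X,\mu)$ with a measurable $\mu$-preserving left action of $\Gamma$. It is essentially free if $\mu$-almost every point has trivial stabiliser. It is ergodic if every $\Gamma$-invariant measurable subset $A$ satisfies $\mu(A)=0$ or $\mu(X\setminus A)=0$. Its orbit relation is $\{(x,\gamma\cdot x)\mid x\in X,\gamma\in\Gamma\}\subset X\times X$. **Standard equivalence relations and cost.** Let $S\subset X\times X$ be a measurable equivalence relation on a standard Borel measure space $(X,\mu)$. Let $[S]$ be the group of measurable isomorphisms $f\colon X\to X$ with $f(x)\sim_S x$ for all $x\in X$. Let $[[S]]$ be the set of measurable isomorphisms $f\colon A\to B$ between measurable subsets $A,B\subset X$ with $f(x)\sim_S x$ for all $x\in A$;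 write $\mathrm{dom} f:=A$. $S$ is a standard equivalence relation if every equivalence class is countable and every element of $[S]$ is $\mu$-preserving. (Orbit relations of standard $\Gamma$-spaces of countable groups are standard equivalence relations.) A graphing of $S$ is a countable family $\Phi=(\varphi_i)_{i\in I}$ in $[[S]]$ such that $S$ is the smallest equivalence relation on $X$ containing all pairs $(x,\varphi_i(x))$ with $i\in I$, $x\in\mathrm{dom}\varphi_i$. Its cost is $\mathrm{Cost}_\mu\Phi:=\sum_{i\in I}\mu(\mathrm{dom}\varphi_i)$, and $\mathrm{Cost}_\mu S$ is the infimum of the costs of all graphings of $S$. For a standard $\Gamma$-space $\alpha$, $\mathrm{Cost}_\mu\alpha$ is the cost of its orbit relation. $\mathrm{Cost}\,\Gamma$ is the infimum of $\mathrm{Cost}_\mu\alpha$ over all essentially free standard $\Gamma$-spaces $\alpha$. **Integral foliated simplicial volume.** Let $M$ be an oriented closed connected $n$-manifold with fundamental group $\Gamma$ and universal covering $\widetilde M$, and let $\alpha=\Gamma\curvearrowright(X,\mu)$ be a standard $\Gamma$-space. $L^\infty((X,\mu),\mathbb Z)$ (essentially bounded measurable functions $X\to\mathbb Z$ modulo almost everywhere equality) is a right $\mathbb Z\Gamma$-module via $(f\cdot\gamma)(x)=f(\gamma\cdot x)$. Put $C_*(M;\alpha):=L^\infty((X,\mu),\mathbb Z)\otimes_{\mathbb Z\Gamma}C_*(\widetilde M;\mathbb Z)$, where $C_*(\widetilde M;\mathbb Z)$ is the singular chain complex with the deck transformation action. There is a canonical inclusion $C_*(M;\mathbb Z)\cong\mathbb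 Z\otimes_{\mathbb Z\Gamma}C_*(\widetilde M;\mathbb Z)\to C_*(M;\alpha)$ induced by constant functions. An $\alpha$-parametrised fundamental cycle is a chain in $C_n(M;\alpha)$ homologous in $C_*(M;\alpha)$ to the image of a $\mathbb Z$-fundamental cycle of $M$. If $c=\sum_{j=1}^m f_j\otimes\sigma_j$ is in reduced form (the singular simplices $\sigma_1,\dots,\sigma_m$ lie in different $\Gamma$-orbits), then $|c|_1:=\sum_{j=1}^m\int_X|f_j|\,d\mu$. The $\alpha$-parametrised simplicial volume $|M|^\alpha$ is the infimum of $|c|_1$ over all $\alpha$-parametrised fundamental cycles $c$ of $M$. The integral foliated simplicial volume $|M|$ is the infimum of $|M|^\alpha$ over all standard $\Gamma$-spaces $\alpha$. *)

(* Defs.v *)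
From HB Require Import structures.
From mathcomp Require Import all_boot all_order all_algebra.
From mathcomp Require Import all_classical all_reals all_analysis.
From mathcomp Require Import freeg.

Set Implicit Arguments.
Unset Strict Implicit.
Unset Printing Implicit Defensive.

Import Order.TTheory GRing.Theory Num.Theory.
Import numFieldNormedType.Exports.

Local Open Scope classical_set_scope.
Local Open Scope ring_scope.
Local Open Scope quotient_scope.

Record group_action (G : groupType) (X : Type) := GroupAction {
  act :> G -> X -> X;
  act1x : forall x, act 1%g x = x;
  actMx : forall g h x, act (g * h)%g x = act g (act h x) }.

(** Tensor products over a group ring.  For a right ZG-module A and a left
    ZG-module B, the tensor product of A and B over ZG is the quotient of the
    free abelian group on A * B by the subgroup generated by the bilinearity
    relators and the relators (a . g, b) - (a, g . b); as ZG is generated by G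
    as an abelian group, it suffices to let g range over G. *)

Definition is_subgroup (Z : zmodType) (S : set Z) :=
  S 0 /\ forall x y, S x -> S y -> S (x - y).

Section Tensor.
Context {G : Type} {A B : zmodType} (ra : A -> G -> A) (la : G -> B -> B).

Local Notation free := {freeg (A * B)}.

Inductive tensor_relator : set free :=
| TensorDl a a' b :
    tensor_relator (<< (a + a', b) >> - << (a, b) >> - << (a', b) >>)
| TensorDr a b b' :
    tensor_relator (<< (a, b + b') >> - << (a, b) >> - << (a, b') >>)
| TensorBal a g b :
    tensor_relator (<< (ra a g, b) >> - << (a, la g b) >>).

Definition tensor_null : {pred free} :=
  [pred x | `[< smallest (@is_subgroup free) tensor_relator x >]].

Lemma tensor_null_zmod_closed : zmod_closed tensor_null.
Proof.
split=> [|x y]; first by apply/asboolP => S [[]].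
move=> /asboolP xN /asboolP yN; apply/asboolP => S SS.
by case: (SS) => -[_ SB] _; apply: SB; [exact: xN | exact: yN].
Qed.

HB.instance Definition _ :=
  GRing.isZmodClosed.Build free tensor_null tensor_null_zmod_closed.

Definition tensor := Quotient.quot tensor_null.

Definition tens (a : A) (b : B) : tensor := \pi_tensor << (a, b) >>.

End Tensor.

Section TensorMap.
Context {G : Type} {A B B' : zmodType}.
Context (ra : A -> G -> A) (la : G -> B -> B) (la' : G -> B' -> B').

(** id (x) h, for an equivariant additive h; see [tensor_mapE]. *)
Definition tensor_map (h : B -> B') (x : tensor ra la) : tensor ra la' :=
  fglift (fun ab => tens ra la' ab.1 (h ab.2) : zmodule (tensor ra la')) (repr x).

End TensorMap.

Section TensorTheory.
Context {G : Type} {A B : zmodType} (ra : A -> G -> A) (la : G -> B -> B).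

Lemma tens_relator x : tensor_relator ra la x -> x \in tensor_null ra la.
Proof. by move=> rx; apply/asboolP => S [_]; exact. Qed.

Lemma tensDl a a' b :
  tens ra la (a + a') b = tens ra la a b + tens ra la a' b.
Proof.
rewrite /tens -(@pi_addr _ _ _ _ _ (tensor ra la)); apply/eqP; rewrite -Quotient.idealrBE opprD addrA.
exact/tens_relator/TensorDl.
Qed.

Lemma tensDr a b b' :
  tens ra la a (b + b') = tens ra la a b + tens ra la a b'.
Proof.
rewrite /tens -(@pi_addr _ _ _ _ _ (tensor ra la)); apply/eqP; rewrite -Quotient.idealrBE opprD addrA.
exact/tens_relator/TensorDr.
Qed.

Lemma tens_bal a g b : tens ra la (ra a g) b = tens ra la a (la g b).
Proof.
by apply/eqP; rewrite -Quotient.idealrBE; exact/tens_relator/TensorBal.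
Qed.

End TensorTheory.

Lemma tensor_mapE (G : Type) (A B B' : zmodType) (ra : A -> G -> A)
    (la : G -> B -> B) (la' : G -> B' -> B') (h : B -> B') a b :
  {morph h : x y / x + y} -> (forall g x, h (la g x) = la' g (h x)) ->
  tensor_map la' h (tens ra la a b) = tens ra la' a (h b).
Proof.
move=> hD hG; rewrite /tensor_map.
set F := fglift _.
have FD : additive F by exact: lift_is_additive.
have FU u : F << u >> = tens ra la' u.1 (h u.2) by rewrite /F liftU scale1r.
have null x : x \in tensor_null ra la -> F x = 0.
  move/asboolP => /(_ [set x | F x = 0]); apply; split.
    split=> /=; first by rewrite -[X in F X](subrr 0) FD subrr.
    by move=> y z Fy Fz; rewrite /= FD Fy Fz subrr.
  move=> _ [a1 a2 b1|a1 b1 b2|a1 g b1] /=; rewrite !FD !FU /=.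
  - by rewrite -addrA -opprD tensDl; exact: subrr.
  - by rewrite -addrA -opprD hD tensDr; exact: subrr.
  - by rewrite hG tens_bal subrr.
rewrite -[RHS](FU (a, b)); apply/eqP; rewrite -subr_eq0 -FD; apply/eqP/null.
by rewrite Quotient.idealrBE reprK.
Qed.

HB.instance Definition _ (K : choiceType) (M : lmodType int) (f : K -> M) :=
  GRing.isZmodMorphism.Build {freeg K} M (fglift f) (lift_is_additive f).

Section Singular.
Variable R : realType.

Definition stdsimplex (k : nat) : set 'rV[R]_k.+1 :=
  [set t | (forall i, 0 <= t 0 i) /\ \sum_i t 0 i = 1].
Arguments stdsimplex : clear implicits.

Definition face_fun (k : nat) (i : 'I_k.+2) (t : 'rV[R]_k.+1) : 'rV[R]_k.+2 :=
  \row_j (if unlift i j is Some j' then t 0 j' else 0).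

Lemma face_fun_stdsimplex k (i : 'I_k.+2) (t : stdsimplex k) :
  face_fun i (val t) \in stdsimplex k.+1.
Proof.
have [t0 t1] := set_valP t; apply/mem_set; split=> [j|].
  by rewrite mxE; case: unliftP => // j' _; exact: t0.
rewrite (bigD1_ord i) //= mxE unlift_none add0r -t1.
by apply: eq_bigr => j _; rewrite mxE liftK.
Qed.

Definition face (k : nat) (i : 'I_k.+2) (t : stdsimplex k) : stdsimplex k.+1 :=
  exist _ (face_fun i (val t)) (face_fun_stdsimplex i t).

Lemma face_continuous k (i : 'I_k.+2) : continuous (@face k i).
Proof.
apply: continuous_comp_initial => t A [P nP sPA].
pose Q (j' : 'I_k.+1) : set R := P 0 (fintype.lift i j').
have : nbhs (val t) [set s : 'rV[R]_k.+1 | forall j', Q j' (s 0 j')].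
  exists (fun=> Q) => [i0 j'|s sQ j']; last exact: sQ.
  by have := nP 0 (fintype.lift i j'); rewrite /= mxE liftK ord1.
move=> /(@initial_continuous _ _ (@set_val _ (stdsimplex k)) t) nQ.
apply: (@filterS _ (nbhs t) _ _ _ _ nQ) => s sQ.
apply: sPA => i0 j; rewrite ord1 /= mxE; case: unliftP => [j' ->|ji].
  exact: sQ.
by have := nP 0 j; rewrite ji /= mxE unlift_none => /nbhs_singleton.
Qed.

HB.instance Definition _ k i := isContinuous.Build _ _ _ (@face_continuous k i).

Definition ssimplex (k : nat) (T : topologicalType) : choiceType :=
  continuousType (stdsimplex k) T.

Definition chain (k : nat) (T : topologicalType) := {freeg (ssimplex k T)}.

Definition push_simplex (S T : topologicalType) (f : continuousType S T) k
  (s : ssimplex k S) : ssimplex k T := f \o (s : continuousType _ _).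

Definition push (S T : topologicalType) (f : continuousType S T) k :
  chain k S -> chain k T := fglift (fun s => << push_simplex f s >>).

Definition bdry (T : topologicalType) k : chain k.+1 T -> chain k T :=
  fglift (fun s : ssimplex k.+1 T => \sum_(i < k.+2)
    << (-1) ^+ i *g ((s : continuousType _ _) \o @face k i : ssimplex k T) >>).

Definition chain_in (T : topologicalType) k (A : set T) (c : chain k T) :=
  forall s, s \in dom c -> range (s : continuousType _ _) `<=` A.

Definition rel_cycle (T : topologicalType) k (A : set T) : chain k T -> Prop :=
  if k is k'.+1 then fun c => chain_in A (bdry c) else fun=> True.

Definition rel_homologous (T : topologicalType) k (A : set T)
    (c c' : chain k T) :=
  exists b : chain k.+1 T, exists2 a, chain_in A a & c - c' = bdry b + a.

Lemma bdry_push (S T : topologicalType) (f : continuousType S T) k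
    (c : chain k.+1 S) : bdry (push f c) = push f (bdry c).
Proof.
rewrite -[c]freeg_sumE /bdry /push !raddf_sum; apply: eq_bigr => s _ /=.
rewrite !liftU -[coeff s c]intz !scaler_int !raddfMz; congr (_ *~ _).
rewrite raddf_sum /= liftU scale1r; apply: eq_bigr => i _.
rewrite [RHS]liftU -[(-1) ^+ i]intz scaler_int freegU_mulz.
by congr (<< _ *g _ >>); apply/continuousEP.
Qed.

End Singular.

(** Paths are functions on R that are continuous on the unit interval; their
    values elsewhere are irrelevant. *)

Section Topology.
Variable R : realType.

Definition is_path (T : topologicalType) (x y : T) (w : R -> T) :=
  [/\ {within `[0, 1], continuous w}, w 0 = x & w 1 = y].

Definition path_concat (T : Type) (w v : R -> T) (t : R) : T :=
  if t <= 2^-1 then w (2 * t) else v (2 * t - 1).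

Definition path_homotopic (T : topologicalType) (w v : R -> T) :=
  exists2 H : R * R -> T, {within `[0, 1] `*` `[0, 1], continuous H} &
    forall t, t \in `[0, 1] ->
      [/\ H (0, t) = w t, H (1, t) = v t, H (t, 0) = w 0 & H (t, 1) = w 1].

Definition simply_connected (T : topologicalType) :=
  (forall x y : T, exists w, is_path x y w) /\
  (forall (x : T) w, is_path x x w -> path_homotopic w (cst x)).

(** An identification of the group G with the fundamental group of T at x0;
    [loop_class] is unspecified on functions that are not loops at x0. *)
Record fundamental_group (T : topologicalType) (x0 : T) (G : groupType) :=
  FundamentalGroup {
    loop_class : (R -> T) -> G;
    loop_class_surj : forall g, exists2 w, is_path x0 x0 w & loop_class w = g;
    loop_class_eq : forall w v, is_path x0 x0 w -> is_path x0 x0 v ->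
      (loop_class w = loop_class v <-> path_homotopic w v);
    loop_classM : forall w v, is_path x0 x0 w -> is_path x0 x0 v ->
      loop_class (path_concat w v) = (loop_class w * loop_class v)%g }.

Definition homeo_on (S T : topologicalType) (U : set S) (V : set T)
    (f : S -> T) :=
  [/\ set_bij U V f, {within U, continuous f} &
    exists2 g : T -> S, {within V, continuous g} & {in U, cancel f g}].

Definition evenly_covered (S T : topologicalType) (p : S -> T) (U : set T) :=
  exists (I : Type) (V : I -> set S),
    [/\ p @^-1` U = \bigcup_i V i, trivIset setT V &
      forall i, open (V i) /\ homeo_on (V i) U p].

Definition covering_map (S T : topologicalType) (p : S -> T) :=
  continuous p /\
  forall x, exists U, [/\ open U, U x & evenly_covered p U].

(** A universal covering of M with the deck transformation action of the
    fundamental group G of M.  The action is determined by the base point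
    [ucov_base]: the class of a loop sends it to the endpoint of the lift of
    that loop that starts there. *)
Record universal_covering (M : topologicalType) (x0 : M) (G : groupType)
    (phi : fundamental_group x0 G) (Mt : topologicalType) := UniversalCovering {
  ucov : Mt -> M;
  ucov_covering : covering_map ucov;
  ucov_simply_connected : simply_connected Mt;
  ucov_base : Mt;
  ucov_baseE : ucov ucov_base = x0;
  deck : group_action G Mt;
  deck_continuous : forall g, continuous (deck g);
  ucov_deck : forall g y, ucov (deck g y) = ucov y;
  deck_loop_class : forall w y, is_path ucov_base y w -> ucov y = x0 ->
    deck (loop_class phi (ucov \o w)) ucov_base = y }.

Definition locally_euclidean (n : nat) (M : topologicalType) :=
  forall x : M, exists (U : set M) (V : set 'rV[R]_n) (f : M -> 'rV[R]_n),
    [/\ open U, U x, open V & homeo_on U V f].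

(** Non-emptiness is not included: where it matters, a base point is given. *)
Definition closed_connected_manifold (n : nat) (M : topologicalType) :=
  [/\ hausdorff_space M, @second_countable M, locally_euclidean n M,
      compact [set: M] & connected [set: M]].

(** An orientation is a locally consistent choice of generators of the local
    homology groups H_n(M, M \ {x}; Z), given by relative cycles. *)
Record orientation (n : nat) (M : topologicalType) := Orientation {
  or_cycle : M -> chain R n M;
  or_cycleP : forall x, rel_cycle (~` [set x]) (or_cycle x);
  or_gen : forall x c, rel_cycle (~` [set x]) c ->
    exists m : int, rel_homologous (~` [set x]) c (or_cycle x *~ m);
  or_local : forall x, exists (U : set M) (c : chain R n M),
    [/\ open U, U x, rel_cycle (~` U) c &
      forall y, U y -> rel_homologous (~` [set y]) c (or_cycle y)] }.

Definition is_cycle (T : topologicalType) k : chain R k T -> Prop :=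
  if k is k'.+1 then fun c => bdry c = 0 else fun=> True.

Definition fundamental_cycle n M (o : orientation n M) (z : chain R n M) :=
  is_cycle z /\ forall x, rel_homologous (~` [set x]) z (or_cycle o x).

End Topology.

Definition standard_borel (R : realType) d (X : measurableType d) :=
  exists (P : completePseudoMetricType R) (f : X -> P),
    [/\ hausdorff_space P, exists2 D : set P, countable D & dense D,
        bijective f &
        forall B : set P, <<s @open P >> B <-> measurable (f @^-1` B)].

Record standard_space (R : realType) (G : groupType) := StandardSpace {
  ss_disp : measure_display;
  ss_space : measurableType ss_disp;
  ss_mu : probability ss_space R;
  ss_borel : standard_borel R ss_space;
  ss_act : group_action G ss_space;
  ss_measurable : forall g, measurable_fun setT (ss_act g);
  ss_preserving : forall g A, measurable A ->
    ss_mu (ss_act g @^-1` A) = ss_mu A }.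

Section Actions.
Context {R : realType} {G : groupType} (alpha : standard_space R G).

Local Notation X := (ss_space alpha).
Local Notation mu := (ss_mu alpha).

Definition essentially_free :=
  {ae mu, forall x, forall g, ss_act alpha g x = x -> g = 1%g}.

Definition ergodic := forall A : set X, measurable A ->
  (forall g, ss_act alpha g @` A = A) -> mu A = 0%E \/ mu (~` A) = 0%E.

Definition orbit_relation : set (X * X) :=
  [set xy | exists g, xy.2 = ss_act alpha g xy.1].

End Actions.
Arguments orbit_relation {R G} alpha.
Arguments ergodic {R G} alpha.
Arguments essentially_free {R G} alpha.

Section Cost.
Context {R : realType} d {X : measurableType d}.

Record partial_iso (S : set (X * X)) := PartialIso {
  piso_dom : set X;
  piso_fun : X -> X;
  piso_dom_measurable : measurable piso_dom;
  piso_inj : set_inj piso_dom piso_fun;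
  piso_measurable : measurable_fun piso_dom piso_fun;
  piso_image : forall A, measurable A -> A `<=` piso_dom ->
    measurable (piso_fun @` A);
  piso_rel : forall x, piso_dom x -> S (piso_fun x, x) }.

Definition is_equivalence (E : set (X * X)) :=
  [/\ forall x, E (x, x), forall x y, E (x, y) -> E (y, x) &
      forall x y z, E (x, y) -> E (y, z) -> E (x, z)].

Definition graphing (S : set (X * X)) (I : countType) (Phi : I -> partial_iso S) :=
  S = smallest is_equivalence
    [set xy | exists i, piso_dom (Phi i) xy.1 /\ xy.2 = piso_fun (Phi i) xy.1].

Definition graphing_cost (mu : probability X R) (S : set (X * X))
    (I : countType) (Phi : I -> partial_iso S) : \bar R :=
  \esum_(i in [set: I]) mu (piso_dom (Phi i)).

Definition cost (mu : probability X R) (S : set (X * X)) : \bar R :=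
  ereal_inf [set c | exists (I : countType) (Phi : I -> partial_iso S),
    graphing Phi /\ c = graphing_cost mu Phi].

End Cost.

Definition action_cost (R : realType) (G : groupType)
    (alpha : standard_space R G) : \bar R :=
  cost (ss_mu alpha) (orbit_relation alpha).

Definition group_cost (R : realType) (G : groupType) : \bar R :=
  ereal_inf [set c | exists alpha : standard_space R G,
    essentially_free alpha /\ c = action_cost alpha].

Section Linf.
Context {R : realType} d {X : measurableType d} (mu : probability X R).

Definition ess_bounded : {pred X -> int} := [pred f : X -> int |
  `[< (forall B : set int, measurable (f @^-1` B)) /\
      exists m : int, {ae mu, forall x, `|f x| <= m} >]].

Lemma ess_bounded_zmod_closed : zmod_closed ess_bounded.
Proof.
split=> [|f g /asboolP[mf [a fa]] /asboolP[mg [b gb]]]; apply/asboolP; split.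
- move=> B; rewrite (_ : _ @^-1` B = if 0 \in B then setT else set0).
    by case: ifP => _.
  by apply/seteqP; split=> x /=; case: ifP => //; rewrite ?in_setE // => /negP;
    rewrite in_setE.
- by exists 0; apply: aeW => x; rewrite normr0.
- move=> B; rewrite (_ : _ @^-1` B =
    \bigcup_(u : int) (f @^-1` [set u] `&` g @^-1` [set v | B (u - v)])).
    apply: countable_bigcupT_measurable => [|u]; first exact: countableP.
    exact: measurableI.
  apply/seteqP; split=> x /=; first by move=> ?; exists (f x).
  by case=> u _ [/= <-].
- exists (a + b); apply: filterS2 fa gb => x fa gb.
  exact: le_trans (ler_normB _ _) (lerD fa gb).
Qed.

HB.instance Definition _ :=
  GRing.isZmodClosed.Build (X -> int) ess_bounded ess_bounded_zmod_closed.

Record Linf_fun := LinfFun {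
  Linf_val :> X -> int;
  Linf_valP : Linf_val \in ess_bounded }.

HB.instance Definition _ := [isSub for Linf_val].
HB.instance Definition _ := [Choice of Linf_fun by <:].
HB.instance Definition _ := [SubChoice_isSubZmodule of Linf_fun by <:].

Definition ae_null : {pred Linf_fun} :=
  [pred f : Linf_fun | `[< {ae mu, forall x, f x = 0} >]].

Lemma ae_null_zmod_closed : zmod_closed ae_null.
Proof.
split=> [|f g /asboolP f0 /asboolP g0]; apply/asboolP.
  exact: aeW.
apply: filterS2 f0 g0 => x /= f0 g0; change (\val (f - g) x = 0).
by rewrite raddfB; change (f x - g x = 0); rewrite f0 g0 subrr.
Qed.

HB.instance Definition _ :=
  GRing.isZmodClosed.Build Linf_fun ae_null ae_null_zmod_closed.

Definition Linf := Quotient.quot ae_null.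

Lemma ess_bounded1 : (cst 1 : X -> int) \in ess_bounded.
Proof.
apply/asboolP; split=> [B|]; last by exists 1; exact: aeW.
have [B1|nB1] := pselect (B 1).
  by rewrite (_ : _ @^-1` B = setT) //; apply/seteqP; split.
by rewrite (_ : _ @^-1` B = set0) //; apply/seteqP; split.
Qed.

Definition Linf1 : Linf := \pi_Linf (LinfFun ess_bounded1).

Definition Linf_norm1 (f : Linf) : \bar R :=
  \int[mu]_x (`|(repr f : Linf_fun) x|%:~R)%:E.

End Linf.

Section LinfAction.
Context {R : realType} {G : groupType} (alpha : standard_space R G).

Local Notation mu := (ss_mu alpha).

Lemma ess_bounded_act (f : Linf_fun mu) (g : G) :
  ((f : _ -> int) \o ss_act alpha g) \in ess_bounded mu.
Proof.
have /asboolP[mf [m [N [mN N0 fN]]]] := Linf_valP f.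
have mact A : measurable A -> measurable (ss_act alpha g @^-1` A).
  by move=> mA; rewrite -[X in measurable X]setTI; exact: ss_measurable.
apply/asboolP; split=> [B|]; first by rewrite comp_preimage; exact: mact.
exists m, (ss_act alpha g @^-1` N); split; first exact: mact.
  by rewrite ss_preserving.
by move=> x /= fx; apply: fN.
Qed.

(** (f . g)(x) = f (g . x) *)
Definition Linf_act (f : Linf mu) (g : G) : Linf mu :=
  \pi_(Linf mu) (LinfFun (ess_bounded_act (repr f) g)).

Lemma Linf_act_pi (f : Linf_fun mu) (g : G) :
  Linf_act (\pi_(Linf mu) f) g = \pi_(Linf mu) (LinfFun (ess_bounded_act f g)).
Proof.
apply/eqP; rewrite -Quotient.idealrBE; apply/asboolP.
set r := repr _.
have /asboolP[N [mN N0 fN]] : r - f \in @ae_null R _ _ mu.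
  by rewrite Quotient.idealrBE reprK.
have mact A : measurable A -> measurable (ss_act alpha g @^-1` A).
  by move=> mA; rewrite -[X in measurable X]setTI; exact: ss_measurable.
exists (ss_act alpha g @^-1` N); split; first exact: mact.
  by rewrite ss_preserving.
by move=> x /= fx; apply: fN.
Qed.

End LinfAction.

Section ParametrisedVolume.
Context {R : realType} {n : nat} {M : topologicalType} (o : orientation R n M).
Context {x0 : M} {G : groupType} {phi : fundamental_group R x0 G}.
Context {Mt : topologicalType} (uc : universal_covering phi Mt).

Definition deck_map (g : G) : continuousType Mt Mt :=
  mkcts (@deck_continuous _ _ _ _ _ _ uc g).

Definition ucov_map : continuousType Mt M := mkcts (ucov_covering uc).1.

Definition chain_act k (g : G) : chain R k Mt -> chain R k Mt :=
  @push R _ _ (deck_map g) k.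

Section FixedAction.
Variable alpha : standard_space R G.

Definition param_chain k := tensor (@Linf_act _ _ alpha) (@chain_act k).

Definition ptens k : Linf (ss_mu alpha) -> chain R k Mt -> param_chain k :=
  tens (@Linf_act _ _ alpha) (@chain_act k).

Definition param_bdry k : param_chain k.+1 -> param_chain k :=
  tensor_map (@chain_act k) (@bdry R Mt k).

Lemma param_bdryE k (f : Linf (ss_mu alpha)) (c : chain R k.+1 Mt) :
  param_bdry (ptens f c) = ptens f (bdry c).
Proof.
apply: tensor_mapE => [x y|g x]; [exact: raddfD|exact: bdry_push].
Qed.

(** For a chain z of the universal covering, 1 (x) z is the image of the chain
    p_* z of M under the canonical inclusion. *)
Definition param_fundamental_cycle (c : param_chain n) :=
  exists2 z : chain R n Mt, fundamental_cycle o (push ucov_map z) &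
    exists b : param_chain n.+1, c - ptens (Linf1 _) z = param_bdry b.

Definition reduced_form (m : nat) (f : 'I_m -> Linf (ss_mu alpha))
    (s : 'I_m -> ssimplex R n Mt) (c : param_chain n) :=
  c = \sum_(j < m) ptens (f j) << s j >> /\
  forall i j g, s j = push_simplex (deck_map g) (s i) -> i = j.

Definition param_norm1 (c : param_chain n) (r : \bar R) :=
  exists (m : nat) f (s : 'I_m -> ssimplex R n Mt),
    reduced_form f s c /\ r = (\sum_(j < m) Linf_norm1 (f j))%E.

Definition param_simplicial_volume : \bar R :=
  ereal_inf [set r | exists2 c, param_fundamental_cycle c & param_norm1 c r].

End FixedAction.

Definition integral_foliated_simplicial_volume : \bar R :=
  ereal_inf [set r | exists alpha, r = param_simplicial_volume alpha].

End ParametrisedVolume.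

(* Main.v *)
Require Import Defs.
From HB Require Import structures.
From mathcomp Require Import all_boot all_order all_algebra.
From mathcomp Require Import all_classical all_reals all_analysis.
From mathcomp Require Import measurable_realfun freeg zify ring lra.

Set Implicit Arguments.
Unset Strict Implicit.
Unset Printing Implicit Defensive.

Import Order.TTheory GRing.Theory Num.Theory.
Import numFieldNormedType.Exports.

Local Open Scope classical_set_scope.
Local Open Scope ring_scope.
Local Open Scope quotient_scope.

(** Let a parametrised fundamental cycle be given as the sum of the f_j ⊗ s_j. For almost every
    point x, the integers f_j(g^-1 x) are the coefficients, at the translates g s_j, of a locally
    finite cycle on the universal covering that is homologous to the full lift of a fundamental
    cycle of [M]. (Only its finite truncations [trunc] are ever formed.) Points of the covering are
    labelled by elements of [G] through a set-theoretic fundamental domain ([deck_coordinate]). For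
    each simplex with nonzero coefficient, join the labels of its first two vertices. Every face of
    a simplex starts at one of these two vertices, so the simplices that start in a given union of
    classes of the generated equivalence relation again form a cycle ([bdry_class_part]). Such a
    part has a degree modulo 2 which is constant on the covering, and the whole cycle has degree 1
    ([cycle_good_config]). Hence some class is odd. An odd class has nonzero degree everywhere, so
    it meets every translate of one fixed finite subset of [G].

    This yields generators of the orbit relation. The edges cost at most the norm of the cycle,
    because integral coefficients have absolute value at least 1 on their support
    ([measure_support_le_Linf_norm1]). Every point is moved into an odd class by one of finitely
    many group elements; with disjoint domains these moves cost at most 1. If [G] is infinite, odd
    classes are infinite, and there are sets of arbitrarily small measure that meet all of them
    ([markers], [marker_sequence]). Finitely many jumps from such a set link all odd classes of an
    orbit at arbitrarily small cost ([infinite_group_action_cost]). For finite [G], a transversal of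
    the orbits gives cost at most 1 ([finite_group_action_cost]).

    The degree is built directly: [local_degree_ex] colours a neighbourhood of a point and counts
    rainbow simplices in fine barycentric subdivisions, normalised by Sperner's lemma;
    [covering_degree] transports it to chains on the covering whose simplices embed under the
    projection. For the inequality about groups, an arbitrary action is replaced by its product with
    a Bernoulli shift, which is essentially free and to which the coefficients of a cycle pull back
    ([bernoulli_extension_free], [cycle_cost]). *)

(** * Covering spaces, unique lifts and path lifting *)

Section ConnectedSpaces.
Context {T : topologicalType}.

(** Local constancy makes the intersection of [A] and [P] both relatively open and relatively closed
    in [A]. Uniqueness of lifts, existence of lifts and constancy of degrees all reduce to this. *)
Lemma connected_locally_constant (A : set T) (P : T -> Prop) :
  connected A ->
  (forall x, A x -> \forall y \near x, A y -> (P y <-> P x)) ->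
  forall x y, A x -> A y -> P x -> P y.
Proof.
move=> cA loc x y Ax Ay Px.
suff : A `&` P = A by move=> AP; have [] : (A `&` P) y by rewrite AP.
apply: cA; first by exists x.
  exists (interior [set z | A z -> P z]).
    exact: open_interior.
  apply/seteqP; split=> z [Az Pz]; split=> //.
    by apply: filterS (loc _ Az) => t tP At; apply/(tP At).
  exact: (interior_subset Pz).
exists (~` interior [set z | A z -> ~ P z]).
  exact/open_closedC/open_interior.
apply/seteqP; split=> z [Az Pz]; split=> //.
  by move=> /interior_subset; apply.
apply: contrapT => nP; apply: Pz.
by apply: filterS (loc _ Az) => t tP At /(tP At).
Qed.

End ConnectedSpaces.

Section Sheets.
Context {S T : topologicalType} (p : S -> T).

(** [V y] is the sheet through [y] over the evenly covered set [U], and [g y]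
    the corresponding local section. *)
Definition sheets (U : set T) (V : S -> set S) (g : S -> T -> S) :=
  (forall y, U (p y) -> [/\ open (V y), V y y,
    forall v, V y v -> U (p v) /\ g y (p v) = v,
    forall u, U u -> V y (g y u) /\ p (g y u) = u &
    forall u, U u -> {for u, continuous (g y)}]) /\
  (forall y y', U (p y) -> U (p y') -> V y `&` V y' !=set0 -> V y = V y').

(** Indexing sheets and local sections by points upstairs hides the index type of the even covering;
    points outside the preimage of [U] receive dummy values. *)
Lemma covering_sheets : covering_map p ->
  forall x, exists U, [/\ open U, U x & exists V g, sheets U V g].
Proof.
move=> [_ cov] x; have [U [oU Ux [I [V [pU tV hV]]]]] := cov x.
exists U; split=> //.
have idx y : exists W, U (p y) -> exists2 i, W = V i & V i y.
  have [Uy|nUy] := pselect (U (p y)); last by exists set0.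
  have : (p @^-1` U) y by []; rewrite pU => -[i _ Viy].
  by exists (V i) => _; exists i.
have [W WP] := choice idx.
have sec y : exists g : T -> S, U (p y) ->
    {within U, continuous g} /\ {in W y, cancel p g}.
  have [Uy|nUy] := pselect (U (p y)); last by exists (fun=> y).
  have [i -> _] := WP _ Uy.
  by have [_ [_ _ [g cg gK]]] := hV i; exists g.
have [g gP] := choice sec.
exists W, g; split=> [y Uy|y y' Uy Uy' [v [Wv Wv']]].
  have [i Wi Viy] := WP _ Uy; have [cg gK] := gP _ Uy.
  have [oV [[/= VU _ UV] _ _]] := hV i; rewrite Wi in gK *.
  split=> //.
  - by move=> v Vv; split; [exact: VU|rewrite gK// inE].
  - by move=> u /UV[v Vv <-]; rewrite gK ?inE.
  - by move=> u Uu; move: cg; rewrite continuous_open_subspace//; apply; exact/mem_set.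
have [i Wi Viy] := WP _ Uy; have [i' Wi' Viy'] := WP _ Uy'.
rewrite Wi Wi' in Wv Wv' *; congr (V _).
by apply: tV => //; exists v.
Qed.

Lemma covering_sheet : covering_map p ->
  forall y, exists V, [/\ open V, V y & set_inj V p].
Proof.
move=> /covering_sheets cov y; have [U [_ Uy [V [g [VP _]]]]] := cov (p y).
have [oV Vy Vg _ _] := VP _ Uy; exists (V y); split=> // v v' /set_mem Vv /set_mem Vv' e.
by rewrite -(Vg _ Vv).2 e (Vg _ Vv').2.
Qed.

(** If the sheets of two points of a fibre met, they would coincide, and the local section would
    identify the two points. *)
Lemma covering_separated : covering_map p ->
  forall y y', p y = p y' -> y <> y' ->
  exists V V', [/\ open V, open V', V y, V' y' & V `&` V' = set0].
Proof.
move=> /covering_sheets cov y y' pyy' yy'.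
have [U [_ Uy [V [g [VP VE]]]]] := cov (p y).
have Uy' : U (p y') by rewrite -pyy'.
have [oV Vy Vg _ _] := VP _ Uy; have [oV' Vy' Vg' _ _] := VP _ Uy'.
exists (V y), (V y'); split=> //; apply: contrapT => /eqP/set0P/VE e.
apply: yy'; rewrite -(Vg _ Vy).2 pyy'.
by apply: (Vg _ _).2; rewrite e.
Qed.

Lemma covering_hausdorff : covering_map p -> hausdorff_space T ->
  hausdorff_space S.
Proof.
move=> cov hT; rewrite open_hausdorff => y y' yy'.
have [e|ne] := pselect (p y = p y').
  have [V [V' [oV oV' Vy Vy' VV']]] := covering_separated cov e (elimN eqP yy').
  by exists (V, V'); split; rewrite ?inE//; exact/eqP.
move: hT; rewrite open_hausdorff => /(_ _ _ (introN eqP ne)).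
move=> [[A B] /= [/set_mem Ay /set_mem By'] [oA oB AB]].
exists (p @^-1` A, p @^-1` B) => /=; first by rewrite !inE.
split; [| |by rewrite -preimage_setI (eqP AB) preimage_set0].
- by apply: open_comp => // z _; exact: cov.1.
- by apply: open_comp => // z _; exact: cov.1.
Qed.

(** Near a point of agreement both lifts run in one sheet, on which [p] is injective; near a point
    of disagreement they run in disjoint sheets. So agreement is locally constant. *)
Lemma lift_unique (Y : topologicalType) (A : set Y) (f f' : Y -> S) :
  covering_map p -> connected A ->
  {within A, continuous f} -> {within A, continuous f'} ->
  (forall x, A x -> p (f x) = p (f' x)) ->
  forall x, A x -> f x = f' x -> forall y, A y -> f y = f' y.
Proof.
move=> cov cA /subspace_continuousP cf /subspace_continuousP cf' pff' x Ax fx y Ay.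
apply: (connected_locally_constant (P := fun y => f y = f' y) cA _ Ax Ay fx).
move=> {fx x Ax y Ay} x Ax.
have near_in V (h : Y -> S) : (h z @[z --> within A (nbhs x)] --> h x) ->
    open V -> V (h x) -> \forall z \near x, A z -> V (h z).
  by move=> ch oV Vh; apply: (ch V); exact: open_nbhs_nbhs.
have [e|ne] := pselect (f x = f' x).
  have [V [oV Vx Vi]] := covering_sheet cov (f x).
  have Vx' : V (f' x) by rewrite -e.
  apply: filterS2 (near_in _ _ (cf _ Ax) oV Vx) (near_in _ _ (cf' _ Ax) oV Vx').
  move=> z zV zV' Az; split=> // _.
  by apply: Vi; rewrite ?inE; [exact: zV|exact: zV'|exact: pff'].
have [V [V' [oV oV' Vx Vx' VV']]] := covering_separated cov (pff' _ Ax) ne.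
apply: filterS2 (near_in _ _ (cf _ Ax) oV Vx) (near_in _ _ (cf' _ Ax) oV' Vx').
move=> z zV zV' Az; split=> // ez; exfalso.
have : (V `&` V') (f z) by split; [exact: zV|rewrite ez; exact: zV'].
by rewrite VV'.
Qed.

End Sheets.
Lemma within_comp (X Y Z : topologicalType) (A : set X) (f : X -> Y)
    (g : Y -> Z) : {within A, continuous f} ->
  (forall x, A x -> {for f x, continuous g}) -> {within A, continuous (g \o f)}.
Proof.
move=> /subspace_continuousP cf cg; apply/subspace_continuousP => x Ax.
exact: (cvg_comp _ _ (cf _ Ax) (cg _ Ax)).
Qed.

Lemma within_eq (X Y : topologicalType) (A : set X) (f g : X -> Y) :
  {in A, f =1 g} -> {within A, continuous f} -> {within A, continuous g}.
Proof. by move=> fg; apply: subspace_eq_continuous. Qed.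

(** Liftability over the interval from 0 to [s] is a locally constant property of [s]; connectedness
    of the unit interval replaces a subdivision by a Lebesgue number. *)
Lemma path_lift (R : realType) (S T : topologicalType) (p : S -> T)
    (v : R -> T) (y : S) :
  covering_map p -> {within `[0, 1], continuous v} -> p y = v 0 ->
  exists w : R -> S, [/\ {within `[0, 1], continuous w}, w 0 = y &
    forall t, t \in `[0, 1] -> p (w t) = v t].
Proof.
move=> cov cv py.
pose P (s : R) := exists w : R -> S, [/\ {within `[0, s], continuous w},
  w 0 = y & forall t : R, t \in `[0, s] -> p (w t) = v t].
have := @connected_locally_constant _ `[(0 : R), 1]%classic P (@segment_connected R 0 1).
move=> /(_ _ 0 1); apply; rewrite /= ?in_itv /= ?lexx ?ler01//; last first.
  exists (fun=> y); split=> // [|t]; first by move=> x; exact: cst_continuous.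
  by rewrite in_itv /= -eq_le => /eqP <-.
move=> s0 s01.
have [U [oU Us0 [V [g [VP _]]]]] := covering_sheets cov (v s0).
have vU : \forall t \near s0, t \in `[0, 1] -> U (v t).
  move/subspace_continuousP : (cv) => /(_ _ s01) /(_ U); apply.
  exact: open_nbhs_nbhs.
have [e /= e0 eU] : exists2 e : R, 0 < e &
    forall t, `|s0 - t| < e -> t \in `[0, 1] -> U (v t).
  by move/nbhs_ballP : vU => [e /= e0 eU]; exists e.
(* Within distance [e] of [s0] the path stays in one evenly covered set, so a lift up to [s1] is
   either restricted or prolonged by the local section through its endpoint. *)
have ext s1 s2 : `|s0 - s1| < e -> `|s0 - s2| < e -> s1 \in `[0, 1] ->
    s2 \in `[0, 1] -> P s1 -> P s2.
  rewrite !in_itv /= => s1e s2e /andP[s10 s11] /andP[s20 s21] [w [cw w0 pw]].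
  have [s21'|s12] := leP s2 s1.
    exists w; split=> // [|t].
      apply: continuous_subspaceW cw => t /=; rewrite !in_itv /= => /andP[-> ts].
      exact: le_trans s21'.
    rewrite in_itv /= => /andP[t0 ts]; apply: pw.
    by rewrite in_itv /= t0 (le_trans ts).
  have s1in : s1 \in `[0, s1] by rewrite in_itv /= s10 lexx.
  have Us1 : U (p (w s1)) by rewrite pw//; apply: eU; rewrite // in_itv /= s10.
  have [_ Vs1 Vg gV gC] := VP _ Us1.
  have Ut t : s1 <= t -> t <= s2 -> U (v t).
    move=> ts1 ts2; apply: eU; last first.
      by rewrite in_itv /= (le_trans s10 ts1) (le_trans ts2 s21).
    move: s1e s2e; rewrite !ltr_norml => /andP[a b] /andP[c d]; apply/andP.
    by split; [apply: lt_le_trans c _; rewrite lerD2l lerN2|apply: le_lt_trans b; rewrite lerD2l lerN2].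
  pose w' t := if t <= s1 then w t else g (w s1) (v t).
  have w'E t : s1 <= t -> w' t = g (w s1) (v t).
    rewrite /w'; case: (leP t s1) => // ts1 st1.
    have -> : t = s1 by apply/le_anti; rewrite ts1 st1.
    by rewrite -(pw _ s1in) (Vg _ Vs1).2.
  exists w'; split.
  - have -> : `[0, s2]%classic = `[0, s1]%classic `|` `[s1, s2]%classic.
      apply/seteqP; split=> t /=; rewrite !in_itv /=.
        move=> /andP[t0 ts]; case: (leP t s1) => ts1; [left|right].
          by rewrite t0.
        by rewrite (ltW ts1).
      move=> [/andP[-> ts]|/andP[st ->]]; first by rewrite (le_trans ts)// ltW.
      by rewrite (le_trans s10).
    apply: withinU_continuous; [exact: itv_closed|exact: itv_closed| |].
      apply: within_eq cw => t; rewrite inE /= in_itv /= /w' => /andP[_ ->].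
      by [].
    have := @within_comp _ _ _ `[s1, s2]%classic v (g (w s1)).
    move=> /(_ _ _)/(within_eq _); apply.
    + by move=> t; rewrite inE /= in_itv /= => /andP[st _]; rewrite w'E.
    + apply: continuous_subspaceW cv => t /=; rewrite !in_itv /= => /andP[st ts].
      by rewrite (le_trans s10 st) (le_trans ts s21).
    + by move=> t /=; rewrite in_itv /= => /andP[st ts]; exact/gC/Ut.
  - by rewrite /w' s10.
  - move=> t; rewrite in_itv /= => /andP[t0 ts]; have [ts1|ts1] := leP t s1.
      by rewrite /w' ts1 pw// in_itv /= t0.
    by rewrite w'E ?ltW//; apply: (gV _ _).2; apply: Ut => //; exact: ltW.
apply/nbhs_ballP; exists e => //= s se ss01.
by split; apply: ext => //; rewrite ?subrr ?normr0.
Qed.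
Lemma simply_connected_locally_constant (R : realType) (T : topologicalType)
    (P : T -> Prop) :
  simply_connected R T -> (forall x, \forall y \near x, P y <-> P x) ->
  forall x y, P x -> P y.
Proof.
move=> [pc _] loc x y Px; have [w [cw w0 w1]] := pc x y.
have := @connected_locally_constant _ `[(0 : R), 1]%classic (fun t => P (w t))
  (@segment_connected R 0 1).
rewrite -w1 => /(_ _ 0 1); apply; rewrite /= ?in_itv /= ?lexx ?ler01// ?w0//.
move=> t t01; move/subspace_continuousP : cw => /(_ _ t01) cw.
exact: cw (loc (w t)).
Qed.

(** * The deck action of the fundamental group *)

Section UniversalCovering.
Context {R : realType} {M : topologicalType} {x0 : M} {G : groupType}.
Context {phi : fundamental_group R x0 G} {Mt : topologicalType}.
Variable uc : universal_covering phi Mt.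

Local Notation p := (ucov uc).
Local Notation y0 := (ucov_base uc).
Local Notation deck := (deck uc).

Lemma path_homotopic_refl (T : topologicalType) (w v : R -> T) :
  {within `[0, 1], continuous v} -> (forall t, t \in `[0, 1] -> w t = v t) ->
  path_homotopic w v.
Proof.
move=> cv wv; exists (v \o snd).
  apply/subspace_continuousP => -[s t] [/= s01 t01] U.
  move/subspace_continuousP : cv => /(_ _ t01 U) cv /cv [e /= e0 eU].
  exists (setT, ball t e) => /=.
    by split; [exact: filterT|exact: nbhsx_ballx].
  by move=> [a b] [_ /= be] [_ b01]; exact: eU.
move=> t t01; split=> //=; first by rewrite wv.
- by rewrite wv// in_itv /= lexx ler01.
- by rewrite wv// in_itv /= lexx ler01.
Qed.

Lemma path_homotopic_comp (S T : topologicalType) (f : S -> T) (w v : R -> S) :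
  continuous f -> path_homotopic w v -> path_homotopic (f \o w) (f \o v).
Proof.
move=> cf [H cH HP]; exists (f \o H).
  by apply: within_comp => // z _; exact: cf.
by move=> t /HP[H0 H1 Ht0 Ht1]; split; rewrite /= ?H0 ?H1 ?Ht0 ?Ht1.
Qed.

Lemma loop_class_cst : loop_class phi (cst x0) = 1%g.
Proof.
have cst_loop : is_path x0 x0 (cst x0 : R -> M).
  by split=> //; move=> t; exact: cst_continuous.
have := loop_classM phi cst_loop cst_loop.
have -> : path_concat (cst x0) (cst x0) = cst x0 :> (R -> M).
  by apply/funext => t; rewrite /path_concat; case: ifP.
by move=> /esym/eqP; rewrite -{3}[loop_class phi _]mulg1 => /eqP/mulgI.
Qed.

Lemma ucov_continuous : continuous p.
Proof. exact: (ucov_covering uc).1. Qed.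

Lemma ucov_locally_constant (P : Mt -> Prop) :
  (forall x, \forall y \near x, P y <-> P x) -> forall x y, P x -> P y.
Proof. exact: simply_connected_locally_constant (ucov_simply_connected uc). Qed.

Lemma lift_path_unique (w w' : R -> Mt) (s t : R) :
  {within `[0, 1], continuous w} -> {within `[0, 1], continuous w'} ->
  (forall t, t \in `[0, 1] -> p (w t) = p (w' t)) ->
  s \in `[0, 1] -> t \in `[0, 1] -> w s = w' s -> w t = w' t.
Proof.
move=> cw cw' pw s01 t01 ws; apply: (lift_unique (ucov_covering uc)) cw cw' _ _ _ ws _ t01 => //.
exact: segment_connected.
Qed.

Lemma deck_within (g : G) (w : R -> Mt) :
  {within `[0, 1], continuous w} -> {within `[0, 1], continuous (deck g \o w)}.
Proof. by move=> cw; apply: within_comp => // z _; exact: deck_continuous. Qed.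

Let in0 : (0 : R) \in `[0, 1]. Proof. by rewrite in_itv /= lexx ler01. Qed.
Let in1 : (1 : R) \in `[0, 1]. Proof. by rewrite in_itv /= lexx ler01. Qed.

(** Uniqueness of lifts carries a fixed point to the base point. A loop representing [g] then lifts
    to a loop, which contracts in the simply connected covering, so its projection contracts as
    well. *)
Lemma deck_fixpoint (g : G) y : deck g y = y -> g = 1%g.
Proof.
move=> gy; have [/(_ y y0)[w [cw w0 w1]] sc] := ucov_simply_connected uc.
have gy0 : deck g y0 = y0.
  rewrite -w1; apply: (@lift_path_unique (deck g \o w) w 0 1) => //.
  - exact: deck_within.
  - by move=> t _ /=; rewrite ucov_deck.
  - by rewrite /= w0.
have [v [cv v0 v1] vg] := loop_class_surj phi g.
have [|u [cu u0 pu]] := path_lift (ucov_covering uc) cv (y := y0).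
  by rewrite ucov_baseE.
rewrite -vg.
have pcu : is_path x0 x0 (p \o u).
  split=> [||/=]; [|by rewrite /= u0 ucov_baseE|by rewrite pu].
  by apply: within_comp => // z _; exact: ucov_continuous.
have vP : is_path x0 x0 v by [].
have homo w1' w2' : is_path x0 x0 w1' -> is_path x0 x0 w2' ->
  path_homotopic w1' w2' -> loop_class phi w1' = loop_class phi w2'.
  by move=> P1 P2 h; apply/(loop_class_eq phi).
(* The two loops agree only on the unit interval, so their classes are compared through a constant
   homotopy. *)
have vu : loop_class phi v = loop_class phi (p \o u).
  apply: homo => //.
  by apply: path_homotopic_refl => [|t t01 /=]; [case: pcu|rewrite pu].
have u1 : u 1 = y0.
  rewrite -[RHS]gy0 -(_ : deck (loop_class phi (p \o u)) y0 = u 1).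
    by rewrite -vu vg.
  by apply: deck_loop_class => //; rewrite pu.
rewrite vu -loop_class_cst; apply: homo => //.
  by split=> //; move=> t; exact: cst_continuous.
have -> : cst x0 = p \o cst y0 :> (R -> M).
  by apply/funext => t /=; rewrite ucov_baseE.
apply: path_homotopic_comp; [exact: ucov_continuous|exact: sc].
Qed.

Lemma deck_inj y : injective (deck^~ y).
Proof.
move=> g h /= e; have e1 : (h^-1 * g = 1)%g.
  by apply: (@deck_fixpoint _ y); rewrite actMx e -actMx mulVg act1x.
by rewrite -[RHS]mulg1 -e1 mulgA mulgV mul1g.
Qed.

Lemma deck_injr g : injective (deck g).
Proof.
by move=> y z /(congr1 (deck g^-1%g)); rewrite -!actMx mulVg !act1x.
Qed.

(** A path from [y] to the base point is projected and lifted again from [y']. The new endpoint lies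
    over [x0], hence is a translate of the base point by the very definition of the deck action. *)
Lemma deck_transitive y y' : p y = p y' -> exists g, deck g y = y'.
Proof.
move=> pyy'; have [pc _] := ucov_simply_connected uc.
have [w [cw w0 w1]] := pc y y0.
have cv : {within `[0, 1], continuous (p \o w)}.
  by apply: within_comp => // z _; exact: ucov_continuous.
have [|w' [cw' w'0 pw']] := path_lift (ucov_covering uc) cv (y := y').
  by rewrite /= w0.
have [u [cu u0 u1]] := pc y0 (w' 1).
pose g := loop_class phi (p \o u); exists g.
have gw1 : deck g (w 1) = w' 1.
  rewrite w1; apply: deck_loop_class => //.
  by rewrite pw'//= w1 ucov_baseE.
(* Uniqueness of lifts is used backwards, from parameter 1 to parameter 0. *)
rewrite -w0 -w'0; apply: (@lift_path_unique (deck g \o w) w' 1 0) => //.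
- exact: deck_within.
- by move=> t t01 /=; rewrite ucov_deck pw'.
Qed.

End UniversalCovering.
Lemma covering_nbhs (S T : topologicalType) (p : S -> T) (y : S) (W : set S) :
  covering_map p -> nbhs y W -> nbhs (p y) (p @` W).
Proof.
move=> cov nW; have [U [oU Uy [V [g [VP _]]]]] := covering_sheets cov (p y).
have [_ Vy Vg gV gC] := VP _ Uy.
have gy : g y (p y) = y by exact: (Vg _ Vy).2.
have : \forall u \near p y, W (g y u) by apply: (gC _ Uy); rewrite gy.
have nU := open_nbhs_nbhs (conj oU Uy).
by apply: filterS2 nU => u Uu Wu; exists (g y u) => //; exact: (gV _ Uu).2.
Qed.

Section DeckTransformations.
Context {R : realType} {M : topologicalType} {x0 : M} {G : groupType}.
Context {phi : fundamental_group R x0 G} {Mt : topologicalType}.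
Variable uc : universal_covering phi Mt.

Local Notation p := (ucov uc).
Local Notation y0 := (ucov_base uc).
Local Notation deck := (deck uc).

(** Proper discontinuity. Each point of [K] and [y] have neighbourhoods related by at most one deck
    transformation; compactness assembles these into one neighbourhood [W] and one finite list. *)
Lemma deck_locally_finite (K : set Mt) (y : Mt) :
  hausdorff_space M -> compact K ->
  exists2 W, nbhs y W & exists s : seq G, forall g k, K k -> W (deck g k) -> g \in s.
Proof.
move=> hM cK.
have loc k : exists NWs : set Mt * set Mt * seq G,
    [/\ open NWs.1.1, NWs.1.1 k, nbhs y NWs.1.2 &
    forall g k', NWs.1.1 k' -> NWs.1.2 (deck g k') -> g \in NWs.2].
  have [e|ne] := pselect (p k = p y).
    have [h hk] := deck_transitive e.
    have [V [oV Vy Vi]] := covering_sheet (ucov_covering uc) y.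
    exists (deck h @^-1` V, V, [:: h]); split => //=.
    - by apply: open_comp => // z _; exact: deck_continuous.
    - by rewrite hk.
    - exact: open_nbhs_nbhs.
    - move=> g k' Vh Vg; rewrite inE; apply/eqP/(@deck_inj _ _ _ _ _ _ uc k').
      by apply: Vi; rewrite ?inE// !ucov_deck.
  move: hM; rewrite open_hausdorff => /(_ _ _ (introN eqP ne)).
  move=> [[A B] /= [/set_mem Ay /set_mem By] [oA oB AB]].
  have op C : open C -> open (p @^-1` C).
    by move=> oC; apply: open_comp => // z _; exact: ucov_continuous.
  exists (p @^-1` A, p @^-1` B, [::]); split => //=.
  - exact: op.
  - by apply: open_nbhs_nbhs; split => //; exact: op.
  - move=> g k' Ak'; rewrite /= ucov_deck => Bk'; exfalso.
    by have : (A `&` B) (p k') by []; rewrite (eqP AB).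
(* The filter of pairs with a small neighbourhood and a large list, which lets the near-covering
   form of compactness perform the finite union. *)
pose F (A : set (set Mt * seq G)) := exists W0 (s0 : seq G), nbhs y W0 /\
  forall W (s : seq G), W `<=` W0 -> {subset s0 <= s} -> A (W, s).
have FF : Filter F.
  split=> [|A B [W [s [nW WA]]] [W' [s' [nW' WB]]]|A B AB [W [s [nW WA]]]].
  - by exists setT, [::]; split=> //; exact: filterT.
  - exists (W `&` W'), (s ++ s'); split=> [|W1 s1].
      exact: filterI.
    rewrite subsetI => -[W1W W1W'] ss1; split; [apply: WA|apply: WB] => // g gs; apply: ss1;
      by rewrite mem_cat gs ?orbT.
  - by exists W, s; split=> // W1 s1 W1W ss1; apply/AB/WA.
move/compact_near_coveringP : cK.
move=> /(_ _ F (fun i k => forall g, i.1 (deck g k) -> g \in i.2) FF).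
case=> [k _|W [s [nW Ws]]].
  have [[[N W] s] /= [oN Nk nW Ns]] := loc k.
  exists (N, [set i : set Mt * seq G | i.1 `<=` W /\ {subset s <= i.2}]) => /=.
    by split; [exact: open_nbhs_nbhs|exists W, s].
  by move=> [k' [W' s']] /= [Nk' [W'W ss']] g /W'W/(Ns _ _ Nk')/ss'.
exists W => //; exists s => g k Kk Wk; exact: (Ws W s _ _ k).
Qed.

(** Choose one sheet over each basic set that has one. Words in the elements that make two chosen
    sheets overlap reach every translate of a sheet, because the set of points so reached is locally
    constant on a connected space. *)
Lemma deck_group_countable : @second_countable M -> countable [set: G].
Proof.
move=> [Bs cBs [oB bB]].
pose good B V := [/\ open V, set_inj V p & p @` V = B].
have goodP B : exists V, (exists V, good B V) -> good B V.
  have [[V gV]|] := pselect (exists V, good B V); first by exists V.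
  by exists set0.
have [V VP] := choice goodP.
pose Bg := [set B | Bs B /\ exists V, good B V].
have Bg_ex y : exists2 B, Bg B & B (p y).
  have [U [oU Uy [V' [g [V'P _]]]]] := covering_sheets (ucov_covering uc) (p y).
  have [oV Vy Vg gV gC] := V'P _ Uy.
  have [B [bB1 By] /= BU] := bB (p y) U (open_nbhs_nbhs (conj oU Uy)).
  exists B => //; split=> //; exists (V' y `&` p @^-1` B); split.
  - apply: openI => //; apply: open_comp; last exact: oB.
    by move=> z _; exact: ucov_continuous.
  - move=> v v' /set_mem[Vv _] /set_mem[Vv' _] e.
    by rewrite -(Vg _ Vv).2 e (Vg _ Vv').2.
  - apply/seteqP; split=> [_ [v [_ Bv] <-] //|b Bb].
    have [gb1 gb2] := gV _ (BU _ Bb).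
    by exists (g y b) => //; split=> //=; rewrite gb2.
have Bg_cover y B : Bg B -> B (p y) -> exists g v, V B v /\ y = deck g v.
  move=> [_ /VP[_ _ pV]] By; have [v Vv pv] : (p @` V B) (p y) by rewrite pV.
  by have [g <-] := deck_transitive pv; exists g, v.
(* The overlap elements: [f] moves some point of one chosen sheet into another chosen sheet. *)
pose F := [set f : G | exists B B', [/\ Bg B, Bg B' &
  exists2 v, V B v & V B' (deck f v)]].
have cF : countable F.
  pose Q B B' B'' := [set f : G | B'' !=set0 /\
    forall b, B'' b -> exists2 v, V B v & V B' (deck f v) /\ p v = b].
  apply: (@sub_countable _ _ _ (\bigcup_(B in Bg) \bigcup_(B' in Bg)
    \bigcup_(B'' in Bs) Q B B' B'')).
    apply: subset_card_le => f [B [B' [gB gB' [v Vv Vfv]]]].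
    have [oV Vi pV] := VP _ gB.2; have [oV' Vi' pV'] := VP _ gB'.2.
    exists B => //; exists B' => //.
    have nW : nbhs v (V B `&` deck f @^-1` V B').
      apply: open_nbhs_nbhs; split => //; apply: openI => //.
      by apply: open_comp => // z _; exact: deck_continuous.
    have [B'' [bB'' Bv] /= BW] := bB _ _ (covering_nbhs (ucov_covering uc) nW).
    exists B'' => //; split; first by exists (p v).
    by move=> b /BW[u [Vu Vfu] <-]; exists u.
  have cBg : countable Bg by apply: sub_countable cBs; apply: subset_card_le => B [].
  apply: bigcup_countable => // B gB; apply: bigcup_countable => // B' gB'.
  apply: bigcup_countable => // B'' _.
  (* Two sheets and a nonempty basic set inside the image of their overlap determine [f]: a point of
     that basic set has one lift in each sheet, and the deck action is free. *)
  have Q1 : forall f h, Q B B' B'' f -> Q B B' B'' h -> f = h.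
    move=> f h [[b Bb] /(_ _ Bb)[v Vv [Vfv pv]]] [_ /(_ _ Bb)[v' Vv' [Vhv pv']]].
    have [_ Vi _] := VP _ gB.2; have [_ Vi' _] := VP _ gB'.2.
    have vv' : v = v' by apply: Vi; rewrite ?inE// pv.
    subst v'; apply: (@deck_inj _ _ _ _ _ _ uc v).
    by apply: Vi'; rewrite ?inE// !ucov_deck.
  have [->|/set0P[f Qf]] := eqVneq (Q B B' B'') set0; first exact: countable0.
  rewrite (_ : Q B B' B'' = [set f]); first exact: countable1.
  by apply/seteqP; split=> [h Qh|_ ->//]; exact: Q1.
pose W := fix W n := if n is n'.+1 then \bigcup_(f in F) [set (g * f)%g | g in W n'] else [set 1%g].
have cW n : countable (W n).
  elim: n => [|n IH] /=; first exact: countable1.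
  apply: bigcup_countable => // f _; exact: sub_countable (card_image_le _ _) IH.
pose G0 := \bigcup_n W n.
have cG0 : countable G0 by apply: bigcup_countable.
have G01 : G0 1%g by exists 0%N.
have G0M g f : G0 g -> F f -> G0 (g * f)%g.
  by move=> [n _ Wg] Ff; exists n.+1 => //=; exists f => //; exists g.
have [B0 gB0 By0] := Bg_ex y0.
have [g1 [v0 [Vv0 y0E]]] := Bg_cover _ _ gB0 By0.
pose P y := exists h B v, [/\ G0 h, Bg B, V B v & y = deck (g1 * h)%g v].
have Ploc y : \forall y' \near y, P y' <-> P y.
  have [B gB By] := Bg_ex y; have [g [v [Vv yE]]] := Bg_cover _ _ gB By.
  (* On the whole translate of a sheet by [g], reachability depends only on [g]. *)
  have PE y' : V B (deck g^-1%g y') -> P y' <-> G0 (g1^-1 * g)%g.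
    move=> Vy'; split=> [[h [B' [v' [Gh gB' Vv' e]]]]|Gg].
      rewrite -[X in G0 X]mul1g -(mulgV h) -mulgA; apply: G0M => //.
      exists B, B'; split=> //; exists (deck g^-1%g y') => //.
      by rewrite e -!actMx -!mulgA mulVKg mulKg mulVg act1x.
    exists (g1^-1 * g)%g, B, (deck g^-1%g y'); split=> //.
    by rewrite -actMx mulgA mulgV mul1g mulgV act1x.
  have Vy : V B (deck g^-1%g y) by rewrite yE -actMx mulVg act1x.
  have : nbhs y (deck g^-1%g @^-1` V B).
    apply: open_nbhs_nbhs; split=> //; apply: open_comp.
      by move=> z _; exact: deck_continuous.
    by have [] := VP _ gB.2.
  by apply: filterS => y' Vy'; rewrite (PE _ Vy') (PE _ Vy).
have Py0 : P y0 by exists 1%g, B0, v0; rewrite mulg1.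
apply: sub_countable (sub_countable (card_image_le (fun g => g1 * g * g1^-1)%g _) cG0).
apply: subset_card_le => g _.
have [h [B [v [Gh gB Vv e]]]] :=
  @ucov_locally_constant _ _ _ _ _ _ uc P Ploc y0 (deck g y0) Py0.
exists (g1^-1 * g * g1)%g; last first.
  by rewrite -!mulgA mulVKg mulgV mulg1.
have -> : (g1^-1 * g * g1 = h * (h^-1 * g1^-1 * g * g1))%g by rewrite -!mulgA mulVKg.
apply: G0M => //; exists B0, B; split=> //; exists v0 => //.
by rewrite !actMx -y0E e -!actMx -!mulgA mulKg mulVg act1x.
Qed.

End DeckTransformations.

(** * Supports and restrictions in free abelian groups *)

Lemma subrACA (V : zmodType) (a b c d : V) : a - b - (c - d) = a - c - (b - d).
Proof. by rewrite !opprD !opprK addrACA. Qed.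

Section FreeGroups.
Context {K : choiceType}.
Implicit Types (c : {freeg K}) (Q : K -> Prop).

(** [c] is a combination of generators that satisfy [Q]. *)
Definition fg_in Q c := forall x, x \in dom c -> Q x.

Lemma fg_in0 Q : fg_in Q 0. Proof. by move=> x; rewrite dom0. Qed.

Lemma fg_inB Q c c' : fg_in Q c -> fg_in Q c' -> fg_in Q (c - c').
Proof. by move=> Qc Qc' x /domB; rewrite mem_cat => /orP[/Qc|/Qc']. Qed.

Lemma fg_inN Q c : fg_in Q c -> fg_in Q (- c).
Proof. by rewrite -[- c]add0r; apply: fg_inB; exact: fg_in0. Qed.

Lemma fg_inD Q c c' : fg_in Q c -> fg_in Q c' -> fg_in Q (c + c').
Proof. by move=> Qc /fg_inN Qc'; rewrite -[c']opprK; exact: fg_inB. Qed.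

Lemma fg_inU Q x (k : int) : Q x -> fg_in Q << k *g x >>.
Proof.
move=> Qx; have [->|k0] := eqVneq k 0; first by rewrite freegU0; exact: fg_in0.
by move=> y; rewrite domU// inE => /eqP ->.
Qed.

Lemma fg_in_sum Q (I : Type) (r : seq I) (P : pred I) (F : I -> {freeg K}) :
  (forall i, P i -> fg_in Q (F i)) -> fg_in Q (\sum_(i <- r | P i) F i).
Proof.
by move=> QF; apply: big_ind => //; [exact: fg_in0|move=> *; exact: fg_inD].
Qed.

Lemma fg_in_sub Q Q' c : (forall x, Q x -> Q' x) -> fg_in Q c -> fg_in Q' c.
Proof. by move=> QQ' Qc x /Qc/QQ'. Qed.

Lemma fg_mulz (k : int) x : << k *g x >> = << x >> *~ k :> {freeg K}.
Proof. by rewrite freegU_mulz intz. Qed.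

Lemma fg_in_mulz Q c (k : int) : fg_in Q c -> fg_in Q (c *~ k).
Proof.
move=> Qc x; rewrite mem_dom raddfMz /= => cx; apply: Qc; rewrite mem_dom.
by apply: contraNneq cx => ->; rewrite mul0rz.
Qed.

Lemma fg_ind (P : {freeg K} -> Prop) c :
  P 0 -> (forall a b, P a -> P b -> P (a - b)) ->
  (forall x, x \in dom c -> P << x >>) -> P c.
Proof.
move=> P0 PB PU.
have PN a : P a -> P (- a) by move=> Pa; rewrite -sub0r; exact: PB.
have PD a b : P a -> P b -> P (a + b).
  by move=> Pa Pb; rewrite -[b]opprK; apply: PB => //; exact: PN.
have PM a (k : nat) : P a -> P (a *+ k).
  by move=> Pa; elim: k => // k IH; rewrite mulrS; exact: PD.
rewrite -[c]freeg_sumE; rewrite big_seq; apply: big_ind => // x /PU Px.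
rewrite fg_mulz; case: (coeff x c) => n; first exact: PM.
by apply: PN; exact: PM.
Qed.

Lemma fg_ext (V : zmodType) (f g : {additive {freeg K} -> V}) c :
  (forall x, x \in dom c -> f << x >> = g << x >>) -> f c = g c.
Proof.
move=> fg; apply: (fg_ind (P := fun c => f c = g c)) fg; first by rewrite !raddf0.
by move=> a b; rewrite !raddfB => -> ->.
Qed.

Lemma fg_liftU (V : lmodType int) (f : K -> V) x : fglift f << x >> = f x.
Proof. by rewrite liftU scale1r. Qed.

End FreeGroups.

Section FreeGroupMaps.
Context {K : choiceType}.
Implicit Types (c : {freeg K}) (Q : K -> Prop).

Lemma fg_lift_in (L : choiceType) (Q : K -> Prop) (Q' : L -> Prop)
    (f : {additive {freeg K} -> {freeg L}}) c :
  (forall x, Q x -> fg_in Q' (f << x >>)) -> fg_in Q c -> fg_in Q' (f c).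
Proof.
move=> QQ' Qc; apply: (fg_ind (P := fun c => fg_in Q' (f c))).
- by rewrite raddf0; exact: fg_in0.
- by move=> a b; rewrite raddfB; exact: fg_inB.
- by move=> x /Qc/QQ'.
Qed.

Lemma fg_lift0 (V : zmodType) (Q : K -> Prop) (f : {additive {freeg K} -> V}) c :
  (forall x, Q x -> f << x >> = 0) -> fg_in Q c -> f c = 0.
Proof.
move=> Qf Qc; apply: (fg_ind (P := fun c => f c = 0)).
- exact: raddf0.
- by move=> a b; rewrite raddfB => -> ->; rewrite subrr.
- by move=> x /Qc/Qf.
Qed.

(** The part of [c] supported by [A]. *)
Definition fg_restr (A : set K) : {freeg K} -> {freeg K} :=
  fglift (fun x => if `[< A x >] then << x >> else 0).

HB.instance Definition _ A := GRing.isZmodMorphism.Build _ _ (fg_restr A)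
  (lift_is_additive _).

Lemma fg_restrU (A : set K) x :
  fg_restr A << x >> = if `[< A x >] then << x >> else 0.
Proof. exact: fg_liftU. Qed.

Lemma fg_restr_in A c : fg_in A (fg_restr A c).
Proof.
apply: (@fg_lift_in _ (fun=> True)) => // x _ /=; rewrite fg_restrU.
by case: asboolP => ?; [exact: fg_inU|exact: fg_in0].
Qed.

Lemma fg_restr_sub Q A c : fg_in Q c -> fg_in Q (fg_restr A c).
Proof.
apply: fg_lift_in => x Qx /=; rewrite fg_restrU.
by case: asboolP => ?; [exact: fg_inU|exact: fg_in0].
Qed.

Lemma fg_restr_compl A c : fg_in (~` A) (c - fg_restr A c).
Proof.
apply: (fg_ind (P := fun c => fg_in (~` A) (c - fg_restr A c))).
- by rewrite raddf0 subrr; exact: fg_in0.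
- by move=> a b Pa Pb; rewrite [fg_restr A (a - b)]raddfB subrACA; exact: fg_inB.
- move=> x _; rewrite fg_restrU; case: asboolP => Ax.
    by rewrite subrr; exact: fg_in0.
  by rewrite subr0; exact: fg_inU.
Qed.

Lemma fg_restr_id A c : fg_in A c -> fg_restr A c = c.
Proof.
move=> Ac; rewrite -[RHS]/(idfun c); apply: fg_ext => x /Ac Ax /=.
by rewrite fg_restrU asboolT.
Qed.

End FreeGroupMaps.

(** * Ordered chains and combinatorial subdivision *)

Section OrderedChains.
Context {D : choiceType}.

(** Simplices are tuples over an arbitrary set of vertices. With a standard simplex as [D] these are
    the affine simplices, so the identities for cones and subdivision are proved once, without
    geometry. *)
Definition otuple k := {ffun 'I_k.+1 -> D}.

Definition tuple_face k (i : 'I_k.+2) (t : otuple k.+1) : otuple k :=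
  [ffun j => t (fintype.lift i j)].

Definition tuple_cons k (b : D) (t : otuple k) : otuple k.+1 :=
  [ffun i => if unlift ord0 i is Some j then t j else b].

Definition tuple_bdry k : {freeg otuple k.+1} -> {freeg otuple k} :=
  fglift (fun t => \sum_(i < k.+2) << (-1) ^+ i *g tuple_face i t >>).

HB.instance Definition _ k := GRing.isZmodMorphism.Build _ _ (@tuple_bdry k)
  (lift_is_additive _).

Definition tuple_cone k (b : D) : {freeg otuple k} -> {freeg otuple k.+1} :=
  fglift (fun t => << tuple_cons b t >>).

HB.instance Definition _ k b := GRing.isZmodMorphism.Build _ _ (@tuple_cone k b)
  (lift_is_additive _).

Lemma tuple_bdryU k (t : otuple k.+1) :
  tuple_bdry << t >> = \sum_(i < k.+2) << (-1) ^+ i *g tuple_face i t >>.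
Proof. exact: fg_liftU. Qed.

Lemma tuple_coneU k b (t : otuple k) : tuple_cone b << t >> = << tuple_cons b t >>.
Proof. exact: fg_liftU. Qed.

Lemma deg_tuple_bdry (c : {freeg otuple 1}) : deg (tuple_bdry c) = 0.
Proof.
apply: (@fg_lift0 _ _ (fun=> True) (@deg _ \o @tuple_bdry 0)) => // t _ /=.
by rewrite tuple_bdryU !big_ord_recr big_ord0 /= add0r raddfD /= !degU.
Qed.

Lemma tuple_bdry_cone0 b (c : {freeg otuple 0}) :
  tuple_bdry (tuple_cone b c) = c - << [ffun=> b] >> *~ deg c.
Proof.
apply: (fg_ind (P := fun c => tuple_bdry (tuple_cone b c) = c - << [ffun=> b] >> *~ deg c)).
- by rewrite !raddf0 addr0.
- move=> x y; rewrite !raddfB /= => -> ->.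
  by rewrite opprD addrACA.
move=> t _; rewrite tuple_coneU tuple_bdryU !big_ord_recl big_ord0 /= addr0.
rewrite degU mulr1z expr0 expr1 -freegUN; congr (<< _ >> - << _ >>).
  by apply/ffunP => j; rewrite !ffunE liftK.
apply/ffunP => j; rewrite !ffunE (_ : fintype.lift _ _ = ord0) ?unlift_none//.
by apply/val_inj; rewrite /= /bump /= !ord1.
Qed.

Lemma tuple_bdry_cone k b (c : {freeg otuple k.+1}) :
  tuple_bdry (tuple_cone b c) = c - tuple_cone b (tuple_bdry c).
Proof.
apply: (fg_ind (P := fun c => tuple_bdry (tuple_cone b c) = c - tuple_cone b (tuple_bdry c))).
- by rewrite !raddf0 addr0.
- by move=> x y; rewrite !raddfB /= => -> ->; rewrite opprD addrACA.
move=> t _; rewrite tuple_coneU !tuple_bdryU big_ord_recl /= expr0 raddf_sum -sumrN.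
congr (<< _ >> + _).
  by apply/ffunP => j; rewrite !ffunE liftK.
apply: eq_bigr => i _ /=.
rewrite [X in - tuple_cone _ X]fg_mulz raddfMz /= tuple_coneU -fg_mulz freegUN.
congr (<< _ *g _ >>); first by rewrite /= /bump /= exprS mulN1r.
apply/ffunP => j; rewrite !ffunE; case: (unliftP ord0 j) => [j' ->|->].
  rewrite (_ : fintype.lift _ _ = fintype.lift ord0 (fintype.lift i j')) ?liftK ?ffunE//.
  by apply/val_inj; rewrite /= /bump /= !add1n ltnS; case: leqP.
by rewrite (_ : fintype.lift _ _ = ord0) ?unlift_none//; apply/val_inj.
Qed.

Lemma tuple_cons_face k (t : otuple k.+1) :
  tuple_cons (t ord0) (tuple_face ord0 t) = t.
Proof.
by apply/ffunP => i; rewrite !ffunE; case: unliftP => [j ->|->//]; rewrite ffunE.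
Qed.

(** Every tuple is the cone over its zeroth face, so the cone formula gives the claim by induction,
    without manipulating a double sum. *)
Lemma tuple_bdry_bdry k (c : {freeg otuple k.+2}) : tuple_bdry (tuple_bdry c) = 0.
Proof.
elim: k => [|k IH] in c *.
all: apply: (@fg_lift0 _ _ (fun=> True) (@tuple_bdry _ \o @tuple_bdry _)) => // t _ /=.
all: rewrite -(tuple_cons_face t) -tuple_coneU tuple_bdry_cone raddfB /=.
  by rewrite tuple_bdry_cone0 deg_tuple_bdry mulr0z subr0 subrr.
by rewrite tuple_bdry_cone IH raddf0 subr0 subrr.
Qed.

(** Barycentric subdivision, for an arbitrary choice [bar] of "barycenters". *)
Variable bar : forall k, otuple k -> D.

Fixpoint tuple_sd k : {freeg otuple k} -> {freeg otuple k} :=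
  if k is k'.+1 then
    fglift (fun t => tuple_cone (bar t) (@tuple_sd k' (tuple_bdry << t >>)))
  else id.

Lemma tuple_sd_is_additive k : zmod_morphism (@tuple_sd k).
Proof. by case: k => // k; exact: lift_is_additive. Qed.

HB.instance Definition _ k := GRing.isZmodMorphism.Build _ _ (@tuple_sd k)
  (@tuple_sd_is_additive k).

Lemma tuple_sdU k (t : otuple k.+1) :
  tuple_sd << t >> = tuple_cone (bar t) (tuple_sd (tuple_bdry << t >>)).
Proof. exact: fg_liftU. Qed.

Lemma tuple_bdry_sd k (c : {freeg otuple k.+1}) :
  tuple_bdry (tuple_sd c) = tuple_sd (tuple_bdry c).
Proof.
elim: k => [|k IH] in c *.
all: apply: (@fg_ext _ _ (@tuple_bdry _ \o @tuple_sd _)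
  (@tuple_sd _ \o @tuple_bdry _)) => t _ /=.
all: rewrite -/(tuple_sd _) -/(@tuple_sd _.+1 << t >>) tuple_sdU.
  by rewrite tuple_bdry_cone0 deg_tuple_bdry mulr0z subr0.
by rewrite tuple_bdry_cone IH tuple_bdry_bdry !raddf0 addr0.
Qed.

Definition tuple_sdn n k : {freeg otuple k} -> {freeg otuple k} :=
  iter n (@tuple_sd k).

Lemma tuple_sdn_is_additive n k : zmod_morphism (@tuple_sdn n k).
Proof.
by elim: n => // n IH a b; rewrite /tuple_sdn /= -!/(tuple_sdn _ _) IH raddfB.
Qed.

HB.instance Definition _ n k := GRing.isZmodMorphism.Build _ _ (@tuple_sdn n k)
  (@tuple_sdn_is_additive n k).

Lemma tuple_bdry_sdn n k (c : {freeg otuple k.+1}) :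
  tuple_bdry (tuple_sdn n c) = tuple_sdn n (tuple_bdry c).
Proof.
by elim: n => // n IH; rewrite /tuple_sdn /= -!/(tuple_sdn _ _) tuple_bdry_sd IH.
Qed.

End OrderedChains.
Arguments otuple D k : clear implicits.
Section TupleMaps.
Context {D D' : choiceType} (f : D -> D').

Definition tuple_map k (t : otuple D k) : otuple D' k := [ffun j => f (t j)].

Definition tuple_push k : {freeg otuple D k} -> {freeg otuple D' k} :=
  fglift (fun t => << tuple_map t >>).

HB.instance Definition _ k := GRing.isZmodMorphism.Build _ _ (@tuple_push k)
  (lift_is_additive _).

Lemma tuple_pushU k (t : otuple D k) : tuple_push << t >> = << tuple_map t >>.
Proof. exact: fg_liftU. Qed.

Lemma tuple_push_cone k b (c : {freeg otuple D k}) :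
  tuple_push (tuple_cone b c) = tuple_cone (f b) (tuple_push c).
Proof.
apply: (@fg_ext _ _ (@tuple_push _ \o tuple_cone b)
  (tuple_cone (f b) \o @tuple_push _)) => t _ /=.
rewrite tuple_coneU !tuple_pushU tuple_coneU; congr (<< _ >>).
by apply/ffunP => j; rewrite !ffunE; case: unliftP => // i _; rewrite ffunE.
Qed.

Lemma tuple_push_bdry k (c : {freeg otuple D k.+1}) :
  tuple_push (tuple_bdry c) = tuple_bdry (tuple_push c).
Proof.
apply: (@fg_ext _ _ (@tuple_push _ \o @tuple_bdry _ _)
  (@tuple_bdry _ _ \o @tuple_push _)) => t _ /=.
rewrite tuple_pushU !tuple_bdryU raddf_sum; apply: eq_bigr => i _ /=.
rewrite fg_mulz raddfMz /= tuple_pushU -fg_mulz; congr (<< _ *g _ >>).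
by apply/ffunP => j; rewrite !ffunE.
Qed.

Context (bar : forall k, otuple D k -> D) (bar' : forall k, otuple D' k -> D').
Hypothesis f_bar : forall k (t : otuple D k), f (bar t) = bar' (tuple_map t).

Lemma tuple_push_sd k (c : {freeg otuple D k}) :
  tuple_push (tuple_sd bar c) = tuple_sd bar' (tuple_push c).
Proof.
elim: k => // k IH in c *.
apply: (@fg_ext _ _ (@tuple_push _ \o @tuple_sd _ bar _)
  (@tuple_sd _ bar' _ \o @tuple_push _)) => t _.
rewrite -[LHS]/(tuple_push (tuple_sd bar << t >>)).
rewrite -[RHS]/(tuple_sd bar' (tuple_push << t >>)) tuple_pushU !tuple_sdU tuple_push_cone f_bar IH.
by rewrite tuple_push_bdry tuple_pushU.
Qed.

Lemma tuple_push_sdn n k (c : {freeg otuple D k}) :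
  tuple_push (tuple_sdn bar n c) = tuple_sdn bar' n (tuple_push c).
Proof.
by elim: n => // n IH; rewrite /tuple_sdn /= -!/(tuple_sdn _ _ _) tuple_push_sd IH.
Qed.

End TupleMaps.

(** * Affine simplices and subdivision of singular chains *)

Section AffineSimplices.
Context {R : realType}.
Implicit Types (k l m : nat).

Local Notation Simplex m := (@stdsimplex R m).

Definition affine_fun k m (t : otuple (Simplex m) k) (x : 'rV[R]_k.+1) :
  'rV[R]_m.+1 := \sum_j x 0 j *: val (t j).

Lemma affine_fun_stdsimplex k m (t : otuple (Simplex m) k) (x : Simplex k) :
  affine_fun t (val x) \in Simplex m.
Proof.
have [x0 x1] := set_valP x; apply/mem_set; split=> [i|].
  rewrite summxE sumr_ge0// => j _; rewrite mxE mulr_ge0//.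
  by have [] := set_valP (t j).
under eq_bigr do rewrite summxE.
rewrite exchange_big /= -x1; apply: eq_bigr => j _.
under eq_bigr do rewrite mxE.
by rewrite -mulr_sumr; have [_ ->] := set_valP (t j); rewrite mulr1.
Qed.

Definition affine_simplex k m (t : otuple (Simplex m) k) (x : Simplex k) :
  Simplex m := exist _ (affine_fun t (val x)) (affine_fun_stdsimplex t x).

Lemma affine_simplex_continuous k m (t : otuple (Simplex m) k) :
  continuous (affine_simplex t).
Proof.
apply: continuous_comp_initial => x.
apply: (@continuous_comp _ _ _ (@set_val _ (@stdsimplex R k)) (affine_fun t)).
  exact: initial_continuous.
apply: (@cvg_big _ _ _ _ _ _ _ _ _ _ _ (nbhs_filter _)) => [|j _].
  exact: add_continuous.
apply: (@cvgZr_tmp _ _ _ _ (nbhs_filter _)).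
exact: coord_continuous.
Qed.

HB.instance Definition _ k m t :=
  isContinuous.Build _ _ _ (@affine_simplex_continuous k m t).

End AffineSimplices.
HB.instance Definition _ (R : realType) (T : topologicalType) k :=
  GRing.isZmodMorphism.Build _ _ (@bdry R T k) (lift_is_additive _).

HB.instance Definition _ (R : realType) (S T : topologicalType)
    (f : continuousType S T) k :=
  GRing.isZmodMorphism.Build _ _ (@push R S T f k) (lift_is_additive _).

Section Subdivision.
Context {R : realType}.
Implicit Types (k l m : nat) (T : topologicalType).

Local Notation Simplex m := (@stdsimplex R m).

Lemma affine_simplexE k m (t : otuple (Simplex m) k) (x : Simplex k) :
  val (affine_simplex t x) = \sum_j (val x) 0 j *: val (t j).
Proof. by []. Qed.

Lemma vertex_stdsimplex k (j : 'I_k.+1) : delta_mx 0 j \in Simplex k.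
Proof.
apply/mem_set; split=> [i|]; first by rewrite mxE eqxx /= ler0n.
rewrite (bigD1 j) //= mxE !eqxx big1 ?addr0// => i ij.
by rewrite mxE (negPf ij) andbF.
Qed.

Definition vertex k (j : 'I_k.+1) : Simplex k :=
  exist _ (delta_mx 0 j) (vertex_stdsimplex j).

Definition vertices k : otuple (Simplex k) k := [ffun j => vertex j].

Lemma center_stdsimplex k : const_mx k.+1%:R^-1 \in Simplex k.
Proof.
apply/mem_set; split=> [i|]; first by rewrite mxE invr_ge0 ler0n.
under eq_bigr do rewrite mxE.
by rewrite sumr_const card_ord -[_ *+ _]mulr_natr mulVf// pnatr_eq0.
Qed.

Definition center k : Simplex k := exist _ (const_mx k.+1%:R^-1) (center_stdsimplex k).

Definition barycenter m k (t : otuple (Simplex m) k) : Simplex m :=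
  affine_simplex t (center k).

Lemma affine_comp k l m (r : otuple (Simplex m) l) (t : otuple (Simplex l) k) x :
  affine_simplex r (affine_simplex t x) =
  affine_simplex (tuple_map (affine_simplex r) t) x.
Proof.
apply/val_inj; rewrite !affine_simplexE.
under eq_bigr do rewrite summxE scaler_suml.
rewrite exchange_big /=; apply: eq_bigr => j _.
rewrite ffunE affine_simplexE scaler_sumr; apply: eq_bigr => i _.
by rewrite mxE scalerA.
Qed.

Lemma affine_vertices k (x : Simplex k) : affine_simplex (vertices k) x = x.
Proof.
apply/val_inj; rewrite affine_simplexE [RHS]row_sum_delta.
by apply: eq_bigr => i _; rewrite ffunE.
Qed.

Lemma affine_vertex k m (t : otuple (Simplex m) k) j :
  affine_simplex t (vertex j) = t j.
Proof.
apply/val_inj; rewrite affine_simplexE (bigD1 j)//= mxE !eqxx scale1r big1 ?addr0//.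
by move=> i ij; rewrite mxE (negPf ij) andbF scale0r.
Qed.

Lemma affine_face k m (t : otuple (Simplex m) k.+1) i (x : Simplex k) :
  affine_simplex t (face i x) = affine_simplex (tuple_face i t) x.
Proof.
apply/val_inj; rewrite !affine_simplexE (bigD1_ord i) //= mxE unlift_none scale0r add0r.
by apply: eq_bigr => j _; rewrite mxE liftK ffunE.
Qed.

Lemma face_affine k i (x : Simplex k) :
  face i x = affine_simplex (tuple_face i (vertices k.+1)) x.
Proof. by rewrite -affine_face affine_vertices. Qed.

Lemma affine_barycenter l m (r : otuple (Simplex m) l) k (t : otuple (Simplex l) k) :
  affine_simplex r (barycenter t) = barycenter (tuple_map (affine_simplex r) t).
Proof. exact: affine_comp. Qed.

Lemma tuple_map_vertices k m (t : otuple (Simplex m) k) :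
  tuple_map (affine_simplex t) (vertices k) = t.
Proof. by apply/ffunP => j; rewrite !ffunE affine_vertex. Qed.

Notation sdn n := (tuple_sdn (@barycenter _) n).

Definition realize m T (s : ssimplex R m T) k :
  {freeg otuple (Simplex m) k} -> chain R k T :=
  fglift (fun t => << ((s : continuousType _ _) \o affine_simplex t : ssimplex R k T) >>).

HB.instance Definition _ m T (s : ssimplex R m T) k :=
  GRing.isZmodMorphism.Build _ _ (@realize m T s k) (lift_is_additive _).

Lemma realizeU m T (s : ssimplex R m T) k (t : otuple (Simplex m) k) :
  realize s << t >> = << ((s : continuousType _ _) \o affine_simplex t : ssimplex R k T) >>.
Proof. exact: fg_liftU. Qed.

Lemma bdryU T k (s : ssimplex R k.+1 T) : bdry << s >> = \sum_(i < k.+2)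
    << (-1) ^+ i *g ((s : continuousType _ _) \o @face R k i : ssimplex R k T) >>.
Proof. exact: fg_liftU. Qed.

Lemma pushU (S T : topologicalType) (f : continuousType S T) k (s : ssimplex R k S) :
  push f << s >> = << push_simplex f s >>.
Proof. exact: fg_liftU. Qed.

Lemma bdry_realize m T (s : ssimplex R m T) k (c : {freeg otuple (Simplex m) k.+1}) :
  bdry (realize s c) = realize s (tuple_bdry c).
Proof.
apply: (@fg_ext _ _ (@bdry R T k \o @realize m T s _)
  (@realize m T s _ \o @tuple_bdry _ _)) => t _ /=.
rewrite realizeU tuple_bdryU bdryU raddf_sum; apply: eq_bigr => i _ /=.
rewrite [in RHS]fg_mulz raddfMz /= realizeU -fg_mulz; congr << _ *g _ >>.
by apply/continuousEP => x /=; rewrite affine_face.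
Qed.

Lemma realize_affine l m T (s : ssimplex R m T) (r : otuple (Simplex m) l) k
    (c : {freeg otuple (Simplex l) k}) :
  realize ((s : continuousType _ _) \o affine_simplex r : ssimplex R l T) c =
  realize s (tuple_push (affine_simplex r) c).
Proof.
apply: (@fg_ext _ _ (@realize _ T _ _)
  (@realize m T s _ \o @tuple_push _ _ (affine_simplex r) _)) => t _ /=.
rewrite tuple_pushU !realizeU; congr (<< _ >>).
by apply/continuousEP => x /=; rewrite affine_comp.
Qed.

Lemma realize_vertices k T (s : ssimplex R k T) : realize s << vertices k >> = << s >>.
Proof.
rewrite realizeU; congr (<< _ >>).
by apply/continuousEP => x /=; rewrite affine_vertices.
Qed.

Lemma push_realize (S T : topologicalType) (f : continuousType S T) m
    (s : ssimplex R m S) k (c : {freeg otuple (Simplex m) k}) :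
  push f (realize s c) = realize (push_simplex f s) c.
Proof.
apply: (@fg_ext _ _ (@push _ _ _ f k \o @realize _ S s _) (@realize m T _ _)) => t _ /=.
by rewrite !realizeU pushU; congr (<< _ >>); apply/continuousEP.
Qed.

Lemma bdry_bdry T k (c : chain R k.+2 T) : bdry (bdry c) = 0.
Proof.
apply: (@fg_lift0 _ _ (fun=> True) (@bdry R T _ \o @bdry R T _)) => // s _ /=.
by rewrite -realize_vertices !bdry_realize tuple_bdry_bdry raddf0.
Qed.

Definition sd n T k : chain R k T -> chain R k T :=
  fglift (fun s : ssimplex R k T => realize s (sdn n << vertices k >>)).

HB.instance Definition _ n T k :=
  GRing.isZmodMorphism.Build _ _ (@sd n T k) (lift_is_additive _).

Lemma sdU n T k (s : ssimplex R k T) :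
  sd n << s >> = realize s (sdn n << vertices k >>).
Proof. exact: fg_liftU. Qed.

(** Affine maps carry barycenters to barycenters, so subdivision of a realised affine chain can be
    computed in the combinatorial model. Compatibility of [sd] with boundaries and iteration follows
    from this. *)
Lemma sd_realize n m T (s : ssimplex R m T) k (c : {freeg otuple (Simplex m) k}) :
  sd n (realize s c) = realize s (sdn n c).
Proof.
apply: (@fg_ext _ _ (@sd n T k \o @realize _ _ s _)
  (@realize _ _ s _ \o tuple_sdn (@barycenter _) n (k:=k))) => t _ /=.
rewrite realizeU sdU realize_affine.
rewrite (tuple_push_sdn (@affine_barycenter _ _ t)) tuple_pushU.
by rewrite tuple_map_vertices.
Qed.

Lemma bdry_sd n T k (c : chain R k.+1 T) : bdry (sd n c) = sd n (bdry c).
Proof.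
apply: (@fg_ext _ _ (@bdry R T k \o @sd n T _) (@sd n T k \o @bdry R T _)) => s _ /=.
by rewrite -realize_vertices bdry_realize !sd_realize bdry_realize tuple_bdry_sdn.
Qed.

Lemma push_sd n (S T : topologicalType) (f : continuousType S T) k (c : chain R k S) :
  push f (sd n c) = sd n (push f c).
Proof.
apply: (@fg_ext _ _ (@push R S T f k \o @sd n S k) (@sd n T k \o @push R S T f k)) => s _ /=.
by rewrite sdU push_realize pushU sdU.
Qed.

Lemma sd_add n n' T k (c : chain R k T) : sd n (sd n' c) = sd (n + n') c.
Proof.
apply: (@fg_ext _ _ (@sd n T k \o @sd n' T k) (@sd (n + n') T k)) => s _ /=.
by rewrite !sdU sd_realize /tuple_sdn iterD.
Qed.

Lemma sd0 T k (c : chain R k T) : sd 0 c = c.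
Proof.
rewrite -[RHS]/(idfun c); apply: fg_ext => s _ /=.
by rewrite sdU realize_vertices.
Qed.

End Subdivision.

(** * Mesh of iterated subdivisions *)

Lemma compact_set_type (X : topologicalType) (A : set X) :
  compact A -> compact [set: set_type A].
Proof.
move=> /compact_near_coveringP cA; apply/compact_near_coveringP => I F P FF FP.
have : \forall i \near F, A `<=` (fun x => forall Ax : x \in A, P i (exist _ x Ax)).
  apply: cA => x /mem_set Ax.
  have [[V W] /= [nV FW] VW] := FP (exist _ x Ax) Logic.I.
  move: nV => [_ [[V' oV' <-] V'x V'V]].
  exists (V', W) => /=; first by split=> //; exact: open_nbhs_nbhs.
  by move=> [y i] /= [V'y Wi] Ay; apply: (VW (_, i)); split=> //; exact: V'V.
by apply: filterS => i Ai [x Ax] _; apply: Ai => //; exact/set_mem.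
Qed.

Lemma rV_norm_le (R : realType) n (x : 'rV[R]_n) r :
  0 <= r -> (`|x| <= r <-> forall i, `|x 0 i| <= r).
Proof.
move=> r0; change (mx_norm x <= r <-> forall i, `|x 0 i| <= r).
rewrite mx_normrE; split=> [/bigmax_leP[_ xr] i|xr]; first exact: (xr (0, i)).
by apply/bigmax_leP; split=> // -[i j] _ /=; rewrite ord1.
Qed.

Section Mesh.
Context {R : realType}.
Implicit Types (k l m : nat) (T : topologicalType).

Local Notation Simplex m := (@stdsimplex R m).
Local Notation bary := (@barycenter R _).

Lemma stdsimplex_compact k : compact (@stdsimplex R k).
Proof.
apply: bounded_closed_compact.
  exists 1; split=> // M M1 x [x0 x1]; rewrite /=.
  apply/rV_norm_le => [|j]; first exact: le_trans ler01 (ltW M1).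
  rewrite ger0_norm// (le_trans _ (ltW M1))// -x1 (bigD1 j)//= lerDl.
  by rewrite sumr_ge0.
have cc j : continuous (fun x : 'rV[R]_k.+1 => x 0 j) by exact: coord_continuous.
rewrite (_ : @stdsimplex R k = (\bigcap_j (fun x : 'rV[R]_k.+1 => x 0 j) @^-1` [set y | 0 <= y])
   `&` (fun x : 'rV[R]_k.+1 => \sum_i x 0 i) @^-1` [set 1]).
  apply: closedI.
    apply: closed_bigI => j _; apply: (iffLR (continuous_closedP _) (cc j)); exact: closed_ge.
  apply: (iffLR (continuous_closedP _)); last exact: closed_eq.
  move=> x; apply: (@cvg_big _ _ _ _ _ _ _ _ _ _ _ (nbhs_filter _)) => [|j _].
    exact: add_continuous.
  exact: cc.
apply/seteqP; split=> x [x0 x1]; split=> // j; first by move=> _; exact: x0.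
exact: (x0 j Logic.I).
Qed.

(** A form of "[x] lies in the convex hull of [t]" that only refers to balls. *)
Definition in_hull k m (t : otuple (Simplex m) k) (x : Simplex m) :=
  forall v r, (forall j, `|v - val (t j)| <= r) -> `|v - val x| <= r.

Definition mesh_le k m (t : otuple (Simplex m) k) (d : R) :=
  forall i j, `|val (t i) - val (t j)| <= d.

Lemma affine_in_hull k m (t : otuple (Simplex m) k) x :
  in_hull t (affine_simplex t x).
Proof.
move=> v r tr; have [x0 x1] := set_valP x.
have -> : v - val (affine_simplex t x) = \sum_j val x 0 j *: (v - val (t j)).
  rewrite affine_simplexE; under [RHS]eq_bigr do rewrite scalerBr.
  by rewrite sumrB -scaler_suml x1 scale1r.
rewrite (le_trans (ler_norm_sum _ _ _))// -[leRHS]mul1r -x1 mulr_suml.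
apply: ler_sum => j _; rewrite normrZ ger0_norm; last exact: x0.
by rewrite ler_wpM2l ?x0.
Qed.

(** The term of the vertex [j] itself vanishes, which leaves [k] of the [k.+1] equal weights; this
    is the source of the contraction factor. *)
Lemma mesh_barycenter k m (t : otuple (Simplex m) k) d j : mesh_le t d ->
  `|val (barycenter t) - val (t j)| <= k%:R / k.+1%:R * d.
Proof.
move=> td.
have -> : val (barycenter t) - val (t j) =
    \sum_i k.+1%:R^-1 *: (val (t i) - val (t j)).
  rewrite affine_simplexE; under [RHS]eq_bigr do rewrite scalerBr.
  rewrite sumrB sumr_const card_ord -(scaler_nat _ (_ *: _)) scalerA divff ?pnatr_eq0//.
  by rewrite scale1r; congr (_ - _); apply: eq_bigr => i _; rewrite mxE.
rewrite (bigD1 j)//= subrr scaler0 add0r (le_trans (ler_norm_sum _ _ _))//.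
rewrite (@le_trans _ _ (\sum_(i < k.+1 | i != j) k.+1%:R^-1 * d))//.
  apply: ler_sum => i _; rewrite normrZ ger0_norm ?invr_ge0//.
  by apply: ler_wpM2l; rewrite ?invr_ge0//; exact: td.
rewrite sumr_const cardC1 card_ord -[_ *+ _]mulr_natl mulrA /=.
by [].
Qed.

(** The hull clause is carried through the induction because it bounds the new edges: the distance
    from the barycenter to a vertex of the subdivided face is controlled by the distances to the old
    vertices. *)
Lemma mesh_sd k m (t : otuple (Simplex m) k) d : mesh_le t d ->
  fg_in (fun r => mesh_le r (k%:R / k.+1%:R * d) /\ forall i, in_hull t (r i))
    (tuple_sd bary << t >>).
Proof.
elim: k => [|k IH] in t d *; move=> td.
  apply: fg_inU; split=> [i j|i v r]; last exact.
  by rewrite !ord1 subrr normr0 mul0r mul0r.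
have d0 : 0 <= d by apply: le_trans (td ord0 ord0).
have dd : k%:R / k.+1%:R * d <= k.+1%:R / k.+2%:R * d.
  rewrite ler_wpM2r// ler_pdivrMr// mulrAC ler_pdivlMr// -!natrM ler_nat.
  by rewrite mulnC !mulSn !mulnS; lia.
rewrite tuple_sdU tuple_bdryU raddf_sum raddf_sum; apply: fg_in_sum => i _ /=.
rewrite [X in tuple_sd _ X]fg_mulz !raddfMz /=; apply: fg_in_mulz.
apply: fg_lift_in (IH _ d _) => [r [rd rt]|a b]; last by rewrite !ffunE.
rewrite /= tuple_coneU; apply: fg_inU.
have rt' a : in_hull t (r a).
  by move=> v e te; apply: rt => b; rewrite ffunE.
have br a : `|val (barycenter t) - val (r a)| <= k.+1%:R / k.+2%:R * d.
  by apply: rt' => b; exact: mesh_barycenter.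
split=> [a b|a]; last first.
  by rewrite ffunE; case: unliftP => // _; exact: affine_in_hull.
rewrite !ffunE; case: unliftP => [a' _|_]; case: unliftP => [b' _|_].
- exact: le_trans dd.
- by rewrite distrC.
- exact: br.
- by rewrite subrr normr0 mulr_ge0// divr_ge0.
Qed.

Lemma mesh_sdn n k m (t : otuple (Simplex m) k) d : mesh_le t d ->
  fg_in (fun r => mesh_le r ((k%:R / k.+1%:R) ^+ n * d)) (tuple_sdn bary n << t >>).
Proof.
move=> td; elim: n => [|n IH]; first by apply: fg_inU; rewrite expr0 mul1r.
rewrite -[tuple_sdn _ _ _]/(tuple_sd bary (tuple_sdn bary n << t >>)).
apply: fg_lift_in IH => r /mesh_sd.
by apply: fg_in_sub => r' []; rewrite exprS mulrA.
Qed.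

Lemma mesh_ex k m (t : otuple (Simplex m) k) : exists d, mesh_le t d.
Proof.
exists (\sum_p `|val (t p.1) - val (t p.2)|) => i j.
by rewrite (bigD1 (i, j))//= lerDl sumr_ge0.
Qed.

(** The estimate lives on the model simplex, so the number of subdivisions is uniform in [T] and
    [s]. *)
Lemma sd_fine k (e : R) : 0 < e -> \forall n \near \oo, forall T (s : ssimplex R k T),
  fg_in (fun u : ssimplex R k T => exists x : Simplex k, forall z, exists2 y,
    `|val x - val y| < e & (u : continuousType _ _) z = (s : continuousType _ _) y)
    (sd n << s >>).
Proof.
move=> e0; have [d vd] := mesh_ex (@vertices R k).
have q1 : `|k%:R / k.+1%:R : R| < 1.
  by rewrite ger0_norm ?divr_ge0// ltr_pdivrMr// mul1r ltr_nat.
have qd : (k%:R / k.+1%:R) ^+ n * d @[n --> \oo] --> (0 : R).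
  by rewrite -(mul0r d); apply: cvgM; [exact: cvg_expr|exact: cvg_cst].
near=> n => T s.
have nd : (k%:R / k.+1%:R) ^+ n * d < e.
  by near: n; apply: (cvgr_lt _ qd).
rewrite sdU; apply: fg_lift_in (mesh_sdn (n := n) vd) => r rd.
rewrite /= realizeU; apply: fg_inU; exists (r ord0) => z.
exists (affine_simplex r z) => //.
by apply: le_lt_trans nd; apply: affine_in_hull => j; exact: rd.
Unshelve. all: by end_near. Qed.

End Mesh.

(** * Sperner's lemma modulo 2 *)

Section FreeGroupHom.
Context {K : choiceType} {V : zmodType}.

Definition fg_hom (f : K -> V) (c : {freeg K}) : V :=
  fglift (f : K -> zmodule V) c.

Lemma fg_hom_is_additive f : zmod_morphism (fg_hom f).
Proof. exact: (lift_is_additive (f : K -> zmodule V)). Qed.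

HB.instance Definition _ f :=
  GRing.isZmodMorphism.Build _ _ (fg_hom f) (fg_hom_is_additive f).

Lemma fg_homU f x : fg_hom f << x >> = f x.
Proof. by rewrite /fg_hom fg_liftU. Qed.

End FreeGroupHom.

Lemma boolMsign (b : bool) i : b *~ (-1) ^+ i = b.
Proof. by rewrite -signr_odd; case: odd; case: b. Qed.

Lemma fg_bool_sign (K : choiceType) (f : {additive {freeg K} -> bool}) i x :
  f << (-1) ^+ i *g x >> = f << x >>.
Proof. by rewrite fg_mulz raddfMz boolMsign. Qed.

Section Sperner.

(** Over the field [bool], the number (mod 2) of bijections from the entries of
    [f] to the colours [0, ..., k]. *)
Definition rainbow k (f : 'I_k.+1 -> nat) : bool :=
  \det (\matrix_(i < k.+1, j < k.+1) (f i == j :> nat)).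

Lemma rainbow_missing k (f : 'I_k.+1 -> nat) (c : 'I_k.+1) :
  (forall i, f i <> c) -> rainbow f = false.
Proof.
move=> fc; rewrite /rainbow (expand_det_col _ c) big1// => i _.
by rewrite mxE; case: eqP => [/fc//|_]; rewrite mul0r.
Qed.

Lemma rainbow0 (f : 'I_1 -> nat) : rainbow f = (f ord0 == 0)%N.
Proof. by rewrite /rainbow det_mx11 mxE. Qed.

(** Adding all columns to the last one turns it into a column of ones. *)
Lemma rainbow_faces k (f : 'I_k.+2 -> nat) : (forall i, f i <= k.+1)%N ->
  \sum_(i < k.+2) rainbow (f \o fintype.lift i) = rainbow f.
Proof.
move=> fk.
pose A := \matrix_(i < k.+2, j < k.+2) (f i == j :> nat).
pose U : 'M[bool]_k.+2 := \matrix_(i, j) ((i == j) || (j == ord_max)).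
have detU : \det U = 1.
  rewrite -det_tr det_trig; last first.
    apply/is_trig_mxP => i j ij; rewrite !mxE -!val_eqE /=.
    rewrite gtn_eqF//=; have := ltn_ord j; case: eqP => // e; lia.
  by apply: big1 => i _; rewrite !mxE eqxx.
pose B : 'M[bool]_k.+2 := A *m U.
have AU i j : B i j = (j == ord_max) || (f i == j :> nat).
  rewrite mxE; have [->|jm] := eqVneq j ord_max.
    rewrite (bigD1 (inord (f i))) //= big1 => [|l li].
      by rewrite !mxE eqxx orbT inordK ?ltnS ?fk// eqxx.
    rewrite !mxE; case: eqP => [e|_]; last by rewrite mul0r.
    by move: li; rewrite -val_eqE /= inordK ?ltnS ?fk// e eqxx.
  rewrite (bigD1 j) //= big1 => [|l lj]; rewrite !mxE.
    by rewrite eqxx /=; case: (_ == _).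
  by rewrite (negPf lj) (negPf jm) mulr0.
have <- : \det B = rainbow f by rewrite /B det_mulmx detU mulr1.
(* Over [bool] the expansion along the column of ones carries no signs, and deleting row [i] and
   that column leaves the matrix of the [i]-th face. *)
rewrite (expand_det_col _ ord_max); apply: eq_bigr => i _.
apply: (@etrans _ _ (1 * cofactor B i ord_max)); last first.
  have e : B i ord_max = true by have := AU i ord_max; rewrite eqxx.
  exact: (congr1 (fun b : bool => b && cofactor B i ord_max) (esym e)).
rewrite mul1r /cofactor -signr_odd.
have -> (b : bool) : (-1) ^+ b = 1 :> bool by case: b.
rewrite mul1r; congr (\det _); apply/matrixP => i' j'.
rewrite mxE 2![RHS]mxE; apply/esym/(etrans (AU _ _)).
rewrite -[_ == ord_max]negbK eq_sym neq_lift /=.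
by rewrite /bump leqNgt ltn_ord.
Qed.

End Sperner.
Lemma tuple_sd_in (D : choiceType) (bar : forall k, otuple D k -> D) (Q : D -> Prop) k
    (c : {freeg otuple D k}) :
  (forall k (t : otuple D k), (forall j, Q (t j)) -> Q (bar k t)) ->
  fg_in (fun t : otuple D k => forall j, Q (t j)) c ->
  fg_in (fun t : otuple D k => forall j, Q (t j)) (tuple_sd bar c).
Proof.
move=> Qbar; elim: k => [//|k IH] in c * => Qc.
apply: fg_lift_in Qc => t Qt.
rewrite -[X in fg_in _ X]/(tuple_sd bar << t >>) tuple_sdU.
apply: fg_lift_in (IH _ _) => [r Qr|].
  rewrite /= tuple_coneU; apply: fg_inU => j.
  by rewrite ffunE; case: unliftP => // _; exact: Qbar.
by rewrite tuple_bdryU; apply: fg_in_sum => i _; apply: fg_inU => j; rewrite ffunE.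
Qed.

Lemma tuple_sdn_in (D : choiceType) (bar : forall k, otuple D k -> D) (Q : D -> Prop) n k
    (c : {freeg otuple D k}) :
  (forall k (t : otuple D k), (forall j, Q (t j)) -> Q (bar k t)) ->
  fg_in (fun t : otuple D k => forall j, Q (t j)) c ->
  fg_in (fun t : otuple D k => forall j, Q (t j)) (tuple_sdn bar n c).
Proof. by move=> Qbar Qc; elim: n => // n; exact: tuple_sd_in. Qed.

Section SpernerLemma.
Context {R : realType} {n : nat}.

Local Notation Simplex m := (@stdsimplex R m).

Context (col : Simplex n -> 'I_n.+1).
Hypothesis col_gt0 : forall x : Simplex n, 0 < val x 0 (col x).

Definition rainbow_count k : {freeg otuple (Simplex n) k} -> bool :=
  fg_hom (fun t : otuple (Simplex n) k => rainbow (fun j => col (t j))).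

HB.instance Definition _ k := GRing.isZmodMorphism.Build _ _ (@rainbow_count k)
  (fg_hom_is_additive _).

Lemma rainbow_countU k (t : otuple (Simplex n) k) :
  rainbow_count << t >> = rainbow (fun j => col (t j)).
Proof. exact: fg_homU. Qed.

Lemma rainbow_count_bdry k (c : {freeg otuple (Simplex n) k.+1}) :
  fg_in (fun t : otuple (Simplex n) k.+1 => forall j, col (t j) <= k.+1)%N c ->
  rainbow_count (tuple_bdry c) = rainbow_count c.
Proof.
move=> ck; apply: (@fg_ext _ _ (@rainbow_count _ \o @tuple_bdry _ _)) => t /ck tk /=.
rewrite tuple_bdryU raddf_sum rainbow_countU -rainbow_faces//.
apply: eq_bigr => i _; rewrite fg_bool_sign /= rainbow_countU.
by congr rainbow; apply/funext => j; rewrite ffunE.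
Qed.

Lemma barycenter_coord0 i k (t : otuple (Simplex n) k) :
  (forall j, val (t j) 0 i = 0) -> val (barycenter t) 0 i = 0.
Proof.
move=> ti; rewrite affine_simplexE summxE big1// => j _.
by rewrite mxE ti mulr0.
Qed.

Definition initial_vertices m : otuple (Simplex n) m :=
  [ffun j : 'I_m.+1 => vertex (inord j)].

(** Induction on the face spanned by the first vertices: by [rainbow_count_bdry] it suffices to
    count on the boundary, where only the face opposite to the last vertex contributes. *)
Lemma sperner K m : (m <= n)%N ->
  rainbow_count (tuple_sdn (@barycenter R _) K << initial_vertices m >>) = true.
Proof.
elim: m => [|m IH] mn.
  have -> : tuple_sdn (@barycenter R _) K << initial_vertices 0 >> =
      << initial_vertices 0 >> by elim: K.
  rewrite rainbow_countU rainbow0 ffunE.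
  have := col_gt0 (vertex (inord (@ord0 0))); rewrite mxE eqxx /=.
  case: eqP => [->|_]; last by rewrite ltxx.
  by rewrite inordK.
rewrite -rainbow_count_bdry.
  rewrite tuple_bdry_sdn tuple_bdryU !raddf_sum (bigD1 ord_max)//= big1 ?addr0 => [|i im].
    rewrite [X in tuple_sdn _ _ X]fg_mulz 2!raddfMz boolMsign -(IH (ltnW mn)) /=.
    congr (rainbow_count (tuple_sdn _ _ << _ >>)).
    by apply/ffunP => j; rewrite !ffunE lift_max.
  (* The face opposite to vertex [i] and its subdivisions lie where the [i]-th coordinate vanishes,
     so colour [i] does not occur there. *)
  rewrite [X in tuple_sdn _ _ X]fg_mulz 2!raddfMz boolMsign /=.
  have im' : (i < m.+1)%N by rewrite ltn_neqAle -ltnS ltn_ord andbT.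
  have in' : (i < n.+1)%N by lia.
  apply: (@fg_lift0 _ _ _ (@rainbow_count _)); last first.
    apply: (@tuple_sdn_in _ _ (fun x : Simplex n => val x 0 (Ordinal in') = 0)).
      by move=> k t; exact: barycenter_coord0.
    apply: fg_inU => j; rewrite !ffunE mxE eqxx /=; case: eqP => // /(congr1 val) /=.
    rewrite inordK; last by have /= := ltn_ord (fintype.lift i j); lia.
    by move=> e; have := neq_lift i j; rewrite -val_eqE /= -e eqxx.
  move=> t ti /=; rewrite rainbow_countU.
  apply: (@rainbow_missing _ _ (Ordinal im')) => j /= e.
  have := col_gt0 (t j); rewrite (_ : col (t j) = Ordinal in') ?ti ?ltxx//.
  exact/val_inj.
(* Subdivision stays in the chosen face, so no colour above [m.+1] occurs, as [rainbow_count_bdry]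
   requires. *)
pose Q (x : Simplex n) := forall i : 'I_n.+1, (m.+1 < i)%N -> val x 0 i = 0.
apply: (@fg_in_sub _ (fun t : otuple _ _ => forall j, Q (t j))); last first.
  apply: tuple_sdn_in => [k t H i mi|].
    by apply: barycenter_coord0 => j; exact: H.
  apply: fg_inU => j i mi; rewrite ffunE mxE eqxx /=; case: eqP => // e.
  by move: mi; rewrite e inordK; have := ltn_ord j; lia.
move=> t H j; rewrite leqNgt; apply/negP => /H e.
by have := col_gt0 (t j); rewrite e ltxx.
Qed.

Lemma sperner_vertices K :
  rainbow_count (tuple_sdn (@barycenter R _) K << vertices n >>) = true.
Proof.
rewrite -(sperner K (leqnn n)); congr (rainbow_count (tuple_sdn _ _ << _ >>)).
by apply/ffunP => j; rewrite !ffunE inord_val.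
Qed.

End SpernerLemma.

(** * Small simplices, charts and the local degree modulo 2 *)

Section SmallSimplices.
Context {R : realType}.

(** A Lebesgue number of the cover pulled back to the compact simplex, combined with [sd_fine]. *)
Lemma sd_cover k (T : topologicalType) (s : ssimplex R k T) (I : Type) (G : I -> set T) :
  (forall i, open (G i)) -> (forall x, exists i, G i ((s : continuousType _ _) x)) ->
  \forall n \near \oo, fg_in (fun u : ssimplex R k T =>
    exists i, range (u : continuousType _ _) `<=` G i) (sd n << s >>).
Proof.
move=> oG sG.
have := compact_set_type (@stdsimplex_compact R k).
move=> /compact_near_coveringP /(_ R (0 : R)^'+
  (fun e x => exists i, forall y : @stdsimplex R k,
    `|val x - val y| < e -> G i ((s : continuousType _ _) y)) _).
case=> [x _|e /= e0 eP].
  have [i Gi] := sG x.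
  have : nbhs x ((s : continuousType _ _) @^-1` G i).
    have cs := @cts_fun _ _ (s : continuousType _ _).
    by apply: cs; exact: open_nbhs_nbhs.
  rewrite -nbhs_ballE => -[e /= e0 eG].
  exists (ball x (e / 2), [set d | d < e / 2]) => /=.
    split; first by apply: nbhsx_ballx; rewrite divr_gt0.
    by apply: nbhs_right_lt; rewrite divr_gt0.
  move=> [y d] /= [xy de]; exists i => z yz; apply: eG.
  move: xy; rewrite -!initial_ballE -!ball_normE /= => xy.
  rewrite (splitr e) -(subrKA (val y)) (le_lt_trans (ler_normD _ _))// ltrD//.
  exact: lt_trans yz de.
have e20 : 0 < e / 2 by rewrite divr_gt0.
have {}eP (x : @stdsimplex R k) : exists i,
    forall y : @stdsimplex R k, `|val x - val y| < e / 2 -> G i ((s : continuousType _ _) y).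
  apply: (eP (e / 2) _ e20 x Logic.I) => /=.
  by rewrite /ball_ sub0r normrN gtr0_norm// ltr_pdivrMr// ltr_pMr// ltr1n.
have := sd_fine k e20; apply: filterS => n /(_ T s); apply: fg_in_sub => u [x ux].
have [i xG] := eP x; exists i => _ [z _ <-].
by have [y xy ->] := ux z; exact: xG.
Qed.

End SmallSimplices.
Section UltraLimit.
Context (U : set_system nat) {UU : UltraFilter U} (sU : \oo `<=` U).

(** The limit of a sequence of bits along an ultrafilter. *)
Definition ulim (x : nat -> bool) : bool := `[< U [set k | x k] >].

Lemma ulimP x : U [set k | x k = ulim x].
Proof.
rewrite /ulim; case: asboolP => [|nU]; first by [].
have [//|] := in_ultra_setVsetC [set k | x k] UU.
by apply: filterS => k /= /negP/negbTE.
Qed.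

Lemma ulim_eq x b : U [set k | x k = b] -> ulim x = b.
Proof.
move=> xb; have [k [/= <- <- //]] := filter_ex (filterI (ulimP x) xb).
Qed.

Lemma ulimB x y : ulim (fun k => x k - y k) = ulim x - ulim y.
Proof. by apply: ulim_eq; apply: filterS2 (ulimP x) (ulimP y) => k /= -> ->. Qed.

Lemma ulim_near x b : (\forall k \near \oo, x k = b) -> ulim x = b.
Proof. by move=> xb; apply: ulim_eq; exact: sU. Qed.

End UltraLimit.

Section Chart.
Context {R : realType} {n : nat} {M : topologicalType}.
Hypotheses (hausM : hausdorff_space M) (eucM : locally_euclidean R n M).

(** The chart is translated so that [q] corresponds to the origin. [N] is the image of a closed ball
    under the inverse chart, hence compact, and closed because [M] is Hausdorff. *)
Lemma chart (q : M) : exists (U N : set M) (f : M -> 'rV[R]_n) (g : 'rV[R]_n -> M) (r : R),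
  [/\ open U /\ N `<=` U, closed N /\ nbhs q N, {in U, continuous f},
    f q = 0 /\ (forall v, N v -> f v = 0 -> v = q) &
    0 < r /\ {within [set u | `|u| <= r], continuous g} /\
    forall u, `|u| <= r -> N (g u) /\ f (g u) = u].
Proof.
have [U [V [f0 [oU Uq oV [[fUV finj VfU] cf [g0 cg gK]]]]]] := eucM q.
have fK w : V w -> U (g0 w) /\ f0 (g0 w) = w.
  by move=> /VfU[v Uv <-]; rewrite gK ?inE.
have cf' : {in U, continuous f0} by rewrite -continuous_open_subspace.
have [e /= e0 eV] : exists2 e : R, 0 < e & ball (f0 q) e `<=` V.
  by apply/nbhs_ballP/open_nbhs_nbhs; split=> //; exact: fUV.
pose r := e / 2.
have r0 : 0 < r by rewrite divr_gt0.
have rV u : `|u| <= r -> V (u + f0 q).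
  move=> ur; apply: eV; rewrite -ball_normE /= opprD addrCA subrr addr0 normrN.
  by apply: le_lt_trans ur _; rewrite /r ltr_pdivrMr// ltr_pMr// ltr1n.
have cg' : {within [set u | `|u| <= r], continuous (fun u => g0 (u + f0 q))}.
  apply/subspace_continuousP => u /= ur A.
  move/subspace_continuousP : cg => /(_ _ (rV _ ur) A) cg /cg nA.
  have cs : (fun w : 'rV[R]_n => w + f0 q) @ nbhs u --> u + f0 q.
    by apply: cvgD; [exact: cvg_id|exact: cvg_cst].
  have : nbhs u [set w | V (w + f0 q) -> A (g0 (w + f0 q))] := cs _ nA.
  by apply: filterS => w /= wA wr; apply: wA; exact: rV.
pose N := (fun u => g0 (u + f0 q)) @` [set u | `|u| <= r].
exists U, N, (fun v => f0 v - f0 q), (fun u => g0 (u + f0 q)), r; split.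
- by split=> // _ [u /= ur <-]; apply: (fK _ _).1; exact: rV.
- split.
    apply: compact_closed => //; apply: continuous_compact => //.
    apply: bounded_closed_compact.
      by exists r; split=> [|M0 M1 u /= ur]; [exact: num_real|exact: le_trans (ltW M1)].
    have cn : continuous (fun u : 'rV[R]_n => `|u|) by exact: norm_continuous.
    exact: (iffLR (continuous_closedP _) cn _ (@closed_le _ r)).
  have : \forall v \near q, ball (f0 q) r (f0 v).
    apply: (cf' q _); rewrite ?inE//.
    exact: nbhsx_ballx.
  have nU := open_nbhs_nbhs (conj oU Uq).
  apply: filterS2 nU => v Uv; rewrite -ball_normE /= => vr.
  exists (f0 v - f0 q); first by rewrite /= distrC ltW.
  by rewrite subrK gK ?inE.
- move=> v Uv; apply: cvgB; [exact: cf'|exact: cvg_cst].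
- rewrite subrr; split=> // _ [u /= /rV/fK[Uu fu] <-] /eqP; rewrite subr_eq0 => /eqP e1.
  by apply: finj; rewrite ?inE.
- do 2!split=> //; move=> u ur; split; first by exists u.
  by rewrite (fK _ (rV _ ur)).2 addrK.
Qed.

End Chart.

Section HyperplaneCoordinates.
Context {R : realType} {n : nat}.

(** Identifies ['rV_n] with the vectors of ['rV_n.+1] with sum zero. *)
Definition hcoord (u : 'rV[R]_n) (i : 'I_n.+1) : R :=
  if unlift ord_max i is Some j then u 0 j else - \sum_j u 0 j.

Lemma sum_hcoord u : \sum_i hcoord u i = 0.
Proof.
rewrite (bigD1_ord ord_max)//= {1}/hcoord unlift_none.
rewrite (eq_bigr (fun j => u 0 j)) ?addNr// => j _.
by rewrite /hcoord liftK.
Qed.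

Lemma hcoord_lt0 u : u != 0 -> exists i, hcoord u i < 0.
Proof.
move=> u0; apply: contrapT => H; move/eqP : u0; apply.
have pos i : 0 <= hcoord u i by rewrite leNgt; apply/negP => ?; apply: H; exists i.
apply/rowP => j; rewrite mxE.
have /(_ (fintype.lift ord_max j) isT) := psumr_eq0P (fun i _ => pos i) (sum_hcoord u).
by rewrite /hcoord liftK.
Qed.

Lemma hcoord_ge0 u : exists i, 0 <= hcoord u i.
Proof.
apply: contrapT => H.
have neg i : hcoord u i < 0 by rewrite ltNge; apply/negP => ?; apply: H; exists i.
have : \sum_i hcoord u i < 0.
  rewrite big_ord_recl; apply: ltr_wnDr => //.
  by apply: sumr_le0 => i _; exact/ltW.
by rewrite sum_hcoord ltxx.
Qed.

Lemma hcoord_continuous i : continuous (hcoord^~ i).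
Proof.
have cs : continuous (fun u : 'rV[R]_n => \sum_j u 0 j).
  move=> u; apply: (@cvg_big _ _ _ _ _ _ _ _ _ _ _ (nbhs_filter _)) => [|j _].
    exact: add_continuous.
  exact: coord_continuous.
rewrite /hcoord; case: unlift => [j|] u; first exact: coord_continuous.
exact: (cvgN (cs u)).
Qed.

(** A chart of the standard simplex, centered at its barycenter. *)
Definition simplex_chart (r : R) (t : 'rV[R]_n.+1) : 'rV[R]_n :=
  \row_j (r * (t 0 (fintype.lift ord_max j) - n.+1%:R^-1)).

Lemma hcoord_simplex_chart r (t : @stdsimplex R n) i :
  hcoord (simplex_chart r (val t)) i = r * (val t 0 i - n.+1%:R^-1).
Proof.
rewrite /hcoord; case: unliftP => [j ->|->]; first by rewrite mxE.
have [_ t1] := set_valP t.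
under eq_bigr do rewrite mxE.
rewrite -mulr_sumr -mulrN; congr (r * _).
rewrite sumrB sumr_const card_ord.
move: t1; rewrite (bigD1_ord ord_max)//= => t1.
have -> : \sum_(i0 < n) val t 0 (fintype.lift ord_max i0) = 1 - val t 0 ord_max.
  by rewrite -t1 addrAC subrr add0r.
have : (n.+1%:R : R) * n.+1%:R^-1 = 1 by rewrite divff// pnatr_eq0.
rewrite -[_ *+ n]mulr_natl -[X in X%:R * _]addn1 natrD mulrDl mul1r => e.
by rewrite -{1}e; ring.
Qed.

Lemma norm_simplex_chart r (t : @stdsimplex R n) : 0 < r ->
  `|simplex_chart r (val t)| <= r.
Proof.
move=> r0; apply/rV_norm_le; first exact: ltW.
move=> j; rewrite mxE normrM gtr0_norm// ger_pMr//.
have [t0 t1] := set_valP t.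
have tj : 0 <= val t 0 (fintype.lift ord_max j) <= 1.
  rewrite t0 -t1 [leRHS](bigD1 (fintype.lift ord_max j))//= lerDl sumr_ge0// => i _.
have c1 : 0 <= (n.+1%:R : R)^-1 <= 1.
  by rewrite invr_ge0 ler0n invf_le1 ?ltr0n// ler1n.
move: (val t 0 _) (_^-1) tj c1 => a b /andP[? ?] /andP[? ?].
by rewrite ler_norml; apply/andP; split; lra.
Qed.

Lemma simplex_chart_continuous r : continuous (simplex_chart r).
Proof.
move=> t A [P nP sPA].
have : nbhs t [set s : 'rV[R]_n.+1 | forall j, P 0 j (simplex_chart r s 0 j)].
  apply: (@filter_forall _ _ _ _ (nbhs_filter t)) => j.
  have : (fun s : 'rV[R]_n.+1 => r * (s 0 (fintype.lift ord_max j) - n.+1%:R^-1)) @ nbhs t -->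
      r * (t 0 (fintype.lift ord_max j) - n.+1%:R^-1).
    have cc : (fun s : 'rV[R]_n.+1 => s 0 (fintype.lift ord_max j)) @ nbhs t -->
      t 0 (fintype.lift ord_max j) by exact: coord_continuous.
    have FF := nbhs_filter t.
    by apply: (cvgM (cvg_cst _)); apply: (cvgB cc (cvg_cst _)).
  have := nP 0 j; rewrite mxE => nPj /(_ _ nPj).
  by apply: (@filterS _ _ (nbhs_filter t)) => s /=; rewrite mxE.
by apply: (@filterS _ _ (nbhs_filter t)) => s sP; apply: sPA => i j; rewrite ord1.
Qed.

End HyperplaneCoordinates.
Section LocalDegree.
Context {R : realType}.
Implicit Types (T : topologicalType).

Lemma sd_range T k (A : set T) n (c : chain R k T) : chain_in A c -> chain_in A (sd n c).
Proof.
move=> Ac; apply: (fg_lift_in (f := @sd R n T k)) Ac => s sA /=.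
rewrite sdU; apply: (fg_lift_in (Q := fun=> True)) => // t _.
rewrite /= realizeU; apply: fg_inU => _ [x _ <-]; apply: sA.
by exists (affine_simplex t x).
Qed.

Lemma face_vertex k (i : 'I_k.+2) (j : 'I_k.+1) :
  face i (@vertex R k j) = vertex (fintype.lift i j).
Proof. by rewrite face_affine affine_vertex !ffunE. Qed.

Context {n : nat} {M : topologicalType}.
Hypotheses (hausM : hausdorff_space M) (eucM : locally_euclidean R n.+1 M).

(** A point is coloured by one of its nonnegative hyperplane coordinates in a chart at [q], and
    simplices with all vertices in [N] and all colours are counted after [k] subdivisions. A small
    simplex missing [q] lies in some [G i], so it lacks colour [i]; a small simplex of one dimension
    higher has an even number of rainbow faces. Hence the limiting count vanishes on boundaries and
    on chains away from [q]. The normalisation is stated after every subdivision, since it is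
    applied to subdivided chains; this avoids comparing a chain with its subdivision by a chain
    homotopy. *)
Lemma local_degree_ex (o : orientation R n.+1 M) (q : M) :
  exists D : {additive chain R n.+1 M -> bool},
    [/\ forall b, D (bdry b) = 0,
      forall c, chain_in (~` [set q]) c -> D c = 0 &
      forall K, D (sd K (or_cycle o q)) = 1].
Proof.
have [W [UW sW]] := ultraFilterLemma (@eventually_filter).
have [U [N [f [g [r [[oU NU] [cN nN] cf [fq fN] [r0 [cg gN]]]]]]]] := chart hausM eucM q.
have oG i : open (~` N `|` [set v | U v /\ hcoord (f v) i < 0]).
  apply: openU; first exact: closed_openC.
  rewrite openE => v /= [Uv vi]; rewrite /interior /=.
  have nU := open_nbhs_nbhs (conj oU Uv).
  have : (hcoord^~ i \o f) @ v --> hcoord (f v) i.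
    by apply: continuous_comp; [apply: cf; rewrite inE|exact: hcoord_continuous].
  move=> /cvgr_lt /(_ _ vi); apply: filterS2 nU => w Uw wi.
  by split.
pose G i := ~` N `|` [set v | U v /\ hcoord (f v) i < 0].
have Gcover v : v <> q -> exists i, G i v.
  move=> vq; have [Nv|nNv] := pselect (N v); last by exists ord0; left.
  have /hcoord_lt0[i vi] : f v != 0 by apply/eqP => /(fN _ Nv).
  by exists i; right; split=> //; exact: NU.
have colE v : exists i, 0 <= hcoord (f v) i by exact: hcoord_ge0.
have [col colP] := choice colE.
pose Es (s : ssimplex R n.+1 M) : bool :=
  if `[< forall j, N ((s : continuousType _ _) (vertex j)) >]
  then rainbow (fun j => col ((s : continuousType _ _) (vertex j))) else 0.
pose E : {additive chain R n.+1 M -> bool} := fg_hom Es.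
have EU s : E << s >> = Es s by exact: fg_homU.
have EG i s : range (s : continuousType _ _) `<=` G i -> Es s = 0.
  move=> sG; rewrite /Es; case: asboolP => // sN.
  apply: (@rainbow_missing _ _ i) => j /val_inj ci.
  have [|[_]] : G i ((s : continuousType _ _) (vertex j)) by apply: sG; exists (vertex j).
    by apply.
  by rewrite -ci ltNge colP.
have EB (u : ssimplex R n.+2 M) :
    (exists i, range (u : continuousType _ _) `<=` if i is Some i then G i else interior N) ->
    E (bdry << u >>) = 0.
  move=> [i ui]; rewrite bdryU raddf_sum /=.
  under eq_bigr do rewrite fg_bool_sign EU.
  case: i => [i|] in ui *.
    apply: big1 => j _; apply: (EG i) => _ [x _ <-]; apply: ui.
    by exists (face j x).
  have uN x : N ((u : continuousType _ _) x) by apply: interior_subset; apply: ui; exists x.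
  pose F (j : 'I_n.+3) : nat := col ((u : continuousType _ _) (vertex j)).
  have Fn j : (F j < n.+2)%N by exact: ltn_ord.
  (* There are [n.+3] vertices but only [n.+2] colours, so the top colour is missing and
     [rainbow_faces] makes the number of rainbow faces even. *)
  have F0 : rainbow F = 0.
    by apply: (@rainbow_missing _ _ ord_max) => j /= e; have := Fn j; rewrite e ltnn.
  rewrite (eq_bigr (fun j => rainbow (F \o fintype.lift j))) => [|j _].
    by rewrite -[RHS]F0; apply: rainbow_faces => j; exact: ltnW (Fn j).
  rewrite /Es asboolT//=.
  by congr rainbow; apply/funext => l; rewrite /F /= face_vertex.
(* The counts of a general chain need not visibly stabilise; the limit along an ultrafilter always
   exists and is additive. *)
pose Df c := ulim W (fun k => E (sd k c)).
have DfB : zmod_morphism Df.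
  move=> a b; rewrite /Df -ulimB; congr ulim; apply/funext => k.
  by rewrite !raddfB.
have [D DE] : exists D : {additive chain R n.+1 M -> bool}, D =1 Df.
  pose D : {additive chain R n.+1 M -> bool} :=
    HB.pack Df (GRing.isZmodMorphism.Build _ _ Df DfB).
  by exists D.
have D0 c : (\forall k \near \oo, E (sd k c) = 0) -> D c = 0.
  by rewrite DE; exact: ulim_near.
have Dbdry b : D (bdry b) = 0.
  apply: (@fg_lift0 _ _ (fun=> True) (D \o @bdry R M _)) => // s _ /=.
  apply: D0.
  have oG' (i : option 'I_n.+2) : open (if i is Some i then G i else interior N).
    by case: i => [i|]; [exact: oG|exact: open_interior].
  have cG' x : exists i : option 'I_n.+2,
      (if i is Some i then G i else interior N) ((s : continuousType _ _) x).
    have [->|/eqP/Gcover[i Gi]] := eqVneq ((s : continuousType _ _) x) q.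
      by exists None.
    by exists (Some i).
  apply: filterS (sd_cover oG' cG') => k kP; rewrite -bdry_sd.
  by apply: (@fg_lift0 _ _ _ (E \o @bdry R M _)) kP => u /EB.
have Dmiss c : chain_in (~` [set q]) c -> D c = 0.
  apply: (@fg_lift0 _ _ _ D) => s sq /=; apply: D0.
  have cG x : exists i, G i ((s : continuousType _ _) x).
    by apply: Gcover; apply: sq; exists x.
  apply: filterS (sd_cover oG cG) => k kP.
  by apply: (@fg_lift0 _ _ _ E) kP => u [i] /EG; rewrite EU.
exists D; split=> // K.
have chartN (t : @stdsimplex R n.+1) : N (g (simplex_chart r (val t))) /\
    f (g (simplex_chart r (val t))) = simplex_chart r (val t).
  exact/gN/norm_simplex_chart.
have ce : continuous (fun t : @stdsimplex R n.+1 => g (simplex_chart r (val t))).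
  move=> t A.
  move/subspace_continuousP : cg => /(_ _ (norm_simplex_chart t r0) A) cg /cg nA.
  have cs := @initial_continuous _ _ (@set_val _ (@stdsimplex R n.+1)) t.
  have cc := cvg_comp _ _ cs (@simplex_chart_continuous R n.+1 r (val t)).
  have : nbhs t [set s : @stdsimplex R n.+1 | `|simplex_chart r (val s)| <= r ->
    A (g (simplex_chart r (val s)))] := cc _ nA.
  by apply: filterS => s; apply; exact: norm_simplex_chart.
pose e : ssimplex R n.+1 M := mkcts ce.
have eE t : (e : continuousType _ _) t = g (simplex_chart r (val t)) by [].
have De k : E (sd k << e >>) = 1.
  (* A nonnegative hyperplane coordinate means a barycentric coordinate of at least [n.+2%:R^-1],
     hence positive: the colouring of the model simplex [e] is a Sperner colouring. *)
  have col0 (t : @stdsimplex R n.+1) : 0 < val t 0 (col ((e : continuousType _ _) t)).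
    have := colP ((e : continuousType _ _) t).
    rewrite {1}eE (chartN t).2 hcoord_simplex_chart pmulr_rge0// subr_ge0.
    by apply: lt_le_trans; rewrite invr_gt0.
  rewrite -[RHS](sperner_vertices col0 k) sdU.
  apply: (@fg_ext _ _ (E \o @realize R _ _ e n.+1) (@rainbow_count R n.+1 _ n.+1)) => t _ /=.
  rewrite realizeU EU rainbow_countU /Es asboolT.
    by congr rainbow; apply/funext => j; rewrite /= affine_vertex.
  by move=> j; rewrite /= eE; exact: (chartN _).1.
(* On the [i]-th face the [i]-th hyperplane coordinate is negative, whereas all coordinates of [q]
   are zero. *)
have erel : rel_cycle (~` [set q]) << e >>.
  rewrite /rel_cycle bdryU; apply: (fg_in_sum (Q := fun s : ssimplex R n M =>
    range (s : continuousType _ _) `<=` ~` [set q])) => i _.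
  apply: fg_inU => _ [x _ <-] /= eq.
  have := hcoord_simplex_chart r (face i x) i.
  rewrite -(chartN _).2 [g _]eq fq mxE unlift_none sub0r.
  move=> h; have : hcoord (0 : 'rV[R]_n.+1) i < 0.
    by rewrite h mulrN oppr_lt0 mulr_gt0// invr_gt0.
  have -> : hcoord (0 : 'rV[R]_n.+1) i = 0.
    rewrite /hcoord; case: unlift => [j|]; first by rewrite mxE.
    by rewrite big1 ?oppr0// => j _; rewrite mxE.
  by rewrite ltxx.
have [m [b [a qa eb]]] := or_gen o erel.
have : D (sd K (<< e >> - or_cycle o q *~ m)) = 0.
  rewrite eb raddfD /= -bdry_sd raddfD /= Dbdry add0r.
  by apply: Dmiss; exact: sd_range.
rewrite !raddfB /= => /eqP; rewrite subr_eq0 => /eqP.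
have -> : D (sd K << e >>) = 1.
  rewrite DE; apply: ulim_eq; apply: sW; exists 0%N => // k _ /=.
  by rewrite sd_add De.
(* The odd degree of [e] is an integer multiple of that of the orientation cycle, which therefore
   cannot be zero. *)
rewrite raddfMz raddfMz /=; case: (D _) => // /esym.
by rewrite mul0rz.
Qed.

End LocalDegree.

(** * Translates of singular simplices *)

Lemma stdsimplex_connected (R : realType) k : connected [set: @stdsimplex R k].
Proof.
have [v0 _] : exists v0 : @stdsimplex R k, True by exists (vertex ord0).
pose seg (y : @stdsimplex R k) (t : R) : 'rV[R]_k.+1 :=
  (1 - t) *: val v0 + t *: val y.
have segP y t : t \in `[0, 1] -> seg y t \in @stdsimplex R k.
  rewrite in_itv /= => /andP[t0 t1].
  have [v00 v01] := set_valP v0; have [y0 y1] := set_valP y.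
  apply/mem_set; split=> [i|].
    by rewrite !mxE addr_ge0// mulr_ge0// ?subr_ge0.
  under eq_bigr do rewrite !mxE.
  by rewrite big_split /= -!mulr_sumr v01 y1 !mulr1 subrK.
pose f y t : @stdsimplex R k := insubd v0 (seg y t).
have fE y t : t \in `[0, 1] -> val (f y t) = seg y t.
  by move=> t01; rewrite /f val_insubd segP.
have cf y : {within `[0, 1], continuous (f y)}.
  apply: continuous_comp_initial.
  have cs : {within `[0, 1], continuous (seg y)}.
    apply: continuous_subspaceT => t.
    apply: cvgD; apply: cvgZr_tmp; last exact: cvg_id.
    by apply: cvgB; [exact: cvg_cst|exact: cvg_id].
  by apply: within_eq cs => t /set_mem t01; exact/esym/fE.
have -> : [set: @stdsimplex R k] = \bigcup_(y in setT) (f y @` `[0, 1]%classic).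
  apply/seteqP; split=> // y _; exists y => //; exists 1.
    by rewrite /= in_itv /= ler01 lexx.
  apply/val_inj; rewrite fE ?in_itv /= ?ler01 ?lexx//.
  by rewrite /seg subrr scale0r add0r scale1r.
apply: bigcup_connected; last first.
  by move=> y _; apply: connected_continuous_connected; [exact: segment_connected|exact: cf].
exists v0 => y _; exists 0; first by rewrite /= in_itv /= lexx ler01.
apply/val_inj; rewrite fE ?in_itv /= ?ler01 ?lexx//.
by rewrite /seg subr0 scale0r addr0 scale1r.
Qed.

Lemma range_compact (R : realType) (T : topologicalType) k (s : ssimplex R k T) :
  compact (range (s : continuousType _ _)).
Proof.
apply: continuous_compact; last exact/compact_set_type/stdsimplex_compact.
exact/continuous_subspaceT/cts_fun.
Qed.

Lemma range_near_miss (R : realType) (T : topologicalType) k (s : ssimplex R k T) (y : T) :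
  hausdorff_space T -> ~ range (s : continuousType _ _) y ->
  \forall y' \near y, ~ range (s : continuousType _ _) y'.
Proof.
move=> hT sy; have /closed_openC os := compact_closed hT (@range_compact _ _ _ s).
exact: (@open_nbhs_nbhs _ _ _ (conj os sy)).
Qed.

Lemma near_seq (T : topologicalType) (y : T) (I : eqType) (r : seq I) (P : I -> T -> Prop) :
  (forall i, i \in r -> \forall y' \near y, P i y') ->
  \forall y' \near y, forall i, i \in r -> P i y'.
Proof.
elim: r => [|i r IH] H; first exact: nearW.
have := IH (fun j jr => H j (mem_behead (s := i :: r) jr)).
apply: filterS2 (H i (mem_head _ _)) => y' Pi Pr j.
by rewrite inE => /orP[/eqP ->|/Pr].
Qed.

Section DeckSimplices.
Context {R : realType} {M : topologicalType} {x0 : M} {G : groupType}.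
Context {phi : fundamental_group R x0 G} {Mt : topologicalType}.
Variable uc : universal_covering phi Mt.

Local Notation p := (ucov uc).
Local Notation deck := (deck uc).

Definition gsimplex k (g : G) (s : ssimplex R k Mt) : ssimplex R k Mt :=
  push_simplex (deck_map uc g) s.

Lemma chain_actU k g (s : ssimplex R k Mt) :
  push (deck_map uc g) << s >> = << gsimplex g s >>.
Proof. exact: pushU. Qed.

Lemma gsimplexE k g (s : ssimplex R k Mt) x :
  (gsimplex g s : continuousType _ _) x = deck g ((s : continuousType _ _) x).
Proof. by []. Qed.

Lemma gsimplexM k g h (s : ssimplex R k Mt) :
  gsimplex (g * h)%g s = gsimplex g (gsimplex h s).
Proof. by apply/continuousEP => x; rewrite !gsimplexE actMx. Qed.

Lemma gsimplex_inj k (s : ssimplex R k Mt) : injective (fun g => gsimplex g s).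
Proof.
move=> g h /(congr1 (fun t : ssimplex R k Mt => (t : continuousType _ _) (vertex ord0))).
exact: deck_inj.
Qed.

Lemma push_gsimplex k g (s : ssimplex R k Mt) :
  push_simplex (ucov_map uc) (gsimplex g s) = push_simplex (ucov_map uc) s.
Proof. by apply/continuousEP => x; exact: ucov_deck. Qed.

Lemma push_deckM k g h (c : chain R k Mt) :
  push (deck_map uc (g * h)%g) c = push (deck_map uc g) (push (deck_map uc h) c).
Proof.
apply: (@fg_ext _ _ (@push R _ _ (deck_map uc (g * h)%g) k)
  (@push R _ _ (deck_map uc g) k \o @push R _ _ (deck_map uc h) k)) => s _ /=.
by rewrite !chain_actU gsimplexM.
Qed.

Lemma gsimplex_transitive k (s t : ssimplex R k Mt) :
  push_simplex (ucov_map uc) s = push_simplex (ucov_map uc) t ->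
  exists g, gsimplex g s = t.
Proof.
move=> /continuousEP st.
have [g gs] := deck_transitive (st (vertex ord0)).
exists g; apply/continuousEP => x.
apply: (@lift_unique _ _ _ _ [set: @stdsimplex R k] (gsimplex g s : continuousType _ _)
  (t : continuousType _ _) (ucov_covering uc) _ _ _ _ (vertex ord0) Logic.I gs) => //.
- exact: stdsimplex_connected.
- exact/continuous_subspaceT/cts_fun.
- exact/continuous_subspaceT/cts_fun.
- by move=> z _; rewrite gsimplexE ucov_deck; exact: (st z).
Qed.

(** A set-theoretic fundamental domain: one point is chosen in each fibre, and [nu y] is the deck
    transformation that carries the chosen point to [y]. *)
Lemma deck_coordinate : exists nu : Mt -> G, forall g y, nu (deck g y) = (g * nu y)%g.
Proof.
have rep m : exists y0, forall y, p y = m -> exists g, deck g y0 = y.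
  have [[y ym]|nom] := pselect (exists y, p y = m).
    by exists y => y' y'm; apply: deck_transitive; rewrite ym.
  by exists (ucov_base uc) => y ym; exfalso; apply: nom; exists y.
have [r rP] := choice rep.
have /choice[nu nuP] y : exists g, deck g (r (p y)) = y by exact: rP.
exists nu => g y; apply: (@deck_inj _ _ _ _ _ _ uc (r (p y))).
by rewrite actMx nuP -{1}(ucov_deck uc g y) nuP.
Qed.

(** [P] contains every [g] such that a [g]-translate of a simplex in [S] meets [W]. *)
Definition translates_cover k (S : seq (ssimplex R k Mt)) (W : set Mt) (P : seq G) :=
  forall (s : ssimplex R k Mt) g x, s \in S ->
    W ((gsimplex g s : continuousType _ _) x) -> g \in P.

Lemma translates_cover_ex k (S : seq (ssimplex R k Mt)) (y : Mt) :
  hausdorff_space M ->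
  exists2 W, nbhs y W & exists2 P, uniq P & translates_cover S W P.
Proof.
move=> hM; elim: S => [|s S [W nW [P _ PW]]].
  by exists setT; [exact: filterT|exists [::]].
have [W' nW' [P' PW']] := deck_locally_finite uc y hM (@range_compact _ _ _ s).
exists (W `&` W'); first exact: filterI.
exists (undup (P' ++ P)); first exact: undup_uniq.
move=> t g x; rewrite inE mem_undup mem_cat => /orP[/eqP ->|tS] [Wx W'x].
  by rewrite (PW' g ((s : continuousType _ _) x))//; exists x.
by rewrite (PW _ _ _ tS Wx) orbT.
Qed.

End DeckSimplices.

Lemma bdry_in (R : realType) (T : topologicalType) k (Q : ssimplex R k.+1 T -> Prop)
    (Q' : ssimplex R k T -> Prop) (c : chain R k.+1 T) :
  (forall s (i : 'I_k.+2), Q s -> Q' ((s : continuousType _ _) \o @face R k i : ssimplex R k T)) ->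
  fg_in Q c -> fg_in Q' (bdry c).
Proof.
move=> QQ'; apply: fg_lift_in => s Qs; rewrite /= bdryU; apply: fg_in_sum => i _.
by apply: fg_inU; exact: QQ'.
Qed.

Lemma push_in (R : realType) (S T : topologicalType) (f : continuousType S T) k
    (Q : ssimplex R k S -> Prop) (Q' : ssimplex R k T -> Prop) (c : chain R k S) :
  (forall s, Q s -> Q' (push_simplex f s)) -> fg_in Q c -> fg_in Q' (push f c).
Proof.
by move=> QQ'; apply: fg_lift_in => s Qs; rewrite /= pushU; apply: fg_inU; exact: QQ'.
Qed.

(** * The degree on the universal covering *)

Section CoveringDegree.
Context {R : realType} {n : nat} {M : topologicalType}.
Hypotheses (hausM : hausdorff_space M) (eucM : locally_euclidean R n.+1 M).
Variable o : orientation R n.+1 M.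
Context {x0 : M} {G : groupType} {phi : fundamental_group R x0 G}.
Context {Mt : topologicalType}.
Variable uc : universal_covering phi Mt.

Local Notation p := (ucov uc).
Local Notation pm := (ucov_map uc).
Local Notation deck := (deck uc).

Definition local_degree (q : M) : {additive chain R n.+1 M -> bool} :=
  projT1 (cid (local_degree_ex hausM eucM o q)).

Lemma local_degree_bdry q b : local_degree q (bdry b) = 0.
Proof. have [H _ _] := projT2 (cid (local_degree_ex hausM eucM o q)); exact: H. Qed.

Lemma local_degree_miss q c : chain_in (~` [set q]) c -> local_degree q c = 0.
Proof. have [_ H _] := projT2 (cid (local_degree_ex hausM eucM o q)); exact: H. Qed.

Lemma local_degree_or q K : local_degree q (sd K (or_cycle o q)) = 1.
Proof. have [_ _ H] := projT2 (cid (local_degree_ex hausM eucM o q)); exact: H. Qed.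

Lemma local_degree_homologous q c c' : rel_homologous (~` [set q]) c c' ->
  local_degree q c = local_degree q c'.
Proof.
move=> [b [a qa /(congr1 (local_degree q))]]; rewrite raddfB raddfD /=.
rewrite local_degree_bdry (local_degree_miss qa) addr0 => /eqP.
by rewrite subr_eq0 => /eqP.
Qed.

(** One chain [c0] represents the orientation at all points near [q]. A multiple of it is homologous
    to [c] up to a chain that misses [q], and, its simplices being compact, also misses all nearby
    points. So the degree near [q] is the parity of that multiple. *)
Lemma local_degree_locally_constant q (c : chain R n.+1 M) :
  (\forall q' \near q, chain_in (~` [set q']) (bdry c)) ->
  \forall q' \near q, local_degree q' c = local_degree q c.
Proof.
move=> cq; have relq : rel_cycle (~` [set q]) c := nbhs_singleton cq.
have [m cm] := or_gen o relq.
have [U [c0 [oU Uq _ c0U]]] := or_local o q.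
have [b [a qa ab]] := cm; have [b' [a' qa' ab']] := c0U _ Uq.
have e : c - c0 *~ m = bdry (b - b' *~ m) + (a - a' *~ m).
  rewrite raddfB raddfMz /= addrACA -opprD -mulrzDl -ab' mulrzBl -ab.
  by rewrite opprB addrA subrK.
have qaa : chain_in (~` [set q]) (a - a' *~ m).
  by apply: fg_inB => //; exact: fg_in_mulz.
have near_a : \forall q' \near q, chain_in (~` [set q']) (a - a' *~ m).
  apply: near_seq => s /qaa sq.
  have : ~ range (s : continuousType _ _) q by move=> /sq; apply.
  move=> /(range_near_miss hausM); apply: filterS => q' sq' _ [x _ <-] /= sx.
  by apply: sq'; exists x.
have or1 q' : local_degree q' (or_cycle o q') = 1.
  by rewrite -[X in local_degree _ X](sd0 (or_cycle o q')) local_degree_or.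
have val q' : U q' -> chain_in (~` [set q']) (a - a' *~ m) ->
    local_degree q' c = 1 *~ m.
  move=> Uq' aq'; rewrite (@local_degree_homologous q' c (c0 *~ m)); last first.
    by exists (b - b' *~ m), (a - a' *~ m).
  by rewrite raddfMz /= (local_degree_homologous (c0U _ Uq')) or1.
have nU := open_nbhs_nbhs (conj oU Uq).
apply: filterS2 nU near_a => q' Uq' aq'.
by rewrite (val _ Uq' aq') (val q Uq qaa).
Qed.

(** Restricting to the simplices through [y] before projecting discards the contributions of other
    points of the fibre. The definition is meaningful for simplices on whose image [p] is
    injective. *)
Definition covering_degree (y : Mt) (u : chain R n.+1 Mt) : bool :=
  local_degree (p y) (push pm (fg_restr [set s | range (s : continuousType _ _) y] u)).

Lemma covering_degree_is_additive y : zmod_morphism (covering_degree y).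
Proof. by move=> a b; rewrite /covering_degree !raddfB. Qed.

HB.instance Definition _ y := GRing.isZmodMorphism.Build _ _ (covering_degree y)
  (covering_degree_is_additive y).

Lemma covering_degreeU y (s : ssimplex R n.+1 Mt) : range (s : continuousType _ _) y ->
  covering_degree y << s >> = local_degree (p y) << push_simplex pm s >>.
Proof. by move=> sy; rewrite /covering_degree fg_restrU asboolT// pushU. Qed.

Lemma covering_degree_miss y (c : chain R n.+1 Mt) :
  chain_in (~` [set y]) c -> covering_degree y c = 0.
Proof.
apply: (@fg_lift0 _ _ _ (covering_degree y)) => s sy /=.
rewrite /covering_degree fg_restrU asboolF ?raddf0//.
by move=> /sy; apply.
Qed.

Lemma covering_degree_deck g y (c : chain R n.+1 Mt) :
  covering_degree (deck g y) (push (deck_map uc g) c) = covering_degree y c.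
Proof.
apply: (@fg_ext _ _ (covering_degree (deck g y) \o @push R _ _ (deck_map uc g) _)
  (covering_degree y)) => s _ /=; rewrite chain_actU.
have [sy|sy] := pselect (range (s : continuousType _ _) y).
  rewrite !covering_degreeU// ?ucov_deck ?push_gsimplex//.
  by case: sy => x _ <-; exists x.
rewrite !covering_degree_miss//; apply: fg_inU => _ [x _ <-].
  by move=> e; apply: sy; exists x.
by move=> /deck_injr e; apply: sy; exists x.
Qed.

Definition small_simplex k (s : ssimplex R k Mt) :=
  forall x x', p ((s : continuousType _ _) x) = p ((s : continuousType _ _) x') ->
    (s : continuousType _ _) x = (s : continuousType _ _) x'.

Lemma small_gsimplex k g (s : ssimplex R k Mt) : small_simplex s ->
  small_simplex (gsimplex uc g s).
Proof. by move=> ss x x'; rewrite !gsimplexE !ucov_deck => /ss ->. Qed.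

(** If a small simplex passes through [y], its faces that avoid [y] project to simplices that avoid
    [p y]. So discarding them does not change the local degree of the projected boundary, which is
    zero. *)
Lemma covering_degree_bdry y (v : chain R n.+2 Mt) :
  fg_in (@small_simplex _) v -> covering_degree y (bdry v) = 0.
Proof.
apply: (@fg_lift0 _ _ _ (covering_degree y \o @bdry R Mt _)) => s ss /=.
have [[x _ xy]|sy] := pselect (range (s : continuousType _ _) y); last first.
  apply: covering_degree_miss; apply: (@bdry_in _ _ _
    (fun s => range (s : continuousType _ _) `<=` ~` [set y])).
    by move=> t i ty _ [x _ <-]; apply: ty; exists (face i x).
  by apply: fg_inU => _ [x _ <-] e; apply: sy; exists x.
pose r := bdry << s >> - fg_restr [set t : ssimplex R _ Mt | range (t : continuousType _ _) y] (bdry << s >>).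
have r_in t : t \in dom r -> range (t : continuousType _ _) `<=` range (s : continuousType _ _).
  have bs : fg_in (fun t : ssimplex R n.+1 Mt =>
      range (t : continuousType _ _) `<=` range (s : continuousType _ _)) (bdry << s >>).
    apply: (@bdry_in _ _ _ (eq s)); last exact: fg_inU.
    by move=> _ i <- _ [z _ <-]; exists (face i z).
  by apply: fg_inB (bs) (fg_restr_sub bs) _.
have -> : covering_degree y (bdry << s >>) =
    local_degree (p y) (push pm (bdry << s >>)) - local_degree (p y) (push pm r).
  by rewrite -!raddfB /covering_degree /r subKr.
rewrite -bdry_push local_degree_bdry sub0r local_degree_miss ?oppr0//.
apply: (@push_in _ _ _ _ _ (fun t => t \in dom r)) => // t tr _ [z _ <-] /= e.
apply: (fg_restr_compl tr); exists z => //.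
by have [w _ wz] := r_in _ tr _ (ex_intro2 _ _ z Logic.I erefl); rewrite -wz -xy; apply: ss; rewrite wz xy; exact: e.
Qed.

(** The part of the simplex outside a sheet at [y] is compact and projects to a closed set, which
    misses [p y] by smallness. *)
Lemma covering_nhbs_inj (y : Mt) (s : ssimplex R n.+1 Mt) : small_simplex s ->
  range (s : continuousType _ _) y -> \forall y' \near y,
    forall x, p ((s : continuousType _ _) x) = p y' -> (s : continuousType _ _) x = y'.
Proof.
move=> ss [x0' _ sx0]; have [V [oV Vy Vi]] := covering_sheet (ucov_covering uc) y.
have cK : compact (range (s : continuousType _ _) `\` V).
  rewrite setDE; apply: compact_closedI; first exact: range_compact.
  exact: open_closedC.
have cpK : closed (p @` (range (s : continuousType _ _) `\` V)).
  apply: compact_closed => //; apply: continuous_compact => //.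
  exact/continuous_subspaceT/ucov_continuous.
have py : (~` (p @` (range (s : continuousType _ _) `\` V))) (p y).
  move=> [_ [[x _ <-] nVx] e]; apply: nVx.
  by rewrite (_ : _ x = y)// -sx0; apply: ss; rewrite sx0.
have nV := open_nbhs_nbhs (conj oV Vy).
have np := ucov_continuous (open_nbhs_nbhs (conj (closed_openC cpK) py)).
apply: filterS2 nV np => y' Vy' npy' x e.
have [Vx|nVx] := pselect (V ((s : continuousType _ _) x)); first by apply: Vi; rewrite ?inE.
by exfalso; apply: npy'; exists ((s : continuousType _ _) x) => //; split=> //; exists x.
Qed.

(** Near [y] only the simplices of [u] through [y] matter: the others stay away, and by
    [covering_nhbs_inj] those that miss a nearby [y'] project off [p y']. So the degree is the local
    degree of one fixed projected chain [v], a relative cycle at all points near [p y]. *)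
Lemma covering_degree_locally_constant (u : chain R n.+1 Mt) (W : set Mt) (y : Mt) :
  fg_in (@small_simplex _) u -> nbhs y W -> chain_in (~` W) (bdry u) ->
  \forall y' \near y, covering_degree y' u = covering_degree y u.
Proof.
move=> us nW uW.
have hausMt : hausdorff_space Mt := covering_hausdorff (ucov_covering uc) hausM.
pose A z := [set s : ssimplex R n.+1 Mt | range (s : continuousType _ _) z].
pose uy := fg_restr (A y) u.
have uys s : s \in dom uy -> small_simplex s /\ A y s.
  by move=> sd; split; [exact: (fg_restr_sub us sd)|exact: (fg_restr_in sd)].
have far : \forall y' \near y, forall s, s \in dom (u - uy) -> ~ A y' s.
  apply: near_seq => s sd; apply: range_near_miss => //.
  exact: (fg_restr_compl sd).
have inj : \forall y' \near y, forall s, s \in dom uy -> forall x,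
    p ((s : continuousType _ _) x) = p y' -> (s : continuousType _ _) x = y'.
  by apply: near_seq => s /uys[ss sy]; exact: covering_nhbs_inj.
pose good y' := [/\ W y', forall s, s \in dom (u - uy) -> ~ A y' s &
  forall s, s \in dom uy -> forall x,
    p ((s : continuousType _ _) x) = p y' -> (s : continuousType _ _) x = y'].
have ngood : \forall y' \near y, good y'.
  by near=> y'; split; near: y'.
pose v := push pm uy.
have vE y' : good y' -> covering_degree y' u = local_degree (p y') v.
  move=> [Wy' far' inj']; apply/eqP; rewrite -subr_eq0 /covering_degree /v -!raddfB.
  apply/eqP; apply: local_degree_miss.
  apply: (@push_in _ _ _ _ _ (fun s => s \in dom (fg_restr (A y') u - uy))) => // s sd.
  move=> _ [x _ <-] /= e.
  have sE : fg_restr (A y') u - uy = - (uy - fg_restr (A y') uy).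
    rewrite opprB; congr (_ - _).
    apply/eqP; rewrite -subr_eq0 -raddfB; apply/eqP.
    apply/eqP; rewrite -dom_eq0; apply/eqP/nilP; rewrite /nilp -leqn0 leqNgt.
    apply/negP; case E : (dom _) => [//|t r] _.
    have td : t \in dom (fg_restr (A y') (u - uy)) by rewrite E mem_head.
    have [td1 td2] := (fg_restr_in td, fg_restr_sub (Q := fun t => t \in dom (u - uy)) (fun _ => id) td).
    exact: far' _ td2 td1.
  move: sd; rewrite sE domN => sd.
  have suy : s \in dom uy by apply: (fg_inB (Q := fun t => t \in dom uy)) sd => //; exact: fg_restr_sub.
  by apply: (fg_restr_compl sd); exists x => //; exact: inj' e.
have vrel y' : good y' -> chain_in (~` [set p y']) (bdry v).
  move=> [Wy' far' inj']; rewrite /v bdry_push.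
  have b1 : fg_in (fun t => forall x, p ((t : continuousType _ _) x) = p y' ->
      (t : continuousType _ _) x = y') (bdry uy).
    apply: (@bdry_in _ _ _ (fun s => s \in dom uy)) => // s i /inj' si x e.
    exact: si e.
  have b2 : fg_in (fun t => ~ range (t : continuousType _ _) y') (bdry uy).
    rewrite -[uy](subKr u) raddfB /=; apply: fg_inB.
      by move=> t td; move/(_ _ td) : uW => tW /tW.
    apply: (@bdry_in _ _ _ (fun s => s \in dom (u - uy))) => // s i /far' si [x _ e].
    by apply: si; exists (face i x).
  apply: (@push_in _ _ _ _ _ (fun t => t \in dom (bdry uy))) => // t td.
  move=> _ [x _ <-] /= e; apply: (b2 _ td); exists x => //.
  exact: (b1 _ td).
have nv : \forall q \near p y, exists2 y', p y' = q & good y'.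
  have := covering_nbhs (ucov_covering uc) ngood.
  by apply: filterS => q [y' gy' <-]; exists y'.
have nvrel : \forall q' \near p y, chain_in (~` [set q']) (bdry v).
  by apply: filterS nv => q [y' <- /vrel].
have : \forall y' \near y, local_degree (p y') v = local_degree (p y) v.
  exact: (ucov_continuous (local_degree_locally_constant nvrel)).
have gy := nbhs_singleton ngood.
by apply: filterS2 ngood => y' gy' /= e; rewrite !vE.
Unshelve. all: by end_near. Qed.

(** If the projection of a small simplex meets [p y], exactly one of its translates passes through
    [y], since the deck action is free and transitive on fibres. *)
Lemma covering_degree_sum (y : Mt) (c : chain R n.+1 Mt) (P : seq G) :
  uniq P -> fg_in (@small_simplex _) c ->
  translates_cover uc (dom c) [set y] P ->
  \sum_(g <- P) covering_degree y (push (deck_map uc g) c) =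
  local_degree (p y) (push pm c).
Proof.
move=> uP cs cP.
pose F (c : chain R n.+1 Mt) := \sum_(g <- P) covering_degree y (push (deck_map uc g) c).
have FB : zmod_morphism F.
  by move=> a b; rewrite /F -sumrB; apply: eq_bigr => g _; rewrite !raddfB.
have [L LE] : exists L : {additive chain R n.+1 Mt -> bool}, L =1 F.
  pose L : {additive chain R n.+1 Mt -> bool} :=
    HB.pack F (GRing.isZmodMorphism.Build _ _ F FB).
  by exists L.
rewrite -/(F c) -LE.
apply: (@fg_ext _ _ L (local_degree (p y) \o @push R _ _ pm _)) => s sd.
rewrite LE /= pushU /F.
have [[g [x e]]|H] := pselect (exists g x, (gsimplex uc g s : continuousType _ _) x = y).
  have gP : g \in P by apply: (cP s g x) => //=.
  rewrite (big_rem g)//= [X in _ + X]big_seq big1 ?addr0 => [|h].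
    rewrite chain_actU covering_degreeU; last by exists x.
    by rewrite push_gsimplex.
  rewrite mem_rem_uniq// inE => /andP[hg hP].
  rewrite chain_actU covering_degree_miss//; apply: fg_inU => _ [x' _ <-] /= e'.
  move/eqP : hg; apply; apply: (@deck_inj _ _ _ _ _ _ uc ((s : continuousType _ _) x)).
  have -> : deck g ((s : continuousType _ _) x) = y by exact: e.
  rewrite -[RHS]e' (cs _ sd x x')//.
  by rewrite -(ucov_deck uc g) -[in RHS](ucov_deck uc h); congr (p _); rewrite [LHS]e [RHS]e'.
rewrite big1 => [|g _]; last first.
  rewrite chain_actU covering_degree_miss//; apply: fg_inU => _ [x _ <-] e.
  by apply: H; exists g, x.
apply/esym; apply: local_degree_miss; apply: fg_inU => _ [x _ <-] /= e.
have [g gs] := deck_transitive (e : p _ = p y).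
by apply: H; exists g, x.
Qed.

End CoveringDegree.

(** * Evaluating parametrised chains along orbits *)

Lemma countable_enum (T : Type) (x : T) : countable [set: T] ->
  exists e : nat -> T, forall y, exists n, e n = y.
Proof.
move=> /countable_injP[f fi].
have eP n : exists y, forall z, f z = n -> y = z.
  have [[z zn]|nz] := pselect (exists z, f z = n).
    by exists z => z' z'n; apply: fi; rewrite ?inE// zn.
  by exists x => z zn; exfalso; apply: nz; exists z.
have [e eP'] := choice eP.
by exists e => y; exists (f y); exact: eP'.
Qed.

Section StandardSpaces.
Context {R : realType} {G : groupType} (alpha : standard_space R G).

Local Notation X := (ss_space alpha).
Local Notation mu := (ss_mu alpha).
Local Notation act := (ss_act alpha).

Lemma act_measurable g (A : set X) : measurable A -> measurable (act g @^-1` A).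
Proof. by move=> mA; rewrite -[X in measurable X]setTI; exact: ss_measurable. Qed.

Lemma ae_act g (P : X -> Prop) : {ae mu, forall x, P x} -> {ae mu, forall x, P (act g x)}.
Proof.
move=> [N [mN N0 PN]]; exists (act g @^-1` N); split; first exact: act_measurable.
  by rewrite ss_preserving.
by move=> x /= Px; exact: PN.
Qed.

Lemma ae_forall_group (P : G -> X -> Prop) : countable [set: G] ->
  (forall g, {ae mu, forall x, P g x}) -> {ae mu, forall x, forall g, P g x}.
Proof.
move=> /(countable_enum 1%g)[e eP] H.
have : {ae mu, forall x, forall n, P (e n) x} by apply/ae_foralln => n; exact: H.
by apply: filterS => x Px g; have [n <-] := eP g.
Qed.

Lemma Linf_funB (f f' : Linf_fun mu) x : (f - f') x = f x - f' x.
Proof. by change (\val (f - f') x = f x - f' x); rewrite raddfB. Qed.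

Lemma Linf_funD (f f' : Linf_fun mu) x : (f + f') x = f x + f' x.
Proof. by change (\val (f + f') x = f x + f' x); rewrite raddfD. Qed.

Lemma Linf_reprD (f f' : Linf mu) : {ae mu, forall x,
  (repr (f + f') : Linf_fun mu) x = (repr f : Linf_fun mu) x + (repr f' : Linf_fun mu) x}.
Proof.
have /asboolP : (repr (f + f') - (repr f + repr f') : Linf_fun mu) \in @ae_null R _ _ mu.
  by rewrite Quotient.idealrBE reprK (@pi_addr _ _ _ _ _ (Linf mu)) !reprK.
by apply: filterS => x /eqP; rewrite Linf_funB Linf_funD subr_eq0 => /eqP.
Qed.

Lemma Linf_repr_act (f : Linf mu) g : {ae mu, forall x,
  (repr (Linf_act f g) : Linf_fun mu) x = (repr f : Linf_fun mu) (act g x)}.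
Proof.
have /asboolP : (repr (Linf_act f g) - LinfFun (ess_bounded_act (repr f) g) : Linf_fun mu)
    \in @ae_null R _ _ mu.
  by rewrite Quotient.idealrBE reprK.
by apply: filterS => x /eqP; rewrite Linf_funB subr_eq0 => /eqP.
Qed.

Lemma Linf_repr1 : {ae mu, forall x, (repr (Linf1 mu) : Linf_fun mu) x = 1}.
Proof.
have /asboolP : (repr (Linf1 mu) - LinfFun (@ess_bounded1 R _ _ mu) : Linf_fun mu)
    \in @ae_null R _ _ mu.
  by rewrite Quotient.idealrBE reprK.
by apply: filterS => x /eqP; rewrite Linf_funB subr_eq0 => /eqP.
Qed.

End StandardSpaces.

Lemma fg_in_sumB (K : choiceType) (I : eqType) (Q : K -> Prop) (P P' : seq I)
    (A : I -> {freeg K}) : uniq P -> uniq P' ->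
  (forall i, i \in P -> i \notin P' -> fg_in Q (A i)) ->
  (forall i, i \in P' -> i \notin P -> fg_in Q (A i)) ->
  fg_in Q (\sum_(i <- P) A i - \sum_(i <- P') A i).
Proof.
move=> uP uP' PA P'A.
rewrite (bigID (mem P')) [X in _ - X](bigID (mem P)) /=.
have -> : \sum_(i <- P | i \in P') A i = \sum_(i <- P' | i \in P) A i.
  rewrite -big_filter -[RHS]big_filter; apply: perm_big; apply: uniq_perm.
  - exact: filter_uniq.
  - exact: filter_uniq.
  - by move=> i; rewrite !mem_filter andbC.
rewrite opprD addrACA subrr add0r.
rewrite big_seq_cond [X in _ - X]big_seq_cond; apply: fg_inB.
  by apply: fg_in_sum => i /andP[]; exact: PA.
by apply: fg_in_sum => i /andP[]; exact: P'A.
Qed.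

Section Truncation.
Context {R : realType} {M : topologicalType} {x0 : M} {G : groupType}.
Context {phi : fundamental_group R x0 G} {Mt : topologicalType}.
Variable uc : universal_covering phi Mt.
Variable alpha : standard_space R G.
Hypothesis countG : countable [set: G].

Local Notation X := (ss_space alpha).
Local Notation mu := (ss_mu alpha).
Local Notation act := (ss_act alpha).

(** The part over [P] of the locally finite chain on the universal covering
    that is obtained by evaluating the coefficients along the orbit of [x]. *)
Definition trunc k (x : X) (P : seq G) :
    {freeg (Linf mu * chain R k Mt)} -> chain R k Mt :=
  fg_hom (fun ab : Linf mu * chain R k Mt => \sum_(g <- P)
    push (deck_map uc g) ab.2 *~ (repr ab.1 : Linf_fun mu) (act g^-1%g x)).

HB.instance Definition _ k x P := GRing.isZmodMorphism.Build _ _ (@trunc k x P)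
  (fg_hom_is_additive _).

Lemma truncU k x P (f : Linf mu) (c : chain R k Mt) :
  trunc x P << (f, c) >> = \sum_(g <- P)
    push (deck_map uc g) c *~ (repr f : Linf_fun mu) (act g^-1%g x).
Proof. exact: fg_homU. Qed.

Lemma translates_cover_sub k (S S' : seq (ssimplex R k Mt)) W P :
  {subset S <= S'} -> translates_cover uc S' W P -> translates_cover uc S W P.
Proof. by move=> SS' H s g x /SS'; exact: H. Qed.

(** A finitary way to say that the evaluated locally finite chain is zero: wherever [P] lists all
    translates of [S] that meet [W], the truncation avoids [W]. *)
Definition trunc_null k (u : {freeg (Linf mu * chain R k Mt)}) :=
  exists S : seq (ssimplex R k Mt), {ae mu, forall x, forall W P, uniq P ->
    translates_cover uc S W P -> chain_in (~` W) (trunc x P u)}.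

(** Additivity relators evaluate to zero almost everywhere. For a balancing relator, the
    substitution of [g * h] for [g] turns one truncation into the other, up to the discrepancy
    between [P] and its right translate. *)
Lemma tensor_null_trunc k (u : {freeg (Linf mu * chain R k Mt)}) :
  u \in tensor_null (@Linf_act R G alpha) (@chain_act R M x0 G phi Mt uc k) ->
  trunc_null u.
Proof.
move/asboolP => /(_ [set u | trunc_null u]); apply; split.
  split=> [|a b [S Sa] [S' Sb]] /=.
    by exists [::]; apply: aeW => x W P _ _; rewrite raddf0; exact: fg_in0.
  exists (S ++ S'); apply: filterS2 Sa Sb => x Sa Sb W P uP SP.
  rewrite raddfB; apply: fg_inB.
    by apply: Sa => //; apply: translates_cover_sub SP => s; rewrite mem_cat => ->.
  by apply: Sb => //; apply: translates_cover_sub SP => s; rewrite mem_cat orbC => ->.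
have ae_all (P : X -> Prop) : {ae mu, forall x, P x} ->
    {ae mu, forall x, forall g, P (act g^-1%g x)}.
  by move=> aP; apply: ae_forall_group => // g; exact: ae_act.
have zero k' (c : chain R k' Mt) A : c = 0 -> chain_in A c.
  by move=> ->; exact: fg_in0.
move=> _ [f f' c|f c c'|f h c] /=.
- exists [::]; apply: filterS (ae_all _ (Linf_reprD f f')) => x fx W P _ _.
  apply: zero; rewrite !raddfB /= !truncU -!sumrB big1// => g _.
  by rewrite fx mulrzDr addrAC addrK subrr.
- exists [::]; apply: aeW => x W P _ _.
  apply: zero; rewrite !raddfB /= !truncU -!sumrB big1// => g _.
  by rewrite raddfD mulrzDl addrAC addrK subrr.
(* Both the simplices of [c] and their [h]-translates must be covered, so that [P] and its right
   translate by [h] differ only by terms that avoid [W]. *)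
pose S := map (@gsimplex _ _ _ _ _ _ uc k h) (dom c) ++ dom c.
exists S; apply: filterS (ae_all _ (Linf_repr_act f h)) => x fx W P uP SP.
pose A g := push (deck_map uc g) c *~ (repr f : Linf_fun mu) (act h (act g^-1%g x)).
have Ain g : (forall s z, s \in dom c -> ~ W ((gsimplex uc g s : continuousType _ _) z)) ->
    chain_in (~` W) (A g).
  move=> gW; apply: fg_in_mulz; apply: (@push_in _ _ _ _ _ (fun s => s \in dom c)) => // s sc.
  by move=> _ [z _ <-]; exact: gW.
rewrite raddfB /= !truncU.
have -> : \sum_(g <- P) push (deck_map uc g) c *~
    (repr (Linf_act f h) : Linf_fun mu) (act g^-1%g x) = \sum_(g <- P) A g.
  by apply: eq_bigr => g _; rewrite fx.
have -> : \sum_(g <- P) push (deck_map uc g) (chain_act uc h c) *~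
    (repr f : Linf_fun mu) (act g^-1%g x) = \sum_(g <- map (fun g => g * h)%g P) A g.
  rewrite big_map; apply: eq_bigr => g _; rewrite /A push_deckM.
  by rewrite -[in RHS]actMx invgM mulgA mulgV mul1g.
apply: fg_in_sumB => //.
- by rewrite map_inj_uniq//; exact: mulIg.
- move=> g gP gP'; apply: Ain => s z sc Wz; move/negP : gP'; apply.
  apply/mapP; exists (g * h^-1)%g; last by rewrite -mulgA mulVg mulg1.
  apply: (SP (gsimplex uc h s) _ z); first by rewrite mem_cat map_f.
  by rewrite -gsimplexM -mulgA mulVg mulg1.
- move=> g _ gP; apply: Ain => s z sc Wz; move/negP : gP; apply.
  by apply: (SP s _ z) => //; rewrite mem_cat sc orbT.
Qed.

End Truncation.

(** * Degrees of classes of a fundamental cycle *)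

Section Configurations.
Context {G : groupType} {m : nat}.
Implicit Types (F : 'I_m -> G -> int) (C : set G).

(** [F j g] is the coefficient at the [g]-translate of the [j]-th simplex, whose
    first two vertices are in the translates of a fundamental domain given by
    [g * a j] and [g * b j].  The edges with nonzero coefficient generate an
    equivalence relation on [G]; the closed sets are the unions of classes. *)
Definition edge_closed (a b : 'I_m -> G) F C :=
  forall g j, F j g <> 0 -> (C (g * a j)%g <-> C (g * b j)%g).

(** The degree (mod 2) of the part of the cycle that belongs to [C]. *)
Definition config_degree (a : 'I_m -> G) (Q : seq (G * 'I_m)) F C : bool :=
  \sum_(q <- Q) (if `[< C (q.1 * a q.2)%g >] then 1 *~ F q.2 q.1 else 0).

(** All that is retained from topology: the total degree is odd, and the degree of a union of
    classes is invariant under translation of the whole configuration. *)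
Definition good_config a b Q F := config_degree a Q F setT = 1 /\
  forall C h, edge_closed a b F C ->
    config_degree a Q (fun j g => F j (h^-1 * g)%g) (fun g => C (h^-1 * g)%g) =
    config_degree a Q F C.

End Configurations.

Lemma sd_range_in (R : realType) (T : topologicalType) k K (c : chain R k T) :
  fg_in (fun t : ssimplex R k T => exists2 r, r \in dom c &
    range (t : continuousType _ _) `<=` range (r : continuousType _ _)) (sd K c).
Proof.
apply: (@fg_lift_in _ _ (fun r => r \in dom c)) => // r rc /= t td; exists r => //.
apply: (@sd_range R T k (range (r : continuousType _ _)) K << r >>) td.
exact: fg_inU.
Qed.

Section CycleConfiguration.
Context {R : realType} {n : nat} {M : topologicalType}.
Hypotheses (hausM : hausdorff_space M) (eucM : locally_euclidean R n.+1 M).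
Variable o : orientation R n.+1 M.
Context {x0 : M} {G : groupType} {phi : fundamental_group R x0 G}.
Context {Mt : topologicalType}.
Variable uc : universal_covering phi Mt.

Local Notation pm := (ucov_map uc).
Local Notation deck := (deck uc).
Local Notation y0 := (ucov_base uc).
Local Notation degree := (covering_degree hausM eucM o uc).
Local Notation gsimplex := (gsimplex uc).
Local Notation small := (fun s => small_simplex uc s).
Local Notation cover := (translates_cover uc).

Variables (m : nat) (s : 'I_m -> ssimplex R n.+1 Mt) (F : 'I_m -> G -> int).
Variables (z : chain R n.+1 Mt) (B : seq G -> chain R n.+2 Mt).
Variables (S : seq (ssimplex R n.+1 Mt)) (K : nat) (nu : Mt -> G).

Definition weighted_simplices (g : G) : chain R n.+1 Mt :=
  \sum_(j < m) << gsimplex g (s j) >> *~ F j g.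

Local Notation A := weighted_simplices.

Hypothesis nuM : forall g y, nu (deck g y) = (g * nu y)%g.
Hypotheses (sS : forall j, s j \in S) (zS : {subset dom z <= S}).
(** The finite shadow of a homology between the locally finite chain with coefficients [F] and the
    full lift of a fundamental cycle. *)
Hypothesis homologous : forall W P, uniq P -> cover S W P -> chain_in (~` W)
  (\sum_(g <- P) A g - \sum_(g <- P) push (deck_map uc g) z - bdry (B P)).
Hypotheses (small_s : forall j, fg_in small (sd K << s j >>))
  (small_z : fg_in small (sd K z)) (small_B : forall P, fg_in small (sd K (B P))).
Hypothesis z_fundamental : fundamental_cycle o (push pm z).

Let v0 : @stdsimplex R n.+1 := vertex ord0.
Let v1 : @stdsimplex R n.+1 := vertex (fintype.lift ord0 ord0).

Definition edge_start j := nu ((s j : continuousType _ _) v0).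
Definition edge_end j := nu ((s j : continuousType _ _) v1).

Definition class_part k (C : set G) : chain R k Mt -> chain R k Mt :=
  fg_restr [set t | C (nu ((t : continuousType _ _) (vertex ord0)))].

HB.instance Definition _ k C := GRing.isZmodMorphism.Build _ _ (@class_part k C)
  (lift_is_additive _).

Lemma cover_sub P W W' : W' `<=` W -> cover S W P -> cover S W' P.
Proof. by move=> WW' H t g x tS /WW'; exact: H. Qed.

(** Every face starts at vertex 0 or at vertex 1 of the simplex. So a single edge per simplex
    decides whether cutting by first vertices commutes with the boundary; this keeps the cost of the
    edges at one support per simplex. *)
Lemma bdry_class_partU C (t : ssimplex R n.+1 Mt) :
  (C (nu ((t : continuousType _ _) v0)) <-> C (nu ((t : continuousType _ _) v1))) ->
  bdry (class_part C << t >>) = class_part C (bdry << t >>).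
Proof.
move=> Ct.
have Cface (i : 'I_n.+2) : C (nu ((t : continuousType _ _) (face i (vertex ord0)))) <->
    C (nu ((t : continuousType _ _) v0)).
  rewrite face_vertex; case: (unliftP ord0 i) => [j ->|->]; last by rewrite Ct.
  by have -> : fintype.lift (fintype.lift ord0 j) (@ord0 n) = ord0 :> 'I_n.+2 by exact/val_inj.
rewrite bdryU [RHS]raddf_sum /= /class_part fg_restrU; case: asboolP => /= tC.
  rewrite bdryU; apply: eq_bigr => i _.
  rewrite fg_mulz raddfMz /= fg_restrU asboolT//=; exact/Cface.
rewrite raddf0 big1// => i _.
by rewrite fg_mulz raddfMz /= fg_restrU asboolF ?mul0rz//= => /Cface.
Qed.

Lemma gsimplex_start g j : nu ((gsimplex g (s j) : continuousType _ _) v0) = (g * edge_start j)%g.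
Proof. exact: nuM. Qed.

Lemma gsimplex_end g j : nu ((gsimplex g (s j) : continuousType _ _) v1) = (g * edge_end j)%g.
Proof. exact: nuM. Qed.

Lemma bdry_class_part C (P : seq G) : edge_closed edge_start edge_end F C ->
  bdry (class_part C (\sum_(g <- P) A g)) = class_part C (bdry (\sum_(g <- P) A g)).
Proof.
move=> CF; rewrite !raddf_sum; apply: eq_bigr => g _ /=.
rewrite !raddf_sum; apply: eq_bigr => j _ /=.
rewrite !raddfMz /=; have [->|/eqP F0] := eqVneq (F j g) 0; first by rewrite !mulr0z.
by rewrite bdry_class_partU// gsimplex_start gsimplex_end; exact: CF.
Qed.

(** For a simplex [t] that meets [W], its coefficient in the sum of translates equals the
    coefficient of its projection in [push pm c], because [G] acts freely and transitively on the
    lifts of a simplex. *)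
Lemma push_translates_miss k (c : chain R k Mt) W P : uniq P -> push pm c = 0 ->
  cover (dom c) W P -> chain_in (~` W) (\sum_(g <- P) push (deck_map uc g) c).
Proof.
move=> uP c0 cP t; rewrite mem_dom => tc _ [x _ <-] Wt; move/eqP : tc; apply.
have e : coeff (push_simplex pm t) (push pm c) = 0 by rewrite c0 coeff0.
rewrite -[RHS]e raddf_sum /=.
pose f (c : chain R k Mt) : int := \sum_(g <- P) coeff t (push (deck_map uc g) c).
have fB : zmod_morphism f.
  by move=> a b; rewrite /f -sumrB; apply: eq_bigr => g _; rewrite !raddfB.
have [L LE] : exists L : {additive chain R k Mt -> int}, L =1 f.
  pose L : {additive chain R k Mt -> int} :=
    HB.pack f (GRing.isZmodMorphism.Build _ _ f fB).
  by exists L.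
rewrite -/(f c) -LE.
apply: (@fg_ext _ _ L (@coeff _ _ (push_simplex pm t) \o @push R _ _ pm k)) => r rc /=.
rewrite LE /f pushU coeffU mul1r.
under eq_bigr do rewrite chain_actU coeffU mul1r.
have [/gsimplex_transitive[g gr]|ne] := eqVneq (push_simplex pm r) (push_simplex pm t).
  have gP : g \in P by apply: (cP r g x) => //; rewrite gr.
  rewrite (big_rem g)//= gr eqxx big_seq big1 ?addr0// => h.
  rewrite mem_rem_uniq// inE => /andP[hg hP]; case: eqP => // hr.
  by move/eqP : hg; case; apply: (@gsimplex_inj _ _ _ _ _ _ uc _ r); rewrite hr.
rewrite big1// => g _; case: eqP => // gr.
by move/eqP : ne; case; rewrite -gr push_gsimplex.
Qed.

Lemma bdry_push_z : push pm (bdry z) = 0.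
Proof. by rewrite -bdry_push; case: z_fundamental. Qed.

Lemma decomposition W P : uniq P -> cover S W P -> exists2 r, chain_in (~` W) r &
  \sum_(g <- P) A g = r + \sum_(g <- P) push (deck_map uc g) z + bdry (B P).
Proof.
move=> uP SP; have rW := homologous uP SP.
by eexists; [exact: rW|rewrite addrAC !subrK].
Qed.

Lemma class_part_cycle C W P : edge_closed edge_start edge_end F C -> uniq P ->
  cover S W P -> chain_in (~` W) (bdry (class_part C (\sum_(g <- P) A g))).
Proof.
move=> CF uP SP; rewrite bdry_class_part//; apply: fg_restr_sub.
have zW : chain_in (~` W) (\sum_(g <- P) push (deck_map uc g) (bdry z)).
  apply: push_translates_miss => //; first exact: bdry_push_z.
  move=> t g x tz Wx.
  have [r rz [y ry]] : exists2 r, r \in dom z & exists y, (r : continuousType _ _) y = (t : continuousType _ _) x.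
    have H : fg_in (fun t : ssimplex R n Mt => forall x, exists2 r, r \in dom z &
        exists y, (r : continuousType _ _) y = (t : continuousType _ _) x) (bdry z).
      apply: (@bdry_in _ _ _ (fun r => r \in dom z)) => // r i rz x'.
      by exists r => //; exists (face i x').
    exact: H tz x.
  apply: (SP r g y); first exact: zS.
  by rewrite gsimplexE ry.
have [r rW ->] := decomposition uP SP.
rewrite !raddfD /= bdry_bdry addr0; apply: fg_inD.
  apply: (@bdry_in _ _ _ (fun s => range (s : continuousType _ _) `<=` ~` W)) rW.
  by move=> t i tW _ [x _ <-]; apply: tW; exists (face i x).
rewrite raddf_sum /=; under eq_bigr do rewrite bdry_push.
exact: zW.
Qed.

Lemma A_miss g W : (forall j x, ~ W ((gsimplex g (s j) : continuousType _ _) x)) ->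
  chain_in (~` W) (A g).
Proof.
move=> gW; apply: fg_in_sum => j _; apply: fg_in_mulz; apply: fg_inU.
by move=> _ [x _ <-]; exact: gW.
Qed.

Lemma degree_cover_indep C y P P' : uniq P -> uniq P' ->
  cover S [set y] P -> cover S [set y] P' ->
  degree y (sd K (class_part C (\sum_(g <- P) A g))) =
  degree y (sd K (class_part C (\sum_(g <- P') A g))).
Proof.
move=> uP uP' SP SP'; apply/eqP; rewrite -subr_eq0 -!raddfB; apply/eqP.
apply: covering_degree_miss; apply: sd_range; apply: fg_restr_sub.
apply: fg_in_sumB => // g _ gP; apply: A_miss => j x gx; move/negP : gP; apply.
  exact: (SP' (s j) g x).
exact: (SP (s j) g x).
Qed.

Lemma small_part C P : fg_in small (sd K (class_part C (\sum_(g <- P) A g))).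
Proof.
rewrite !raddf_sum; apply: fg_in_sum => g _ /=.
rewrite !raddf_sum; apply: fg_in_sum => j _ /=.
rewrite !raddfMz /=; apply: fg_in_mulz; rewrite /class_part fg_restrU.
case: asboolP => _; last by rewrite raddf0; exact: fg_in0.
rewrite -chain_actU -push_sd.
apply: (@push_in _ _ _ _ _ small small) (@small_s j) => t; exact: small_gsimplex.
Qed.

(** Near each point one finite [P] suffices, and there the class part is a relative cycle, so its
    degree is locally constant; the covering is connected. *)
Lemma degree_part_constant C y y' P P' : edge_closed edge_start edge_end F C ->
  uniq P -> uniq P' -> cover S [set y] P -> cover S [set y'] P' ->
  degree y (sd K (class_part C (\sum_(g <- P) A g))) =
  degree y' (sd K (class_part C (\sum_(g <- P') A g))).
Proof.
move=> CF uP uP' SP SP'.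
pose b := degree y (sd K (class_part C (\sum_(g <- P) A g))).
pose Pr w := forall P, uniq P -> cover S [set w] P ->
  degree w (sd K (class_part C (\sum_(g <- P) A g))) = b.
suff : Pr y' by move=> /(_ P' uP' SP') ->.
apply: (@ucov_locally_constant _ _ _ _ _ _ uc Pr _ y y'); last first.
  by move=> P1 uP1 SP1; exact: degree_cover_indep.
move=> w; have [W nW [P1 uP1 SP1]] := translates_cover_ex uc S w hausM.
have PrE w' : W w' -> Pr w' <-> degree w' (sd K (class_part C (\sum_(g <- P1) A g))) = b.
  move=> Ww'; have SP1' : cover S [set w'] P1 by apply: cover_sub SP1 => _ ->.
  split; first exact.
  by move=> e P2 uP2 SP2; rewrite -[RHS]e; exact: degree_cover_indep.
have cyc := class_part_cycle CF uP1 SP1.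
have := @covering_degree_locally_constant _ _ _ hausM eucM o _ _ _ _ uc _ W w (@small_part C P1) nW.
rewrite bdry_sd => /(_ (sd_range cyc)).
have Ww := nbhs_singleton nW.
by apply: filterS2 nW => w' Ww' e; rewrite (PrE w')// (PrE w)// e.
Qed.

(** The error term avoids [y0] and the boundary has degree zero. What remains are the translates of
    [z], whose degrees at [y0] add up to the local degree of the fundamental cycle below. *)
Lemma degree_total P : uniq P -> cover S [set y0] P ->
  degree y0 (sd K (\sum_(g <- P) A g)) = 1.
Proof.
move=> uP SP; have [r rW ->] := decomposition uP SP.
rewrite !raddfD /= -bdry_sd covering_degree_bdry// addr0.
rewrite covering_degree_miss ?add0r; last exact: sd_range.
rewrite !raddf_sum /=; under eq_bigr do rewrite -push_sd.
rewrite covering_degree_sum//; last first.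
  move=> t g x tz e.
  have [r0 rz [y ry]] : exists2 r, r \in dom z & exists y, (r : continuousType _ _) y = (t : continuousType _ _) x.
    have [r1 rz tr] := sd_range_in tz.
    have [y _ ry] : range (r1 : continuousType _ _) ((t : continuousType _ _) x) by apply: tr; exists x.
    by exists r1 => //; exists y.
  apply: (SP r0 g y); first exact: zS.
  by rewrite gsimplexE ry.
rewrite push_sd -(local_degree_or hausM eucM o (ucov uc y0) K).
apply: local_degree_homologous.
have [b [a qa ab]] := z_fundamental.2 (ucov uc y0).
exists (sd K b), (sd K a); first exact: sd_range.
by rewrite -raddfB ab raddfD /= bdry_sd.
Qed.

Lemma degree_class_part C P y :
  degree y (sd K (class_part C (\sum_(g <- P) A g))) =
  \sum_(g <- P) \sum_(j < m) (if `[< C (g * edge_start j)%g >]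
    then degree y (sd K << gsimplex g (s j) >>) *~ F j g else 0).
Proof.
rewrite 3!raddf_sum; apply: eq_bigr => g _ /=.
rewrite 3!raddf_sum; apply: eq_bigr => j _ /=.
rewrite /class_part fg_mulz raddfMz /= fg_restrU /=.
rewrite -/v0 gsimplex_start.
by case: asboolP => _; rewrite ?mul0rz ?raddf0// 2!raddfMz.
Qed.

Definition degree_support (P : seq G) : seq (G * 'I_m) :=
  [seq q <- [seq (g, j) | g <- P, j <- index_enum 'I_m] |
    degree y0 (sd K << gsimplex q.1 (s q.2) >>)].

Lemma config_degreeE P (F' : 'I_m -> G -> int) C :
  config_degree edge_start (degree_support P) F' C =
  \sum_(g <- P) \sum_(j < m) (if `[< C (g * edge_start j)%g >]
    then degree y0 (sd K << gsimplex g (s j) >>) *~ F' j g else 0).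
Proof.
rewrite /config_degree /degree_support big_filter big_mkcond big_allpairs.
apply: eq_bigr => g _; apply: eq_bigr => j _ /=.
case: (degree _ _) => //; last by case: asboolP; rewrite ?mul0rz.
Qed.

(** Translating the configuration by [h] amounts to measuring the degree at the translate of [y0] by
    the inverse of [h], so the invariance is the constancy of the degree on the covering. *)
Lemma cycle_good_config P : uniq P -> cover S [set y0] P ->
  good_config edge_start edge_end (degree_support P) F.
Proof.
move=> uP SP; split.
  rewrite config_degreeE -(degree_total uP SP) -degree_class_part.
  congr (degree _ (sd K _)); apply: fg_restr_id => t _ //.
move=> C h CF; rewrite !config_degreeE -degree_class_part.
pose P' := map (fun g => h^-1 * g)%g P.
have uP' : uniq P' by rewrite map_inj_uniq//; exact: mulgI.
have SP' : cover S [set deck h^-1%g y0] P'.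
  move=> t g x tS /= e; apply/mapP; exists (h * g)%g; last by rewrite mulKg.
  apply: (SP t (h * g)%g x tS).
  change ((gsimplex (h * g)%g t : continuousType _ _) x = y0).
  rewrite gsimplexM gsimplexE.
  have -> : (gsimplex g t : continuousType _ _) x = deck h^-1%g y0 by exact: e.
  by rewrite -actMx mulgV act1x.
rewrite (degree_part_constant CF uP uP' SP SP') degree_class_part.
rewrite [RHS]big_map; apply: eq_bigr => g _; apply: eq_bigr => j _.
rewrite mulgA; case: asboolP => // _; congr (_ *~ _).
rewrite -[RHS](covering_degree_deck hausM eucM o uc h) -actMx mulgV act1x push_sd chain_actU.
by rewrite -gsimplexM mulVKg.
Qed.

End CycleConfiguration.

Section TensorQuotient.
Context {G : Type} {A B : zmodType} (ra : A -> G -> A) (la : G -> B -> B).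

Definition tensor_pi (u : {freeg (A * B)}) : tensor ra la := \pi_(tensor ra la) u.

Lemma tensor_pi_is_additive : zmod_morphism tensor_pi.
Proof. exact: (pi_is_zmod_morphism (tensor ra la)). Qed.

HB.instance Definition _ := GRing.isZmodMorphism.Build _ _ tensor_pi
  tensor_pi_is_additive.

Lemma tensor_pi_eq u v : tensor_pi u = tensor_pi v -> u - v \in tensor_null ra la.
Proof. by move=> uv; rewrite Quotient.idealrBE; apply/eqP. Qed.

End TensorQuotient.

Lemma tensor_map_pi (G : Type) (A B B' : zmodType) (ra : A -> G -> A)
    (la : G -> B -> B) (la' : G -> B' -> B') (h : B -> B') (x : tensor ra la) :
  tensor_map la' h x = tensor_pi ra la'
    (fg_hom (fun ab : A * B => << (ab.1, h ab.2) >>) (repr x)).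
Proof.
apply: (@fg_ext _ _ (fg_hom (fun ab : A * B => tens ra la' ab.1 (h ab.2)))
  (tensor_pi ra la' \o fg_hom (fun ab : A * B => << (ab.1, h ab.2) >>))) => ab _ /=.
by rewrite !fg_homU.
Qed.

Section FundamentalCycles.
Context {R : realType} {n : nat} {M : topologicalType}.
Hypotheses (hausM : hausdorff_space M) (eucM : locally_euclidean R n.+1 M).
Variable o : orientation R n.+1 M.
Context {x0 : M} {G : groupType} {phi : fundamental_group R x0 G}.
Context {Mt : topologicalType}.
Variable uc : universal_covering phi Mt.
Variable alpha : standard_space R G.
Hypothesis countG : countable [set: G].

Local Notation mu := (ss_mu alpha).
Local Notation act := (ss_act alpha).

Lemma small_sd k (S : seq (ssimplex R k Mt)) : \forall K \near \oo,
  forall s, s \in S -> fg_in (fun t => small_simplex uc t) (sd K << s >>).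
Proof.
have [V VP] := choice (fun y => covering_sheet (ucov_covering uc) y).
elim: S => [|s S IH]; first exact: nearW.
have oV y : open (V y) by have [] := VP y.
have cV x : exists y, V y ((s : continuousType _ _) x).
  by exists ((s : continuousType _ _) x); have [] := VP ((s : continuousType _ _) x).
apply: filterS2 (sd_cover oV cV) IH => K sK SK t.
rewrite inE => /orP[/eqP ->|]; last exact: SK.
apply: fg_in_sub sK => r [y ry] z z' e; have [_ _ Vi] := VP y.
by apply: Vi => //; rewrite inE; apply: ry; [exists z|exists z'].
Qed.

Lemma small_sd_chain k K (c : chain R k Mt) :
  (forall s, s \in dom c -> fg_in (fun t => small_simplex uc t) (sd K << s >>)) ->
  fg_in (fun t => small_simplex uc t) (sd K c).
Proof.
by move=> cK; apply: (@fg_lift_in _ _ (fun s => s \in dom c)).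
Qed.

Lemma trunc_bdry k x P (v : {freeg (Linf mu * chain R k.+1 Mt)}) :
  trunc uc x P (fg_hom (fun ab : Linf mu * chain R k.+1 Mt =>
    << (ab.1, bdry ab.2) >>) v) = bdry (trunc uc x P v).
Proof.
apply: (@fg_ext _ _ (trunc uc x P \o fg_hom (fun ab : Linf mu * chain R k.+1 Mt =>
    << (ab.1, bdry ab.2) >>)) (@bdry _ _ _ \o trunc uc x P)) => -[h c] _ /=.
rewrite fg_homU !truncU raddf_sum; apply: eq_bigr => g _ /=.
by rewrite raddfMz /= bdry_push.
Qed.

Lemma small_sd_trunc k K x P (v : {freeg (Linf mu * chain R k Mt)}) :
  (forall ab t, ab \in dom v -> t \in dom ab.2 ->
    fg_in (fun t => small_simplex uc t) (sd K << t >>)) ->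
  fg_in (fun t => small_simplex uc t) (sd K (trunc uc x P v)).
Proof.
move=> vK; apply: (@fg_lift_in _ _ (fun ab => ab \in dom v) _ (@sd R K _ _ \o trunc uc x P)) => // -[h c] cv /=.
rewrite truncU raddf_sum; apply: fg_in_sum => g _ /=.
rewrite raddfMz; apply: fg_in_mulz => /=; rewrite -push_sd.
apply: (@push_in _ _ _ _ _ (fun t => small_simplex uc t)) => [t|].
  exact: small_gsimplex.
by apply: small_sd_chain => t tc; apply: (vK (h, c)).
Qed.

(** At almost every point the tensor identity between [c], the fundamental cycle and a boundary
    becomes an identity of truncations, to which [cycle_good_config] applies; [a], [b] and [Q] do
    not depend on the point. *)
Lemma fundamental_cycle_config (c : param_chain uc alpha n.+1) (m : nat)
    (f : 'I_m -> Linf mu) (s : 'I_m -> ssimplex R n.+1 Mt) :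
  param_fundamental_cycle o c -> c = \sum_(j < m) ptens uc (f j) << s j >> ->
  exists (a b : 'I_m -> G) Q, {ae mu, forall x,
    good_config a b Q (fun j g => (repr (f j) : Linf_fun mu) (act g^-1%g x))}.
Proof.
move=> [z zfund [b cb]] cE.
pose la k := @chain_act R M x0 G phi Mt uc k.
pose ra := @Linf_act R G alpha.
pose u : {freeg (Linf mu * chain R n.+1 Mt)} := \sum_(j < m) << (f j, << s j >>) >>
  - << (Linf1 mu, z) >> -
  fg_hom (fun ab : Linf mu * chain R n.+2 Mt => << (ab.1, bdry ab.2) >>) (repr b).
have unull : u \in tensor_null ra (la n.+1).
  apply: tensor_pi_eq; rewrite -(tensor_map_pi (la n.+1)) raddfB raddf_sum.
  by rewrite -[tensor_map _ _ _]cb cE.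
have [S0 S0P] := tensor_null_trunc countG unull.
pose S := S0 ++ [seq s j | j <- index_enum 'I_m] ++ dom z.
pose zz := flatten [seq dom ab.2 | ab <- dom (repr b : {freeg (Linf mu * chain R n.+2 Mt)})].
(* Up to translation only finitely many simplices occur, including those of the filling [b], so one
   number of subdivisions makes all of them small, for every point of the space. *)
have [K [SK zzK]] : exists K, (forall t, t \in S -> fg_in (fun t => small_simplex uc t) (sd K << t >>)) /\
    (forall t, t \in zz -> fg_in (fun t => small_simplex uc t) (sd K << t >>)).
  have [K [SK zzK]] := filter_ex (filterI (small_sd S) (small_sd zz)).
  by exists K.
have [nu nuM] := deck_coordinate uc.
have [W nW [P uP SP]] := translates_cover_ex uc S (ucov_base uc) hausM.
have SP0 : translates_cover uc S [set ucov_base uc] P.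
  move=> t g x tS e; apply: (SP t g x tS).
  by have -> : (gsimplex uc g t : continuousType _ _) x = ucov_base uc by []; exact: nbhs_singleton nW.
exists (edge_start s nu), (edge_end s nu), (degree_support hausM eucM o uc s K P).
have one : {ae mu, forall x, forall g, (repr (Linf1 mu) : Linf_fun mu) (act g^-1%g x) = 1}.
  apply: (@ae_forall_group R G alpha (fun g x => (repr (Linf1 mu) : Linf_fun mu) (act g^-1%g x) = 1)) => // g.
  exact: (@ae_act R G alpha g^-1%g (fun x => (repr (Linf1 mu) : Linf_fun mu) x = 1)) (@Linf_repr1 R G alpha).
apply: filterS2 S0P one => x S0P one.
pose F j g := (repr (f j) : Linf_fun mu) (act g^-1%g x).
pose B P := trunc uc x P (repr b : {freeg (Linf mu * chain R n.+2 Mt)}).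
apply: (@cycle_good_config _ _ _ hausM eucM o _ _ _ _ uc m s F z B S K nu) => //.
- by move=> j; rewrite !mem_cat map_f ?orbT// mem_index_enum.
- by move=> t tz; rewrite !mem_cat tz !orbT.
- move=> W1 P1 uP1 SP1.
  have SP01 : translates_cover uc S0 W1 P1.
    by apply: translates_cover_sub SP1 => t tS0; rewrite mem_cat tS0.
  have := S0P W1 P1 uP1 SP01; rewrite /u 2!raddfB raddf_sum /= truncU.
  rewrite trunc_bdry; congr (chain_in _ (_ - _ - _)).
    rewrite exchange_big /=; apply: eq_bigr => j _; rewrite truncU.
    by apply: eq_bigr => g _; rewrite chain_actU.
  by apply: eq_bigr => g _; rewrite one mulr1z.
- by move=> j; apply: SK; rewrite !mem_cat map_f ?orbT// mem_index_enum.
- by apply: small_sd_chain => t tz; apply: SK; rewrite !mem_cat tz !orbT.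
- move=> P1; apply: small_sd_trunc => ab t abd tab; apply: zzK.
  by apply/flattenP; exists (dom ab.2) => //; apply/mapP; exists ab.
Qed.

End FundamentalCycles.

(** * Bounds for the cost and vanishing markers *)

Lemma countable_enum_on (T : Type) (x : T) (D : set T) : countable D ->
  exists e : nat -> T, forall y, D y -> exists n, e n = y.
Proof.
move=> /countable_injP[f fi].
have eP n : exists y, forall z, D z -> f z = n -> y = z.
  have [[z [Dz zn]]|nz] := pselect (exists z, D z /\ f z = n).
    by exists z => z' Dz' z'n; apply: fi; rewrite ?inE// zn.
  by exists x => z Dz zn; exfalso; apply: nz; exists z.
have [e eP'] := choice eP.
by exists e => y Dy; exists (f y); exact: eP'.
Qed.

Lemma separable_basis (R : realType) (P : pseudoPMetricType R) (D : set P) :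
  countable D -> dense D -> exists V : nat -> set P, (forall n, open (V n)) /\
    forall y A, nbhs y A -> exists n, V n y /\ V n `<=` A.
Proof.
move=> cD dD; have [e eD] := countable_enum_on point cD.
pose V (n : nat) : set P := if (unpickle n : option (nat * nat)%type) is Some kl
  then (ball (e kl.1) (kl.2.+1%:R^-1))^° else set0.
exists V; split=> [n|y A /nbhs_ballP[r /= r0 rA]].
  by rewrite /V; case: unpickle => [kl|]; [exact: open_interior|exact: open0].
have [l lr] : exists l : nat, l.+1%:R^-1 < r / 2.
  have /ltr_add_invr[l] : (0 : R) < r / 2 by rewrite divr_gt0.
  by rewrite add0r => lr; exists l.
pose s : R := l.+1%:R^-1.
have s0 : 0 < s by rewrite invr_gt0.
have [z [/= xz Dz]] : (ball y (s / 2))^° `&` D !=set0.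
  apply: dD; last exact: open_interior.
  by exists y; apply: nbhsx_ballx; rewrite divr_gt0.
have xz' : ball y (s / 2) z by exact: interior_subset xz.
have [k ek] := eD _ Dz.
have VE : V (pickle (k, l)) = (ball z s)^° by rewrite /V pickleK /= ek.
exists (pickle (k, l)); rewrite VE; split.
  apply/nbhs_ballP; exists (s / 2); first by rewrite /= divr_gt0.
  move=> w /= xw; rewrite (splitr s); apply: ball_triangle xw.
  exact: ball_sym.
move=> w /interior_subset zw; apply: rA; rewrite (splitr r).
apply: (@ball_triangle _ _ z).
  apply: le_ball xz'; apply: le_trans (ltW lr).
  by rewrite ler_pdivrMr ?ler_peMr ?ler1n// ltW.
by apply: le_ball zw; exact: ltW.
Qed.

Lemma standard_borel_separating (R : realType) d (X : measurableType d) :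
  standard_borel R X -> exists U : nat -> set X, (forall n, measurable (U n)) /\
    forall x y, (forall n, U n x <-> U n y) -> x = y.
Proof.
move=> [P [f [hP [D cD dD] bf mf]]]; have [V [oV VP]] := separable_basis cD dD.
exists (fun n => f @^-1` V n); split=> [n|x y Vxy].
  by apply/mf; exact: sub_sigma_algebra.
apply: (bij_inj bf); apply: contrapT => xy.
have [[A B] /= [/set_mem Ax /set_mem By] [oA oB /eqP AB]] : exists2 AB : set P * set P,
    f x \in AB.1 /\ f y \in AB.2 & [/\ open AB.1, open AB.2 & AB.1 `&` AB.2 == set0].
  by have := hP; rewrite open_hausdorff; apply; exact/eqP.
have [n [Vx VA]] := VP _ _ (open_nbhs_nbhs (conj oA Ax)).
have : (A `&` B) (f y) by split=> //; apply: VA; exact: (Vxy n).1.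
by rewrite AB.
Qed.

Section CostBound.
Context {R : realType} {G : groupType} (alpha : standard_space R G).
Hypothesis countG : countable [set: G].

Local Notation X := (ss_space alpha).
Local Notation mu := (ss_mu alpha).
Local Notation act := (ss_act alpha).

Lemma act_preimage (g : G) (A : set X) : act g @` A = act g^-1%g @^-1` A.
Proof.
apply/seteqP; split=> [_ [x Ax <-]|x Ax] /=; first by rewrite -actMx mulVg act1x.
by exists (act g^-1%g x) => //; rewrite -actMx mulgV act1x.
Qed.

Lemma act_injective (g : G) : injective (act g).
Proof. by move=> x y e; rewrite -(act1x act x) -(mulVg g) actMx e -actMx mulVg act1x. Qed.

Definition act_piso (g : G) (D : set X) (mD : measurable D) :
  partial_iso (orbit_relation alpha).
Proof.
apply: (@PartialIso _ _ _ D (act g)) => //.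
- by move=> x y _ _; exact: act_injective.
- by apply: measurable_funS (ss_measurable g).
- by move=> A mA _; rewrite act_preimage; exact: act_measurable.
- by move=> x _; exists g^-1%g => /=; rewrite -actMx mulVg act1x.
Defined.

(** Everything outside an invariant null set has to be generated by the finite family. *)
Lemma action_cost_le (J : finType) (D : J -> set X) (h : J -> G) (N : set X) :
  (forall j, measurable (D j)) -> measurable N -> mu N = 0 ->
  (forall E, is_equivalence E -> (forall j x, D j x -> E (x, act (h j) x)) ->
    (forall x g, N x -> E (x, act g x)) -> forall x g, E (x, act g x)) ->
  (action_cost alpha <= \sum_j mu (D j))%E.
Proof.
move=> mD mN N0 gen.
have [e eP] := countable_enum 1%g countG.
(* The first indices carry the given maps; all later ones carry the null set with an enumeration of
   the whole group, which costs nothing. *)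
pose D' k := if (insub k : option 'I_#|J|) is Some i then D (enum_val i) else N.
pose h' k := if (insub k : option 'I_#|J|) is Some i then h (enum_val i)
  else e (k - #|J|)%N.
have mD' k : measurable (D' k) by rewrite /D'; case: insubP.
pose Phi k := act_piso (h' k) (mD' k).
have D'e (i : 'I_#|J|) : D' i = D (enum_val i) /\ h' i = h (enum_val i).
  by rewrite /D' /h' valK.
have D'N k : D' (#|J| + k)%N = N /\ h' (#|J| + k)%N = e k.
  by rewrite /D' /h' insubF ?addKn//= ltnNge leq_addr.
apply: (@le_trans _ _ (graphing_cost mu Phi)).
  apply: ereal_inf_lbound; exists nat, Phi; split => //.
  apply/seteqP; split=> [[x y] [g /= ->] E [eqE genE]|].
    apply: gen => // [j z Dz|z g' Nz]; apply: genE.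
      exists (enum_rank j); rewrite /= (D'e _).1 (D'e _).2 enum_rankK; split=> //.
    have [k <-] := eP g'.
    by exists (#|J| + k)%N; rewrite /= (D'N _).1 (D'N _).2.
  apply: smallest_sub => [|[x y] [k [_ /= ->]]]; last by exists (h' k).
  split.
  - by move=> x; exists 1%g; rewrite act1x.
  - by move=> x y [g /= ->]; exists g^-1%g; rewrite -actMx mulVg act1x.
  - by move=> x y z [g /= ->] [g' /= ->]; exists (g' * g)%g; rewrite actMx.
rewrite /graphing_cost -nneseries_esumT//.
rewrite (@nneseries_split _ _ 0 #|J|)// add0n eseries0 ?adde0.
  rewrite big_mkord (reindex _ (onW_bij _ (@enum_rank_bij J))) /=.
  by apply: lee_sum => j _; rewrite (D'e _).1 enum_rankK.
by move=> k Jk _ /=; rewrite -(subnKC Jk) (D'N _).1.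
Qed.

Lemma sum_seqDU_le (k : nat) (P : nat -> set X) : (forall i, measurable (P i)) ->
  (\sum_(i < k) mu (seqDU P i) <= mu (\bigcup_i P i))%E.
Proof.
move=> mP; have mS i : measurable (seqDU P i).
  by apply: measurableD => //; apply: bigsetU_measurable.
have -> : (\sum_(i < k) mu (seqDU P i) = mu (\big[setU/set0]_(i < k) seqDU P i))%E.
  by rewrite measure_bigsetU//; exact: trivIset_seqDU.
apply: le_measure; rewrite ?inE; first exact: bigsetU_measurable.
  exact: bigcup_measurable.
by rewrite seqDU_bigcup_eq; exact: bigsetU_bigcup.
Qed.

End CostBound.

Section Markers.
Context {R : realType} {G : groupType} (alpha : standard_space R G).
Hypothesis countG : countable [set: G].

Local Notation X := (ss_space alpha).
Local Notation act := (ss_act alpha).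

(** The common requirements of two uses of [markers]: with infinite sets it yields vanishing
    markers, with nonempty sets a transversal of the orbits. *)
Record largeness (big : set (set G)) := Largeness {
  largeU : forall P Q, big (P `|` Q) -> big P \/ big Q;
  large_shift : forall g P, big P -> big (fun h => P (g * h)%g);
  large_measurable : forall D : G -> set X, (forall g, measurable (D g)) ->
    measurable [set x | big [set g | D g x]] }.

Lemma infinite_largeness : largeness (fun P => infinite_set P).
Proof.
split.
- move=> P Q PQ; apply: contrapT => /not_orP[/contrapT fP /contrapT fQ].
  by apply: PQ; rewrite finite_setU.
- move=> g P iP fP; apply: iP.
  apply: sub_finite_set (finite_image (fun h => (g * h)%g) fP) => h Ph.
  by exists (g^-1 * h)%g; rewrite /= mulVKg.
move=> D mD; have /countable_injP[f fi] := countG.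
have infP P : infinite_set P <-> forall n : nat, exists g : G, (n <= f g)%N /\ P g.
  split=> [iP n|bP fP].
    apply: contrapT => nP; apply: iP.
    apply: (@sub_finite_set _ _ (f @^-1` `I_n)).
      by move=> g Pg /=; rewrite ltnNge; apply/negP => ng; apply: nP; exists g.
    apply: finite_preimage => // x y _ _; apply: fi; exact: in_setT.
  have [s Ps] := (finite_seqP P).1 fP.
  have [g [gn Pg]] := bP (\max_(g <- s) f g).+1.
  have gs : g \in s by move: Pg; rewrite Ps.
  by have := leq_trans gn (leq_bigmax_seq g gs isT); rewrite ltnn.
rewrite (_ : [set _ | _] = \bigcap_n \bigcup_g (if n <= f g then D g else set0)%N).
  apply: bigcapT_measurable => n; apply: countable_bigcupT_measurable => // g.
  by case: ifP.
apply/seteqP; split=> x /= => [/infP xD n _|xD].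
  by have [g [gn Dg]] := xD n; exists g; rewrite //= gn.
by apply/infP => n; have [g _] := xD n I; case: ifP => // gn Dg; exists g.
Qed.

Lemma nonempty_largeness : largeness (fun P => P !=set0).
Proof.
split=> [P Q [g [Pg|Qg]]|g P [h Ph]|D mD].
- by left; exists g.
- by right; exists g.
- by exists (g^-1 * h)%g; rewrite mulVKg.
- rewrite (_ : [set _ | _] = \bigcup_g D g); first exact: countable_bigcupT_measurable.
  by apply/seteqP; split=> [x [g Dg]|x [g _ Dg]]; exists g.
Qed.

Variable cl : X -> set G.
Hypothesis cl_act : forall x g, cl x g -> forall h, cl (act g^-1%g x) h <-> cl x (g * h)%g.
Hypothesis cl_measurable : forall g, measurable [set x | cl x g].

Definition visits x (B : set X) : set G := [set g | cl x g /\ B (act g^-1%g x)].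

Lemma visits_measurable g B : measurable B -> measurable [set x | visits x B g].
Proof.
move=> mB; apply: (@measurableI _ _ [set x | cl x g] (act g^-1%g @^-1` B)) => //.
exact: act_measurable.
Qed.

Lemma visits_act x g B : cl x g ->
  visits (act g^-1%g x) B = [set h | visits x B (g * h)%g].
Proof.
move=> xg; apply/seteqP; split=> h [xh Bh]; split; first exact/cl_act.
- by rewrite invgM actMx.
- exact/cl_act.
- by rewrite -actMx -invgM.
Qed.

(** Bisection along separating sets: in each class keep the half inside [U n] if it is still large,
    and the other half otherwise. Largeness depends only on the class, so two surviving points of
    one class lie on the same side of every [U n] and therefore coincide. *)
Lemma markers (big : set (set G)) (A : set X) : largeness big -> measurable A ->
  exists B : nat -> set X, [/\ B 0 = A, forall n, measurable (B n),
    forall n, B n.+1 `<=` B n,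
    forall x n, big (visits x A) -> big (visits x (B n)) &
    forall x g, cl x g -> (forall n, B n x) -> (forall n, B n (act g^-1%g x)) ->
      act g^-1%g x = x].
Proof.
move=> [bigU bigM mbig] mA.
have [U [mU sepU]] := standard_borel_separating (ss_borel alpha).
pose B := fix B n : set X := if n is n'.+1 then
  [set x | B n' x /\ (big (visits x (B n' `&` U n')) <-> U n' x)] else A.
have bigE x g S : cl x g -> big (visits (act g^-1%g x) S) <-> big (visits x S).
  move=> xg; rewrite visits_act//; split=> [/(bigM g^-1%g)|]; last exact: bigM.
  rewrite (_ : (fun h => _) = visits x S)//; apply/funext => h /=.
  by rewrite /= mulVKg.
exists B; split=> //.
- elim=> [//|n mB] /=.
  have mV : measurable [set x | big (visits x (B n `&` U n))].
    by apply: mbig => g; apply: visits_measurable; exact: measurableI.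
  rewrite (_ : [set _ | _] = B n `&` (([set x | big (visits x (B n `&` U n))] `&` U n)
    `|` (~` [set x | big (visits x (B n `&` U n))] `&` ~` U n))).
    by apply: measurableI => //; apply: measurableU; apply: measurableI => //; exact: measurableC.
  apply/seteqP; split=> x /= [Bx]; last by case=> -[]; split.
  by have [Ux|Ux] := pselect (U n x) => -[xU Ux']; split=> //; [left|right]; split; auto.
- by move=> n x [].
- move=> x n xA; elim: n => [//|n IH] /=.
  have : big (visits x (B n `&` U n) `|` visits x (B n `\` U n)).
    rewrite (_ : _ `|` _ = visits x (B n))//; apply/seteqP; split=> g /=.
      by move=> [] [? [? ?]]; split.
    move=> [xg Bg]; have [Ug|Ug] := pselect (U n (act g^-1%g x)); [left|right]; split=> //.
  have [b|nb] := pselect (big (visits x (B n `&` U n))).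
    move=> _; rewrite (_ : visits _ _ = visits x (B n `&` U n))//.
    apply/seteqP; split=> g [xg]; move/(bigE _ _ (B n `&` U n)) : (xg) => e.
      by move=> [Bg Ug]; split=> //; split=> //; apply/Ug/e.
    by move=> [Bg Ug]; split=> //; split=> //; split=> // _; apply/e.
  move=> /bigU[//|]; rewrite (_ : visits x (B n `\` U n) = visits x (B n.+1))//.
  apply/seteqP; split=> g [xg]; move/(bigE _ _ (B n `&` U n)) : (xg) => e.
    by move=> [Bg Ug]; split=> //; split=> //; split=> // /e.
  by move=> [Bg Ug]; split=> //; split=> // /Ug /e.
move=> x g xg Bx Bg; apply: sepU => n.
have [_ <-] := Bx n.+1; have [_ <-] := Bg n.+1; exact: bigE.
Qed.

End Markers.

(** * Classes and their degrees along orbits *)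

Section Classes.
Context {G : groupType} {m : nat} (a b : 'I_m -> G).
Implicit Types (F : 'I_m -> G -> int) (C : set G).

Definition edge_class F (g : G) : set G :=
  [set h | forall C, edge_closed a b F C -> C g -> C h].

Lemma edge_class_refl F g : edge_class F g g.
Proof. by move=> C. Qed.

Lemma edge_class_closed F g : edge_closed a b F (edge_class F g).
Proof.
by move=> h j Fh; split=> H C CF Cg; have := H C CF Cg; have [] := CF h j Fh.
Qed.

Lemma edge_closedC F C : edge_closed a b F C -> edge_closed a b F (~` C).
Proof. by move=> CF h j Fh; have [p q] := CF h j Fh; split=> n ?; apply: n; auto. Qed.

Lemma edge_class_sym F g h : edge_class F g h -> edge_class F h g.
Proof.
move=> gh C CF Ch; apply: contrapT => nCg.
exact: (gh (~` C) (edge_closedC CF) nCg).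
Qed.

Lemma edge_class_trans F g h k :
  edge_class F g h -> edge_class F h k -> edge_class F g k.
Proof. by move=> gh hk C CF Cg; apply: hk => //; exact: gh. Qed.

Lemma edge_class_shift F g h k : edge_class F (g * h)%g (g * k)%g <->
  edge_class (fun j g' => F j (g * g')%g) h k.
Proof.
split=> H C CF Ch.
  have := H (fun g' => C (g^-1 * g')%g); rewrite /= !mulKg; apply=> // g' j Fg'.
  have := CF (g^-1 * g')%g j; rewrite mulVKg !mulgA; exact.
apply: (H (fun g' => C (g * g')%g)) => // g' j /CF.
by rewrite !mulgA.
Qed.

(** A sum over a set of indices is the sum of its parts in the classes of an
    equivalence relation. *)
Lemma sum_classes_eq0 (I : eqType) (r : I -> I -> Prop) (t : I -> bool) (Q : seq I) :
  (forall i, r i i) -> (forall i j, r i j -> r j i) ->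
  (forall i j k, r i j -> r j k -> r i k) ->
  (forall i, i \in Q -> \sum_(j <- Q | `[< r i j >]) t j = 0) -> \sum_(j <- Q) t j = 0.
Proof.
move=> rr rs rt; have [k] := ubnP (size Q); elim: k Q => // k IH [|i Q] sQ H.
  by rewrite big_nil.
rewrite (bigID (fun j => `[< r i j >])) /= H ?mem_head// add0r -big_filter; apply: IH.
  rewrite /=; case: asboolP => [_|/(_ (rr i))//] /=.
  by rewrite size_filter; apply: (@leq_ltn_trans (size Q)); [exact: count_size|exact: sQ].
move=> i'; rewrite mem_filter => /andP[_ i'Q]; rewrite big_filter_cond /=.
have [ii'|ii'] := pselect (r i i').
  rewrite big_pred0// => j; apply/negP => /andP[/asboolP nij /asboolP i'j].
  by apply: nij; exact: rt i'j.
rewrite -[RHS](H i' i'Q); apply: eq_bigl => j.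
have [i'j|n'] := pselect (r i' j); last by rewrite (asboolF n') andbF.
rewrite (asboolT i'j) andbT; apply/negP => /asboolP ij; apply: ii'.
by apply: rt ij _; exact: rs.
Qed.

(** The odd total degree is the sum of the degrees of the classes that occur in [Q]. *)
Lemma good_config_class Q F : good_config a b Q F ->
  exists2 q, q \in Q & config_degree a Q F (edge_class F (q.1 * a q.2)%g) = 1.
Proof.
move=> [F1 _]; apply: contrapT => nF; suff : config_degree a Q F setT = 0 by rewrite F1.
pose t (q : G * 'I_m) : bool := 1 *~ F q.2 q.1.
have -> : config_degree a Q F setT = \sum_(q <- Q) t q.
  by apply: eq_bigr => q _; case: asboolP => // /(_ I).
apply: (sum_classes_eq0 (r := fun q q' : G * 'I_m =>
    edge_class F (q.1 * a q.2)%g (q'.1 * a q'.2)%g)).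
- by move=> i; exact: edge_class_refl.
- by move=> i j; exact: edge_class_sym.
- by move=> i j k; exact: edge_class_trans.
move=> q qQ; apply/negbTE/negP => qt; apply: nF; exists q => //.
by rewrite /config_degree -big_mkcond; exact: qt.
Qed.

End Classes.

Section OrbitConfigurations.
Context {R : realType} {G : groupType} (alpha : standard_space R G).
Hypothesis countG : countable [set: G].

Local Notation X := (ss_space alpha).
Local Notation act := (ss_act alpha).

Context {m : nat}.
Variables (a b : 'I_m -> G) (f : 'I_m -> X -> int).
Hypothesis f_measurable : forall j B, measurable (f j @^-1` B).

Definition orbit_config (x : X) (j : 'I_m) (g : G) : int := f j (act g^-1%g x).

Local Notation F := orbit_config.

Lemma orbit_config_act x g :
  F (act g^-1%g x) = fun j h => F x j (g * h)%g.
Proof.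
by apply/funext => j; apply/funext => h; rewrite /orbit_config -actMx -invgM.
Qed.

Definition orbit_class x : set G := edge_class a b (F x) 1%g.

Local Notation cl := orbit_class.

Lemma orbit_class_act x h : cl (act h^-1%g x) = fun g => edge_class a b (F x) h (h * g)%g.
Proof.
apply/funext => g; apply/propext; rewrite /orbit_class orbit_config_act.
by rewrite -{2}[h]mulg1; exact: iff_sym (edge_class_shift _ _ _ _ _ _).
Qed.

Lemma orbit_class_in x g : cl x g -> forall h, cl (act g^-1%g x) h <-> cl x (g * h)%g.
Proof.
move=> xg h; rewrite orbit_class_act; split; first exact: edge_class_trans.
by move=> xh; apply: edge_class_trans xh; exact: edge_class_sym.
Qed.

(** One more step along an edge, in either direction. The impredicative [edge_class] hides
    measurability; iterating this operation exhibits the class as a countable union of measurable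
    conditions. *)
Definition class_step (B : G -> set X) (h : G) : set X :=
  B h `|` \bigcup_j ((B (h * (b j)^-1 * a j)%g `&`
      [set x | F x j (h * (b j)^-1)%g != 0]) `|`
    (B (h * (a j)^-1 * b j)%g `&` [set x | F x j (h * (a j)^-1)%g != 0])).

Definition class_start (h : G) : set X := if h == 1%g then setT else set0.

Lemma config_measurable j g (B : set int) : measurable [set x | B (F x j g)].
Proof. exact: (act_measurable _ (f_measurable j B)). Qed.

Lemma class_iter_measurable k h : measurable (iter k class_step class_start h).
Proof.
elim: k h => [|k IH] h /=; first by rewrite /class_start; case: ifP.
apply: measurableU => //; apply: countable_bigcupT_measurable => [|j].
  exact: countableP.
apply: measurableU; apply: measurableI => //.
  exact: (config_measurable j _ (fun z => z != 0)).
exact: (config_measurable j _ (fun z => z != 0)).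
Qed.

Lemma orbit_classE x h : cl x h <-> exists k, iter k class_step class_start h x.
Proof.
split=> [|[k]]; last first.
  elim: k h => [|k IH] h /=.
    by rewrite /class_start; case: eqP => // -> _; exact: edge_class_refl.
  case=> [/IH //|[j _ [|] [/IH xh /eqP Fh]]].
    by have := (@edge_class_closed _ _ a b (F x) 1%g _ _ Fh).1 xh; rewrite mulgVK.
  by have := (@edge_class_closed _ _ a b (F x) 1%g _ _ Fh).2 xh; rewrite mulgVK.
move=> /(_ (fun h => exists k, iter k class_step class_start h x)).
apply=> [g j /eqP Fg|]; last by exists 0; rewrite /= /class_start eqxx.
split=> -[k xk]; exists k.+1; right; exists j => //; [left|right].
  by rewrite /= mulgK.
by rewrite /= mulgK.
Qed.

Lemma orbit_class_measurable h : measurable [set x | cl x h].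
Proof.
rewrite (_ : [set _ | _] = \bigcup_k iter k class_step class_start h).
  by apply: bigcup_measurable => k _; exact: class_iter_measurable.
by apply/seteqP; split=> x /=; rewrite orbit_classE => -[k]; exists k.
Qed.

Variable Q : seq (G * 'I_m).

Definition orbit_degree x : bool := config_degree a Q (F x) (cl x).

(** Translation invariance turns the parity of the class of [h], seen from [x], into the parity of
    the class of the identity, seen from another point of the orbit. Parity thus becomes a function
    on the space. *)
Lemma orbit_degree_class x h : good_config a b Q (F x) ->
  config_degree a Q (F x) (edge_class a b (F x) h) = orbit_degree (act h^-1%g x).
Proof.
move=> [_ /(_ (edge_class a b (F x) h) h^-1%g)] <-; last exact: edge_class_closed.
by rewrite invgK /orbit_degree orbit_config_act orbit_class_act.
Qed.

Lemma orbit_degree_measurable : measurable [set x | orbit_degree x].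
Proof.
rewrite /orbit_degree /config_degree; elim: Q => [|q Q' IH].
  by rewrite (_ : [set _ | _] = set0)//; apply/seteqP; split=> x; rewrite //= big_nil.
pose t x := if `[< cl x (q.1 * a q.2)%g >] then (1 : bool) *~ F x q.2 q.1 else 0.
have mt : measurable [set x | t x].
  rewrite (_ : [set _ | _] = [set x | cl x (q.1 * a q.2)%g] `&`
    [set x | (1 : bool) *~ F x q.2 q.1]).
    apply: measurableI; first exact: orbit_class_measurable.
    exact: (config_measurable q.2 q.1 (fun z => (1 : bool) *~ z)).
  by apply/seteqP; split=> x /=; rewrite /t; case: asboolP => // ? [].
pose s x := \sum_(q <- Q') (if `[< cl x (q.1 * a q.2)%g >] then (1 : bool) *~ F x q.2 q.1 else 0).
rewrite (_ : [set _ | _] = ([set x | t x] `\` [set x | s x]) `|`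
    ([set x | s x] `\` [set x | t x])).
  by apply: measurableU; exact: measurableD.
apply/seteqP; split=> x /=; rewrite big_cons -/(s x) -/(t x).
  by case: (t x) (s x) => -[] //; [left|right].
by case: (t x) (s x) => -[] // [] [].
Qed.

End OrbitConfigurations.

(** * The cost of the action *)

Section CostOfActions.
Context {R : realType} {G : groupType} (alpha : standard_space R G).
Hypothesis countG : countable [set: G].

Local Notation X := (ss_space alpha).
Local Notation mu := (ss_mu alpha).
Local Notation act := (ss_act alpha).

Lemma first_visit (P : nat -> set X) k i x : (i < k)%N -> P i x ->
  exists i' : 'I_k, seqDU P i' x.
Proof.
move=> ik Px; have : (\big[setU/set0]_(i < k) seqDU P i) x.
  by rewrite -bigsetU_seqDU -bigcup_mkord; exists i.
by rewrite -bigcup_mkord => -[i' /= i'k Px']; exists (Ordinal i'k).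
Qed.

Lemma seqDU_measurable (P : nat -> set X) i : (forall i, measurable (P i)) ->
  measurable (seqDU P i).
Proof. by move=> mP; apply: measurableD => //; apply: bigsetU_measurable. Qed.

Lemma sum_seqDU_le1 k (P : nat -> set X) : (forall i, measurable (P i)) ->
  (\sum_(i < k) mu (seqDU P i) <= 1)%E.
Proof.
move=> mP; apply: le_trans (sum_seqDU_le k mP) _; apply: probability_le1.
exact: bigcup_measurable.
Qed.

(** Markers for nonempty sets shrink to a transversal [T]; moving every point to [T] by the first
    suitable group element uses disjoint domains. *)
Lemma finite_group_action_cost : finite_set [set: G] -> (action_cost alpha <= 1)%E.
Proof.
move=> /finite_seqP[s sG].
have sP g : g \in s by have : [set: G] g by []; rewrite sG.
have [B [B0 mB BS Bbig BT]] := @markers _ _ alpha (fun=> setT)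
  (fun _ _ _ _ => iff_refl _) (fun=> measurableT) _ _ (nonempty_largeness alpha countG)
  (@measurableT _ X).
have BD n k : B (n + k)%N `<=` B n.
  elim: k => [|k IH]; first by rewrite addn0.
  by rewrite addnS; apply: subset_trans (BS _) IH.
pose T := \bigcap_n B n.
have Tx x : exists g, T (act g^-1%g x).
  apply: contrapT => nT.
  (* Were the orbit to miss [T], finiteness of the group would give a common stage at which the
     orbit has already left the decreasing markers. *)
  have /choice[N NP] g : exists n, ~ B n (act g^-1%g x).
    apply: contrapT => nB; apply: nT; exists g => n _.
    by apply: contrapT => nBn; apply: nB; exists n.
  have [|g [_ Bg]] := Bbig x (\max_(g <- s) N g); first by exists 1%g.
  apply: (NP g); apply: (BD _ (\max_(g <- s) N g - N g)%N).
  by rewrite subnKC//; exact: (leq_bigmax_seq g (sP g)).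
have mT : measurable T by exact: bigcapT_measurable.
pose P i := act (nth 1%g s i)^-1%g @^-1` T.
have mP i : measurable (P i) by exact: act_measurable.
apply: le_trans (sum_seqDU_le1 (size s) mP).
apply: (@action_cost_le _ _ alpha countG 'I_(size s) (fun i => seqDU P i)
  (fun i => (nth 1 s i)^-1)%g set0) => //.
  by move=> i; exact: seqDU_measurable.
move=> E [Er Es Et] EP _ x g.
have toT y : exists2 h, T (act h y) & E (y, act h y).
  have [h Th] := Tx y; have : (index h s < size s)%N by rewrite index_mem.
  have : P (index h s) y by rewrite /P nth_index.
  move=> Py /first_visit -/(_ P y Py)[i Pi]; exists (nth 1%g s i)^-1%g; last exact: EP.
  by have [] := Pi.
have [h Th xh] := toT x; have [h' Th' gh'] := toT (act g x).
have e : act (h * g^-1 * h'^-1)^-1%g (act h x) = act h' (act g x).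
  by rewrite -!actMx !invgM !invgK !mulgA mulgVK.
apply: Et xh _; apply: Es; rewrite -(_ : act h' (act g x) = act h x) //.
by rewrite -e; apply: (BT _ _ I) => n; [exact: Th|rewrite e; exact: Th'].
Qed.

Context {m : nat}.
Variables (a b : 'I_m -> G) (Q : seq (G * 'I_m)) (f : 'I_m -> X -> int).
Hypothesis f_measurable : forall j B, measurable (f j @^-1` B).
Hypothesis free : essentially_free alpha.
Hypothesis good : {ae mu, forall x, good_config a b Q (orbit_config f x)}.

Local Notation F := (orbit_config f).
Local Notation cl := (orbit_class a b f).

(** An invariant conull set on which freeness and the good configurations hold everywhere. *)
Definition regular_points (Y : set X) := [/\ measurable Y, mu (~` Y) = 0%E,
  forall x g, Y x -> Y (act g x),
  forall x, Y x -> good_config a b Q (F x) &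
  forall x g, Y x -> act g x = x -> g = 1%g].

Lemma regular_points_ex : exists Y, regular_points Y.
Proof.
have H : {ae mu, forall x, good_config a b Q (F x) /\ forall g, act g x = x -> g = 1%g}.
  by apply: filterS2 good free => x; split.
have [N0 [mN0 N00 N0P]] := H.
have [N1 [mN1 N10 N1P]] : {ae mu, forall x, forall g, ~ N0 (act g x)}.
  apply: ae_forall_group => // g.
  apply: (@ae_act _ _ alpha g (fun x => ~ N0 x)).
  by exists N0; split=> // x /contrapT.
have mU : measurable (\bigcup_g act g @^-1` N0).
  by apply: countable_bigcupT_measurable => // g; exact: act_measurable.
have NP x : ~ (\bigcup_g act g @^-1` N0) x ->
    good_config a b Q (F x) /\ forall g, act g x = x -> g = 1%g.
  move=> nx; apply: contrapT => /N0P xN0; apply: nx.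
  by exists 1%g => //; rewrite /= act1x.
exists (~` \bigcup_g act g @^-1` N0); split.
- exact: measurableC.
- rewrite setCK; apply: (@subset_measure0 _ _ _ mu _ N1) => // x [g _ gx].
  by apply: N1P => /(_ g).
- by move=> x g nx [g' _ gx]; apply: nx; exists (g' * g)%g; rewrite //= actMx.
- by move=> x /NP[].
- by move=> x g /NP[_]; apply.
Qed.

Variable Y : set X.
Hypothesis regY : regular_points Y.

Let h (i : nat) : G := nth 1%g [seq q.1 * a q.2 | q <- Q]%g i.
Let k := size Q.

Let A : set X := [set x | orbit_degree a b f Q x] `&` Y.

Let A_measurable : measurable A.
Proof.
by have [mY _ _ _ _] := regY; apply: measurableI => //; exact: orbit_degree_measurable.
Qed.

Let visit_A x : Y x -> exists2 i, (i < k)%N & A (act (h i)^-1%g x).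
Proof.
have [_ _ YG Yg _] := regY => Yx; have [q qQ qx] := good_config_class (Yg _ Yx).
exists (index q Q); first by rewrite index_mem.
split; last exact: YG.
by rewrite /= -orbit_degree_class ?qx//; [rewrite /h (nth_map q) ?index_mem ?nth_index// qx|exact: Yg].
Qed.

(** A class without any of the finitely many labels [h i] would have degree an empty sum, hence
    would not be odd. *)
Let class_meets x g : Y x -> A (act g^-1%g x) ->
  exists2 i, (i < k)%N & cl (act g^-1%g x) (g^-1 * h i)%g.
Proof.
have [_ _ YG Yg _] := regY => Yx [/= dg _]; apply: contrapT => nQ.
move: dg; rewrite -orbit_degree_class; last exact: Yg.
rewrite /config_degree big_seq big1// => q qQ; case: asboolP => // xq.
exfalso; apply: nQ; exists (index q Q); first by rewrite index_mem.
by rewrite orbit_class_act mulVKg /h (nth_map q) ?index_mem ?nth_index.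
Qed.

Let visits_A x : A x -> visits cl x A = cl x.
Proof.
have [_ _ YG Yg _] := regY => -[/= dx Yx]; apply/seteqP; split=> g; first by case.
move=> xg; split=> //; split; last exact: YG.
rewrite /= -orbit_degree_class; last exact: Yg.
rewrite (_ : edge_class _ _ _ _ = cl x)//; apply/seteqP; split=> g'.
  exact: edge_class_trans.
by apply: edge_class_trans; exact: edge_class_sym.
Qed.

(** Every translate of an odd class is odd for the translated configuration, so it contains a label
    from [Q]. Each [g] is therefore determined by an element of the class and an entry of [Q]. *)
Let class_infinite x : infinite_set [set: G] -> A x -> infinite_set (cl x).
Proof.
have [_ _ YG Yg _] := regY => iG -[/= dx Yx] fC; apply: iG.
have [s sC] := (finite_seqP _).1 fC.
apply: (@sub_finite_set _ _ [set` [seq (c * (q.1 * a q.2)^-1)^-1 | c <- s, q <- Q]%g]); last exact: finite_seq.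
move=> g _ /=; have [_ /(_ (cl x) g)] := Yg _ Yx; rewrite -/(orbit_degree _ _ _ _ _) dx.
move=> /(_ (@edge_class_closed _ _ _ _ _ _)) dg.
apply: contrapT => ns; move: dg; rewrite /config_degree big_seq big1// => q qQ.
case: asboolP => // xq; exfalso; apply: ns; apply/allpairsP.
exists (g^-1 * (q.1 * a q.2), q)%g; split => //=; last by rewrite mulgK invgK.
by move: xq; rewrite sC.
Qed.

(** The intersection [T] of the markers is removed from each of them. By freeness [T] occupies at
    most one element of a class, whereas each marker visits an odd class infinitely often. *)
Let marker_sequence : infinite_set [set: G] -> exists B : nat -> set X,
  [/\ forall n, measurable (B n), forall n, B n.+1 `<=` B n, \bigcap_n B n = set0 &
    forall x n, A x -> exists2 g, cl x g & B n (act g^-1%g x)].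
Proof.
have [_ _ YG _ Yfree] := regY => iG.
have [B [_ mB BS Bbig BT]] := markers (@orbit_class_in _ _ alpha _ a b f)
  (@orbit_class_measurable _ _ alpha _ a b f f_measurable) (infinite_largeness alpha countG) A_measurable.
pose T := \bigcap_n B n.
have mT : measurable T by exact: bigcapT_measurable.
exists (fun n => B n `\` T); split.
- by move=> n; exact: measurableD.
- by move=> n; exact: setSD.
- apply/seteqP; split=> // x xB; have [_] := xB 0 I; apply=> n _.
  by have [] := xB n I.
move=> x n Ax; apply: contrapT => nB.
have iC : infinite_set (visits cl x A) by rewrite visits_A//; exact: class_infinite.
have BT' g : visits cl x (B n) g -> T (act g^-1%g x).
  by move=> [xg Bg]; apply: contrapT => nT; apply: nB; exists g.
apply: (Bbig x n iC).
have [->|/set0P[g Bg]] := eqVneq (visits cl x (B n)) set0; first exact: finite_set0.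
apply: (sub_finite_set (B := [set g])) (finite_set1 g) => g' Bg' /=.
have e : act (g^-1 * g')^-1%g (act g^-1%g x) = act g'^-1%g x.
  by rewrite -actMx invgM invgK mulgK.
have xg : cl x g := Bg.1.
have : act (g^-1 * g')^-1%g (act g^-1%g x) = act g^-1%g x.
  apply: BT; first by apply/(orbit_class_in xg); rewrite mulVKg; exact: Bg'.1.
    by move=> n'; exact: (BT' _ Bg).
  by move=> n'; rewrite e; exact: (BT' _ Bg').
move=> /Yfree -/(_ (YG _ _ Ax.2)) /(congr1 (fun z => g * z^-1)%g).
by rewrite /= invgK mulVKg invg1 mulg1.
Qed.

(** Edges connect points within classes, disjointified moves lead every regular point into an odd
    class, and jumps from a marker set [B n] link the odd classes of an orbit; the cost of the jumps
    tends to zero with [n]. *)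
Lemma infinite_group_action_cost : infinite_set [set: G] ->
  (action_cost alpha <= \sum_j mu [set x | f j x != 0%R] + 1)%E.
Proof.
move=> iG; have [mY muY YG _ _] := regY; have [B [mB BS B0 Bx]] := marker_sequence iG.
pose P i := act (h i)^-1%g @^-1` A.
have mP i : measurable (P i) by exact: act_measurable.
(* In order: edges, moves into [A] with disjoint domains, and [k] jumps defined on the marker
   set. *)
pose D (j : 'I_m + ('I_k + 'I_k)) n := match j with
  | inl j => act (a j) @^-1` [set x | f j x != 0] | inr (inl i) => seqDU P i
  | inr (inr i) => B n end.
pose t (j : 'I_m + ('I_k + 'I_k)) := match j with
  | inl j => (b j)^-1 * a j | inr (inl i) => (h i)^-1
  | inr (inr i) => (h i)^-1 end%g.
have mD j n : measurable (D j n).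
  have ms i : measurable [set x | f i x != 0] by exact: (f_measurable i (fun z => z != 0)).
  case: j => [j|[i|i]] //=; first exact: act_measurable.
  exact: seqDU_measurable.
have cost_n n : (action_cost alpha <= \sum_j mu [set x | f j x != 0%R] + 1 + \sum_(i < k) mu (B n))%E.
  have : (action_cost alpha <= \sum_j mu (D j n))%E.
    apply: (@action_cost_le _ _ alpha countG _ (fun j => D j n) t (~` Y)) => //.
      exact: measurableC.
    move=> E [Er Es Et] ED EY.
    (* The elements along which [E] holds form an edge-closed set, so they contain the class of the
       identity. *)
    have Ecl x g : cl x g -> E (x, act g^-1%g x).
      move=> /(_ [set g | E (x, act g^-1%g x)]); apply=> /= [g' j Fg|]; last first.
        by rewrite invg1 act1x.
      have e : E (act (g' * a j)^-1%g x, act (g' * b j)^-1%g x).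
        have ea : act (a j) (act (g' * a j)^-1%g x) = act g'^-1%g x.
          by rewrite -actMx invgM mulVKg.
        have := ED (inl j) (act (g' * a j)^-1%g x).
        by rewrite /= actMx ea -actMx -invgM; apply; exact/eqP.
      by split=> xg'; apply: (Et _ _ _ xg') => //; exact: (Es _ _).
    have toA x : Y x -> exists2 g, A (act g x) & E (x, act g x).
      move=> Yx; have [i ik Ax] := visit_A Yx.
      have [i' Px] := first_visit (P := P) ik Ax.
      exists (h i')^-1%g; first by have [] := Px.
      exact: (ED (inr (inl i'))).
    (* Walk within the class of [x] to a marker point [y]. The odd class of the target contains some
       point [act (h i)^-1 y], so one jump from [y] followed by a walk in that class arrives at the
       target. *)
    have EA x g : A x -> A (act g x) -> E (x, act g x).
      move=> Ax Agx; have [d xd Bd] := Bx x n Ax; set y := act d^-1%g x in Bd.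
      have xy : E (x, y) by exact: Ecl.
      have Yy : Y y by apply: YG; exact: Ax.2.
      pose u := (g * d)^-1%g.
      have gy : act u^-1%g y = act g x.
        by rewrite invgK actMx /y -[act d _]actMx mulgV act1x.
      have [|i ik gi] := @class_meets y u Yy; first by rewrite gy.
      have := Ecl _ _ gi; rewrite gy => gxi; apply: (Et _ _ _ xy); apply: (Es _ _).
      apply: (Et _ _ _ gxi); apply: (Es _ _).
      have -> : act (u^-1 * h i)^-1%g (act g x) = act (h i)^-1%g y.
        by rewrite -gy -actMx invgM mulgVK.
      exact: (ED (inr (inr (Ordinal ik)))).
    move=> x g; have [Yx|nYx] := pselect (Y x); last exact: EY.
    have [d Ad xd] := toA x Yx; have [d' Ad' gxd'] := toA (act g x) (YG _ _ Yx).
    apply: (Et _ _ _ xd); apply: (Es _ _); apply: (Et _ _ _ gxd'); apply: (Es _ _).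
    have -> : act d' (act g x) = act (d' * g * d^-1)%g (act d x).
      by rewrite -!actMx mulgVK.
    by apply: EA => //; rewrite -!actMx mulgVK actMx.
  move/le_trans; apply; rewrite big_sumType /= big_sumType /= addeA; apply: leeD.
    apply: leeD; last exact: sum_seqDU_le1.
    apply: lee_sum => j _; rewrite ss_preserving//.
    exact: (f_measurable j (fun z => z != 0)).
  exact: lexx.
have cB : (mu (B n) @[n --> \oo] --> 0)%E.
  rewrite -(measure0 mu) -B0; apply: nonincreasing_cvg_mu => //.
  - by rewrite -ge0_fin_numE//; exact: fin_num_measure.
  - exact: bigcap_measurable.
  - by apply/nonincreasing_seqP => n; apply/subsetPset; exact: BS.
apply/lee_addgt0Pr => e e0.
(* Dividing by [k.+1] rather than [k] also covers an empty list of jumps. *)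
pose d := e / k.+1%:R.
have [n nd] : exists n, (mu (B n) <= d%:E)%E.
  apply: contrapT => nd; have : (d%:E <= lim (mu (B n) @[n --> \oo]))%E.
    apply: lime_ge; first by apply/cvg_ex; exists 0%E.
    by apply: nearW => n; apply/ltW; rewrite ltNge; apply/negP => dn; apply: nd; exists n.
  by rewrite (cvg_lim _ cB)// lee_fin leNgt divr_gt0.
apply: le_trans (cost_n n) _; apply: leeD => //.
have -> : e = d *+ k.+1 by rewrite -mulr_natr divfK// pnatr_eq0.
apply: (@le_trans _ _ ((d *+ k)%:E)).
  apply: (@le_trans _ _ (\sum_(i < k) d%:E)%E); first exact: lee_sum.
  by rewrite sumEFin sumr_const card_ord.
by rewrite lee_fin ler_pMn2l ?divr_gt0.
Qed.

End CostOfActions.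

Lemma action_cost_config (R : realType) (G : groupType) (alpha : standard_space R G)
    (m : nat) (a b : 'I_m -> G) (Q : seq (G * 'I_m)) (f : 'I_m -> ss_space alpha -> int) :
  countable [set: G] -> (forall j B, measurable (f j @^-1` B)) ->
  essentially_free alpha ->
  {ae ss_mu alpha, forall x, good_config a b Q (orbit_config f x)} ->
  (action_cost alpha <= \sum_j ss_mu alpha [set x | (f j x != 0)%R] + 1)%E.
Proof.
move=> countG mf free good; have [fG|iG] := pselect (finite_set [set: G]).
  apply: le_trans (finite_group_action_cost alpha countG fG) _.
  by rewrite -[leLHS]add0e leeD// sume_ge0.
have [Y regY] := regular_points_ex countG free good.
exact: (infinite_group_action_cost countG mf regY iG).
Qed.

(** * The fair coin measure on bit sequences *)

Definition bit_sets : set (set (nat -> bool)) :=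
  [set A | exists n, A = [set w : nat -> bool | w n]].

Definition bits := g_sigma_algebraType bit_sets.

Definition cylinder (s : seq nat) (v : nat -> bool) : set bits :=
  [set w : bits | forall i, i \in s -> w i = v i].

Lemma bit_measurable n : measurable [set w : bits | w n].
Proof. by apply: sub_sigma_algebra; exists n. Qed.

Lemma bit_eq_measurable n c : measurable [set w : bits | w n = c].
Proof.
case: c; first exact: (bit_measurable n).
rewrite (_ : [set _ | _] = ~` [set w : bits | w n]).
  by apply: measurableC; exact: bit_measurable.
by apply/seteqP; split=> w /=; [move=> ->|move/negP/negbTE].
Qed.

Lemma cylinder_measurable s v : measurable (cylinder s v).
Proof.
elim: s => [|i s IH]; first by rewrite (_ : cylinder _ _ = setT)//; apply/seteqP; split.
rewrite (_ : cylinder _ _ = [set w : bits | w i = v i] `&` cylinder s v).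
  by apply: measurableI => //; exact: bit_eq_measurable.
apply/seteqP; split=> w /= => [H|[wi ws] j].
  by split=> [|j js]; apply: H; rewrite inE ?eqxx// js orbT.
by rewrite inE => /orP[/eqP ->//|]; exact: ws.
Qed.

Lemma bits_measurable_fun d (T : measurableType d) (f : T -> bits) :
  (forall n, measurable [set x | f x n]) -> measurable_fun setT f.
Proof.
move=> mf; apply: (@measurability _ _ T bits setT f bit_sets) => // _ [_ [n ->] <-].
by rewrite setTI; exact: mf.
Qed.

Section CoinMeasure.
Variable R : realType.

(** The fair coin measure is realised as the joint law of the binary digits of a uniformly
    distributed point of the unit interval. *)
Definition binary_digits (x : R) : bits := fun n => odd (Num.truncn (2 ^+ n.+1 * x)).

Lemma binary_digits_measurable : measurable_fun setT (binary_digits : measurableTypeR R -> bits).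
Proof.
apply: bits_measurable_fun => n; rewrite /binary_digits.
rewrite (_ : [set _ | _] = \bigcup_j (if odd j then
    `[j%:R / 2 ^+ n.+1, j.+1%:R / 2 ^+ n.+1[%classic else set0)).
  by apply: bigcup_measurable => j _; case: ifP.
have p0 : (0 : R) < 2 ^+ n.+1 by rewrite exprn_gt0.
apply/seteqP; split=> x /= => [ox|[j _]].
  exists (Num.truncn (2 ^+ n.+1 * x)); rewrite //= ox /= in_itv/=.
  rewrite ler_pdivrMr// ltr_pdivlMr// mulrC truncn_itv//.
  rewrite leNgt; apply/negP => x0.
  have /Num.Theory.trunc0Pn e : ~~ (1 <= 2 ^+ n.+1 * x).
    by rewrite -ltNge mulrC; exact: lt_trans x0 ltr01.
  by move: ox; rewrite e.
case: ifP => //= oj; rewrite in_itv/= ler_pdivrMr// ltr_pdivlMr// mulrC.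
by move=> /truncn_def ->.
Qed.

Fixpoint dyadic N (v : nat -> bool) : nat :=
  if N is N'.+1 then (dyadic N' v).*2 + v N' else 0.

Lemma dyadic_lt N v : (dyadic N v < 2 ^ N)%N.
Proof. by elim: N => //= N IH; rewrite expnS; case: (v N); lia. Qed.

Lemma truncn_double (y : R) : 0 <= y ->
  Num.truncn (2 * y) = ((Num.truncn y).*2 + odd (Num.truncn (2 * y)))%N.
Proof.
move=> y0; have /andP[l1 u1] := truncn_itv y0.
have y20 : 0 <= 2 * y by rewrite mulr_ge0.
have /andP[l2 u2] := truncn_itv y20.
set a := Num.truncn y in l1 u1 *; set c := Num.truncn (2 * y) in l2 u2 *.
have : (a.*2 < c.+1)%N.
  by rewrite -(ltr_nat R); apply: le_lt_trans u2; rewrite -mul2n natrM ler_pM2l.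
have : (c < a.+1.*2)%N.
  by rewrite -(ltr_nat R); apply: le_lt_trans l2 _; rewrite -mul2n natrM ltr_pM2l.
by rewrite -(odd_double_half c); case: (odd c); lia.
Qed.

Lemma binary_digits_prefix N v (x : R) : 0 <= x < 1 ->
  (forall i, (i < N)%N -> binary_digits x i = v i) <->
  (Num.truncn (2 ^+ N * x) = dyadic N v).
Proof.
move=> /andP[x0 x1]; elim: N => [|N IH].
  split=> // _; rewrite expr0 mul1r; apply: truncn_def; rewrite x0//=.
have y0 : 0 <= 2 ^+ N * x by rewrite mulr_ge0// exprn_ge0.
have td := truncn_double y0; rewrite mulrA -exprS in td.
split=> [H|/=].
  rewrite td (proj1 IH) /=; first by congr (_ + _)%N; rewrite -(H N).
  by move=> i iN; apply: H; exact: ltnW.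
move=> e; have ov : odd (Num.truncn (2 ^+ N.+1 * x)) = v N.
  by rewrite e oddD odd_double /= oddb.
move=> i; rewrite ltnS leq_eqVlt => /orP[/eqP -> //|]; apply: (proj2 IH).
by move: td; rewrite ov e => /addIn; lia.
Qed.

Lemma unit_itv_measurable : measurable (`[0, 1[%classic : set (measurableTypeR R)).
Proof. by []. Qed.

Definition unit_lebesgue : set (measurableTypeR R) -> \bar R :=
  mrestr (@lebesgue_measure R) unit_itv_measurable.

HB.instance Definition _ := Measure.on unit_lebesgue.

Lemma unit_lebesgueT : unit_lebesgue setT = 1%E.
Proof.
by rewrite /unit_lebesgue /mrestr setTI lebesgue_measure_itv /= lte01 sube0.
Qed.

HB.instance Definition _ := Measure_isProbability.Build _ _ _ unit_lebesgue unit_lebesgueT.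

HB.instance Definition _ := isMeasurableFun.Build _ _ _ _
  (binary_digits : measurableTypeR R -> bits) binary_digits_measurable.

Definition coin_measure : probability bits R :=
  distribution unit_lebesgue (binary_digits : measurableTypeR R -> bits).

(** Prescribing the first [N] digits cuts out one half-open dyadic interval. *)
Lemma coin_measure_prefix N v : coin_measure (cylinder (iota 0 N) v) = (2^-1 ^+ N)%:E.
Proof.
have p0 : (0 : R) < 2 ^+ N by rewrite exprn_gt0.
have -> : coin_measure (cylinder (iota 0 N) v) = lebesgue_measure
    (`[(dyadic N v)%:R / 2 ^+ N, (dyadic N v).+1%:R / 2 ^+ N[%classic : set R).
  rewrite /coin_measure /= /distribution /pushforward /unit_lebesgue /mrestr.
  congr (lebesgue_measure _); apply/seteqP; split=> x /=.
    move=> [xv]; rewrite in_itv/= => x01; have /andP[x0 x1] := x01.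
    have : forall i, (i < N)%N -> binary_digits x i = v i.
      by move=> i iN; apply: xv; rewrite mem_iota.
    move=> /binary_digits_prefix -/(_ x01) <-; rewrite in_itv/=.
    by rewrite ler_pdivrMr// ltr_pdivlMr// mulrC truncn_itv// mulr_ge0// ltW.
  rewrite in_itv/= => xd; have x01 : 0 <= x < 1.
    move: xd => /andP[xd dx]; apply/andP; split.
      by apply: le_trans xd; rewrite divr_ge0// ltW.
    apply: lt_le_trans dx _; rewrite ler_pdivrMr// mul1r -natrX ler_nat.
    exact: dyadic_lt.
  split; last by rewrite in_itv.
  move: xd; rewrite ler_pdivrMr// ltr_pdivlMr// mulrC => /truncn_def /binary_digits_prefix xv i.
  by rewrite mem_iota => /andP[_ iN]; apply: xv.
rewrite lebesgue_measure_itv /= lte_fin ltr_pM2r ?invr_gt0// ltr_nat ltnSn.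
by rewrite -EFinD -mulrBl -natrB// subSnn mul1r exprVn.
Qed.

End CoinMeasure.

Definition update (v : nat -> bool) i c : nat -> bool := fun j => if j == i then c else v j.

Lemma cylinder_cons i s v c : i \notin s ->
  cylinder (i :: s) (update v i c) = cylinder s v `&` [set w : bits | w i = c].
Proof.
move=> si; apply/seteqP; split=> w /= => [H|[ws wi] j].
  split; last by have := H i (mem_head _ _); rewrite /update eqxx.
  move=> j js; have := H j; rewrite inE js orbT /update => ->//.
  by case: eqP js => // ->; rewrite (negbTE si).
rewrite /update inE; case: eqP => [-> //|_ /=]; exact: ws.
Qed.

Lemma cylinder_eq s s' v : s =i s' -> cylinder s v = cylinder s' v.
Proof. by move=> ss; apply/seteqP; split=> w H i si; apply: H; rewrite ?ss// -ss. Qed.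

Lemma bit_split (R : realType) (P : probability bits R) i (A : set bits) : measurable A ->
  P A = (P (A `&` [set w : bits | w i = true]) + P (A `&` [set w : bits | w i = false]))%E.
Proof.
move=> mA; have mb c := bit_eq_measurable i c.
rewrite -measureU//.
- congr (P _); apply/seteqP; split=> w /= => [Aw|[[]|[]]//].
  by case: (w i) (erefl (w i)) => e; [left|right].
- exact: measurableI.
- exact: measurableI.
- by apply/seteqP; split=> w // -[[_ /= ->] [_]].
Qed.

Section Cylinders.
Variable R : realType.
Variable nu : probability bits R.
Hypothesis nu_prefix : forall N v, nu (cylinder (iota 0 N) v) = ((2^-1 : R) ^+ N)%:E.

Lemma half_double k : ((2^-1 : R) ^+ k.+1)%:E + ((2^-1 : R) ^+ k.+1)%:E = ((2^-1 : R) ^+ k)%:E :> \bar R.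
Proof. by rewrite -EFinD exprS; congr (_%:E); lra. Qed.

(** Induction on the number of indices below a bound [N] that are missing from [s]: splitting along
    a missing index halves the measure, and with nothing missing the cylinder is a prefix. *)
Lemma coin_cylinder s v : uniq s -> nu (cylinder s v) = ((2^-1 : R) ^+ size s)%:E.
Proof.
move=> us; pose N := (\max_(i <- s) i).+1.
have sN : {subset s <= iota 0 N}.
  by move=> i si; rewrite mem_iota add0n ltnS; exact: (leq_bigmax_seq i si).
have : (size s <= N)%N by rewrite -(size_iota 0 N); exact: uniq_leq_size.
clearbody N; have [d e] : exists d, (N - size s = d)%N by exists (N - size s)%N.
elim: d s v us sN e => [|d IH] s v us sN e sz.
  have sI : s =i iota 0 N.
    apply: (uniq_min_size us sN _).2; by rewrite size_iota -subn_eq0 e.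
  rewrite (cylinder_eq _ sI) nu_prefix; congr (_ ^+ _)%:E.
  by apply/eqP; rewrite eqn_leq sz -subn_eq0 e.
have [i iN si] : exists2 i, i \in iota 0 N & i \notin s.
  apply: contrapT => H; have : (N <= size s)%N.
    rewrite -(size_iota 0 N); apply: uniq_leq_size; first exact: iota_uniq.
    by move=> i iN; apply: contrapT => /negP si; apply: H; exists i.
  by rewrite -subn_eq0 e.
have sz' : (size s < N)%N by rewrite -subn_gt0 e.
rewrite (bit_split nu i (cylinder_measurable s v)) -half_double -!cylinder_cons//.
have H c : nu (cylinder (i :: s) (update v i c)) = ((2^-1 : R) ^+ (size s).+1)%:E.
  apply: IH => //=; first by rewrite si.
    by move=> j; rewrite inE => /orP[/eqP ->//|]; exact: sN.
  by rewrite subnS e.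
by rewrite !H.
Qed.

Definition agree (a b : nat -> nat) K : set bits :=
  [set w : bits | forall k, (k < K)%N -> w (a k) = w (b k)].

Lemma agree_measurable a b K : measurable (agree a b K).
Proof.
elim: K => [|K IH]; first by rewrite (_ : agree _ _ _ = setT)//; apply/seteqP; split.
rewrite (_ : agree a b K.+1 = agree a b K `&` \bigcup_(c : bool)
    ([set w : bits | w (a K) = c] `&` [set w : bits | w (b K) = c])).
  apply: measurableI => //; apply: countable_bigcupT_measurable => [|c].
    exact: countableP.
  by apply: measurableI; exact: bit_eq_measurable.
apply/seteqP; split=> w /= => [H|[H [c _ [/= wa wb]]] k].
  split; first by move=> k kK; apply: H; exact: ltnW.
  by exists (w (b K)) => //; split=> //=; exact: H.
by rewrite ltnS leq_eqVlt => /orP[/eqP ->|]; [rewrite wa wb|exact: H].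
Qed.

(** Once the bit at [b K] is fixed, agreement fixes the bit at [a K] as well, so each of the
    disjoint pairs contributes a factor one half. *)
Lemma coin_agree a b K s v : uniq (s ++ flatten [seq [:: a k; b k] | k <- iota 0 K]) ->
  nu (agree a b K `&` cylinder s v) = ((2^-1 : R) ^+ (size s + K))%:E.
Proof.
elim: K s v => [|K IH] s v.
  rewrite cats0 addn0 => us; rewrite (_ : agree a b 0 = setT) ?setTI ?coin_cylinder//.
  by apply/seteqP; split.
rewrite -addn1 iotaD map_cat flatten_cat /= add0n catA => us.
have us' : uniq ([:: a K, b K & s] ++ flatten [seq [:: a k; b k] | k <- iota 0 K]).
  by rewrite uniq_catC in us.
have [abs bs] : a K \notin b K :: s /\ b K \notin s.
  by move: us'; rewrite cat_uniq => /andP[/= /and3P[]].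
have mA : measurable (agree a b K.+1 `&` cylinder s v).
  by apply: measurableI; [exact: agree_measurable|exact: cylinder_measurable].
rewrite addn1 addnS (bit_split nu (b K) mA) -half_double.
suff H c : nu (agree a b K.+1 `&` cylinder s v `&` [set w : bits | w (b K) = c]) =
    ((2^-1 : R) ^+ (size s + K).+2)%:E by rewrite !H.
rewrite -setIA -cylinder_cons// (_ : _ `&` _ = agree a b K `&`
    cylinder [:: a K, b K & s] (update (update v (b K) c) (a K) c)).
  by rewrite IH//= !addSn addnS.
rewrite (cylinder_cons _ _ abs); apply/seteqP; split=> w /= [H ws].
  split; first by move=> k kK; apply: H; exact: ltnW.
  split=> //; rewrite H//.
  by have := ws (b K); rewrite mem_head /update eqxx; apply.
split; last exact: ws.1.
move=> k; rewrite ltnS leq_eqVlt => /orP[/eqP ->|]; last exact: H.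
by rewrite ws.2; have := ws.1 (b K); rewrite mem_head /update eqxx => ->.
Qed.

End Cylinders.

Definition cylinders : set (set bits) :=
  [set A | A = set0 \/ exists s v, uniq s /\ A = cylinder s v].

Lemma cylinders_generate : @measurable _ bits = <<s cylinders >>.
Proof.
apply/seteqP; split.
  apply: smallest_sub; first exact: smallest_sigma_algebra.
  move=> _ [n ->]; apply: sub_sigma_algebra; right; exists [:: n], (fun=> true).
  split=> //; apply/seteqP; split=> w /= => [wn i|]; last by apply; rewrite mem_head.
  by rewrite inE => /eqP ->.
apply: smallest_sub; first exact: sigma_algebra_measurable.
by move=> A [->|[s [v [_ ->]]]]; [exact: measurable0|exact: cylinder_measurable].
Qed.

Lemma cylinders_setI : setI_closed cylinders.
Proof.
move=> A B [->|[s [v [us ->]]]]; first by rewrite set0I; left.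
move=> [->|[t [u [ut ->]]]]; first by rewrite setI0; left.
have [[i [si ti vu]]|ok] := pselect (exists i, [/\ i \in s, i \in t & v i != u i]).
  left; apply/seteqP; split=> // w [ws wt].
  by move/eqP : vu; apply; rewrite -ws// -wt.
right; exists (undup (s ++ t)), (fun i => if i \in s then v i else u i).
split; first exact: undup_uniq.
apply/seteqP; split=> w /= => [[ws wt] i|H].
  by rewrite mem_undup mem_cat; case: ifPn => [si _|_ /= ti]; [exact: ws|exact: wt].
split=> i si; have := H i; rewrite mem_undup mem_cat si ?orbT => /(_ isT) ->//.
case: ifPn => // sv; apply: contrapT => /eqP vu; apply: ok.
by exists i; split.
Qed.

Lemma bits_measure_unique (R : realType) (P P' : probability bits R) :
  (forall s v, uniq s -> P (cylinder s v) = P' (cylinder s v)) ->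
  forall A, measurable A -> P A = P' A.
Proof.
move=> PP' A mA; have cT : cylinders setT.
  by right; exists [::], xpredT; split=> //; apply/seteqP; split.
apply: (measure_unique cylinders (fun=> setT)) => //.
- exact: cylinders_generate.
- exact: cylinders_setI.
- by apply/seteqP; split=> // w _; exists 0.
- by move=> B [->|[s [v [us ->]]]]; [rewrite !measure0|exact: PP'].
- by move=> _ /=; rewrite probability_setT ltry.
Qed.

(** * Bernoulli shifts *)

(** Freeness is asked in a strong form: every nontrivial element moves infinitely many indices in
    pairwise disjoint pairs, so that a fixed bit sequence satisfies infinitely many independent
    coincidences. *)
Record index_action (G : groupType) (s : G -> nat -> nat) := IndexAction {
  index_action1 : forall n, s 1%g n = n;
  index_actionM : forall g h n, s (g * h)%g n = s g (s h n);
  index_action_free : forall g, g != 1%g -> exists a : nat -> nat, forall K,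
    uniq (flatten [seq [:: a k; s g (a k)] | k <- iota 0 K]) }.

(** Left translation on the copy of [G * nat] that [c] embeds into [nat], and the identity
    elsewhere. The second factor supplies infinitely many orbits even when [G] is finite. *)
Lemma index_action_ex (G : groupType) : countable [set: G] ->
  exists s : G -> nat -> nat, index_action s.
Proof.
move=> /countable_injP[f fi].
pose c h k : nat := pickle (f h : nat, k : nat).
have ci h k h' k' : c h k = c h' k' -> h = h' /\ k = k'.
  by move/(pcan_inj pickleK) => [fh ->]; split=> //; apply: fi; rewrite ?in_setT.
have sP (gn : G * nat) : exists n',
    (forall h k, gn.2 = c h k -> n' = c (gn.1 * h)%g k) /\
    ((forall h k, gn.2 <> c h k) -> n' = gn.2).
  have [[h [k e]]|ne] := pselect (exists h k, gn.2 = c h k).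
    exists (c (gn.1 * h)%g k); split=> [h' k'|/(_ h k)//].
    by rewrite e => /ci[-> ->].
  exists gn.2; split=> // h k e; exfalso; apply: ne; by exists h, k.
have [s' s'P] := choice sP; pose s g n := s' (g, n).
have sc g h k : s g (c h k) = c (g * h)%g k by apply: (s'P (g, c h k)).1.
have sn g n : (forall h k, n <> c h k) -> s g n = n by move=> H; apply: (s'P (g, n)).2.
exists s; split.
- move=> n; have [[h [k ->]]|ne] := pselect (exists h k, n = c h k).
    by rewrite sc mul1g.
  by rewrite sn// => h k e; apply: ne; exists h, k.
- move=> g h n; have [[h' [k ->]]|ne] := pselect (exists h k, n = c h k).
    by rewrite !sc mulgA.
  by rewrite !sn// => h' k e; apply: ne; exists h', k.
move=> g g1; exists (c 1%g) => K; elim: K => // K IH.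
rewrite -addn1 iotaD map_cat flatten_cat /= add0n cat_uniq IH /= sc mulg1.
have notin h : c h K \notin flatten [seq [:: c 1%g k; s g (c 1%g k)] | k <- iota 0 K].
  apply/negP => /flattenP[l /mapP[k]]; rewrite mem_iota => kK ->.
  by rewrite sc !inE => /orP[] /eqP /ci[_ e]; move: kK; rewrite e ltnn andbF.
rewrite !negb_or !notin /= !andbT.
by apply/negP => /eqP /ci[e _]; move: g1; rewrite -e eqxx.
Qed.

Section BernoulliShift.
Context {R : realType} {G : groupType} (s : G -> nat -> nat).
Hypothesis sP : index_action s.
Variable nu : probability bits R.
Hypothesis nu_prefix : forall N v, nu (cylinder (iota 0 N) v) = ((2^-1 : R) ^+ N)%:E.

Definition shift (g : G) (w : bits) : bits := fun n => w (s g^-1%g n).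

Lemma shift1 w : shift 1%g w = w.
Proof. by apply/funext => n; rewrite /shift invg1 (index_action1 sP). Qed.

Lemma shiftM g h w : shift (g * h)%g w = shift g (shift h w).
Proof. by apply/funext => n; rewrite /shift invgM (index_actionM sP). Qed.

Lemma shift_measurable g : measurable_fun setT (shift g).
Proof. by apply: bits_measurable_fun => n; exact: bit_measurable. Qed.

HB.instance Definition _ g := isMeasurableFun.Build _ _ _ _ (shift g) (shift_measurable g).

Lemma index_actionK g : cancel (s g) (s g^-1%g).
Proof. by move=> n; rewrite -(index_actionM sP) mulVg (index_action1 sP). Qed.

Lemma index_actionVK g : cancel (s g^-1%g) (s g).
Proof. by move=> n; rewrite -(index_actionM sP) mulgV (index_action1 sP). Qed.

Lemma shift_preserving g A : measurable A -> nu (shift g @^-1` A) = nu A.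
Proof.
move=> mA; apply: (@bits_measure_unique _ (distribution nu (shift g)) nu) => // t v ut.
have gi : injective (s g^-1%g) by apply: can_inj (index_actionK g^-1%g).
rewrite /= /distribution /pushforward.
rewrite (_ : _ @^-1` _ = cylinder (map (s g^-1%g) t) (v \o s g)).
  by rewrite !(coin_cylinder nu_prefix)// ?map_inj_uniq// size_map.
apply/seteqP; split=> w H i /=.
  by move=> /mapP[j jt ->] /=; rewrite index_actionVK; exact: (H j jt).
by move=> it; have := H (s g^-1%g i) (map_f _ it); rewrite /= index_actionVK.
Qed.

(** A fixed sequence agrees on infinitely many disjoint pairs of indices; agreement on the first [K]
    of them has measure [2^-1 ^+ K]. *)
Lemma shift_free g : g != 1%g -> exists2 N : set bits, measurable N &
  nu N = 0%E /\ forall w, shift g w = w -> N w.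
Proof.
move=> g1; have gV : g^-1%g != 1%g by rewrite invg_eq1.
have [a au] := index_action_free sP gV.
pose b k := s g^-1%g (a k).
exists (\bigcap_K agree a b K).
  by apply: bigcapT_measurable => K; exact: agree_measurable.
split; last first.
  by move=> w e K _ k _; rewrite -[in LHS]e.
have le K : (nu (\bigcap_K agree a b K) <= ((2^-1 : R) ^+ K)%:E)%E.
  rewrite -(add0n K) -(coin_agree nu_prefix (s := [::]) xpredT (au K)).
  apply: le_measure; rewrite ?inE.
  - by apply: bigcapT_measurable => ?; exact: agree_measurable.
  - by apply: measurableI; [exact: agree_measurable|exact: cylinder_measurable].
  - by move=> w H; split=> //; exact: H.
apply/eqP; rewrite eq_le measure_ge0 andbT; apply/lee_addgt0Pr => e e0; rewrite add0e.
have [K /ltW Ke] : exists K, (2^-1 : R) ^+ K < e.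
  have /cvgrPdist_lt /(_ e e0) [K _ /(_ K (leqnn K))] : (2^-1 : R) ^+ n @[n --> \oo] --> 0.
    by apply: cvg_expr; rewrite ger0_norm// invf_lt1// ltr1n.
  by rewrite sub0r normrN ger0_norm ?exprn_ge0// => lt; exists K.
by apply: le_trans (le K) _; rewrite lee_fin.
Qed.

End BernoulliShift.

(** * Free extensions of standard spaces *)

Definition polish_bits (R : realType) (P : completePseudoMetricType R) :=
  (P * (nat -> bool))%type.

Section PolishBits.
Context {R : realType} {P : completePseudoMetricType R}.
Local Notation Q := (polish_bits P).

HB.instance Definition _ := Pointed.on Q.

(** On bit sequences this is an ultrametric: closeness at scale [e] means equality at the finitely
    many positions [n] with [e <= n.+1%:R^-1]. *)
Definition pb_ball (x : Q) (e : R) (y : Q) := [/\ 0 < e, ball x.1 e y.1 &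
  forall n, e <= n.+1%:R^-1 -> x.2 n = y.2 n].

Lemma pb_ball_center x e : 0 < e -> pb_ball x e x.
Proof. by move=> e0; split=> //; exact: ballxx. Qed.

Lemma pb_ball_sym x y e : pb_ball x e y -> pb_ball y e x.
Proof. by move=> [e0 xy H]; split=> // [|n /H]; [exact: ball_sym|]. Qed.

Lemma pb_ball_triangle x y z e1 e2 :
  pb_ball x e1 y -> pb_ball y e2 z -> pb_ball x (e1 + e2) z.
Proof.
move=> [e10 xy H] [e20 yz K]; split; first exact: addr_gt0.
  exact: ball_triangle xy yz.
by move=> n en; rewrite H ?K//; apply: le_trans en; rewrite ?lerDl ?lerDr ltW.
Qed.

HB.instance Definition _ := hasNbhs.Build Q (nbhs_ (entourage_ pb_ball)).

HB.instance Definition _ := Nbhs_isPseudoMetric.Build R Q erefl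
  pb_ball_center pb_ball_sym pb_ball_triangle erefl.

Lemma pb_ballP (x y : Q) e : ball x e y <-> pb_ball x e y.
Proof. by []. Qed.

Lemma small_inv (e : R) : 0 < e -> exists N : nat, forall n, e <= n.+1%:R^-1 -> (n < N)%N.
Proof.
move=> e0; have /ltr_add_invr[N] := e0; rewrite add0r => Ne.
exists N => n en; have := lt_le_trans Ne en.
by rewrite ltf_pV2 ?posrE// ltr_nat ltnS.
Qed.

Lemma near_prefix (F : set_system Q) (w : nat -> bool) N : Filter F ->
  (forall n, F [set x : Q | x.2 n = w n]) ->
  F [set x : Q | forall n, (n < N)%N -> x.2 n = w n].
Proof.
move=> FF Fw; elim: N => [|N IH]; first by apply: filterS filterT => x _.
apply: filterS2 IH (Fw N) => x H e n; rewrite ltnS leq_eqVlt => /orP[/eqP ->//|].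
exact: H.
Qed.

Lemma pb_complete (F : set_system Q) : ProperFilter F -> cauchy F -> cvg F.
Proof.
move=> FF cauF; have cF : cauchy_ex F by exact/cauchyP.
have cF1 : cauchy ((fun x : Q => x.1) @ F).
  apply/cauchy_exP => e e0; have [x xF] := cF e e0; exists x.1.
  apply: (@filterS _ F _ (ball x e)) xF => y /pb_ballP[_ xy _]; exact: xy.
have /cauchy_cvg/cvg_ex[p /cvg_ballP Fp] := cF1.
have /choice[w Fw] n : exists c, F [set x : Q | x.2 n = c].
  have [x xF] := cF n.+1%:R^-1 ltac:(by rewrite invr_gt0).
  by exists (x.2 n); apply: filterS xF => y /pb_ballP[_ _ H]; rewrite H.
apply/cvg_ex; exists ((p, w) : Q); apply/cvg_ballP => e e0.
have [N NP] := small_inv e0.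
apply: filterS2 (Fp e e0) (near_prefix N FF Fw) => x px xw; apply/pb_ballP; split=> // n /NP nN.
by rewrite xw.
Qed.

HB.instance Definition _ := Uniform_isComplete.Build Q pb_complete.

Lemma pb_hausdorff : hausdorff_space P -> hausdorff_space Q.
Proof.
rewrite !ball_hausdorff => hP x y xy.
have [e|/eqP n1] := pselect (x.1 = y.1); last first.
  have [r /eqP rP] := hP _ _ n1; exists r; apply/eqP/seteqP; split=> // z [/pb_ballP[_ xz _] /pb_ballP[_ yz _]].
  have : (ball x.1 r.1%:num `&` ball y.1 r.2%:num) z.1 by split.
  by rewrite rP.
have [n nxy] : exists n, x.2 n <> y.2 n.
  apply: contrapT => H; move/eqP : xy; apply.
  rewrite (surjective_pairing x) (surjective_pairing y) e; congr pair.
  by apply/funext => n; apply: contrapT => H'; apply: H; exists n.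
have n0 : (0 : R) < n.+1%:R^-1 by rewrite invr_gt0.
exists (PosNum n0, PosNum n0); apply/eqP/seteqP; split=> // z [/pb_ballP[_ _ xz] /pb_ballP[_ _ yz]].
by apply: nxy; rewrite xz// yz.
Qed.

Lemma pb_fst_continuous : continuous (fun x : Q => x.1).
Proof.
move=> x A /nbhs_ballP[e /= e0 eA]; apply/nbhs_ballP; exists e => // y /pb_ballP[_ xy _].
exact: eA.
Qed.

Lemma pb_bit_open n c : open [set x : Q | x.2 n = c].
Proof.
rewrite openE => x xn; apply/nbhs_ballP; exists n.+1%:R^-1; first by rewrite /= invr_gt0.
by move=> y /pb_ballP[_ _ H]; rewrite /= -H.
Qed.

Definition pad (t : seq bool) : nat -> bool := nth false t.

(** Rectangles of a basic open set and a cylinder form a countable base. *)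
Lemma pb_basis (V : nat -> set P) (x : Q) (A : set Q) :
  (forall y B, nbhs y B -> exists n, V n y /\ V n `<=` B) -> nbhs x A ->
  exists n t, [/\ V n x.1, cylinder (iota 0 (size t)) (pad t) x.2 &
    forall y : Q, V n y.1 -> cylinder (iota 0 (size t)) (pad t) y.2 -> A y].
Proof.
move=> VP /nbhs_ballP[e /= e0 eA]; have [N NP] := small_inv e0.
have [n [Vx VA]] := VP _ _ (nbhsx_ballx x.1 e e0).
exists n, (mkseq x.2 N); rewrite size_mkseq; split=> // [i|y Vy xy].
  by rewrite mem_iota => /andP[_ iN]; rewrite /pad nth_mkseq.
apply: eA; apply/pb_ballP; split=> //; first exact: VA.
by move=> i /NP iN; rewrite xy ?mem_iota// /pad nth_mkseq.
Qed.

Lemma pb_separable (D : set P) : countable D -> dense D ->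
  exists2 D' : set Q, countable D' & dense D'.
Proof.
move=> cD dD.
exists ((fun dt : P * seq bool => (dt.1, pad dt.2) : Q) @` (D `*` setT)).
  by apply: card_le_trans (card_image_le _ _) _; exact: countableX.
move=> O [x Ox] oO; have /nbhs_ballP[e /= e0 eA] := open_nbhs_nbhs (conj oO Ox).
have [N NP] := small_inv e0.
have [d [/= xd Dd]] : (ball x.1 e)^° `&` D !=set0.
  by apply: dD; [exists x.1; exact: nbhsx_ballx|exact: open_interior].
exists (d, pad (mkseq x.2 N)); split; last by exists (d, mkseq x.2 N).
apply: eA; apply/pb_ballP; split=> //; first exact: interior_subset xd.
by move=> n /NP nN; rewrite /= /pad nth_mkseq.
Qed.

End PolishBits.

(** By [pb_basis], open sets of the Polish model are countable unions of measurable rectangles.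
    Conversely, the inverse bijection is Borel measurable because both of its components are. *)
Lemma standard_borel_bits (R : realType) d (X : measurableType d) :
  standard_borel R X -> standard_borel R (X * bits)%type.
Proof.
move=> [P [f [hP [D cD dD] bf mf]]]; have [V [oV VP]] := separable_basis cD dD.
pose Q := polish_bits P; pose g (x : X * bits) : Q := (f x.1, x.2).
have [f' fK f'K] := bf; pose g' (y : Q) : X * bits := (f' y.1, y.2).
have gK : cancel g g' by move=> [x w]; rewrite /g /g' /= fK.
have g'K : cancel g' g by move=> [x w]; rewrite /g /g' /= f'K.
exists Q, g; split.
- exact: pb_hausdorff.
- exact: pb_separable dD.
- by exists g'.
move=> B; split.
  pose S := [set B : set Q | measurable (g @^-1` B)].
  move=> sB; apply: (sB S); split; last first.
    move=> O oO; rewrite /S /=.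
    pose rect (n : nat) (t : seq bool) : set Q :=
      [set y : Q | V n y.1 /\ cylinder (iota 0 (size t)) (pad t) y.2].
    rewrite (_ : O = \bigcup_(nt : nat * seq bool)
      (if `[< rect nt.1 nt.2 `<=` O >] then rect nt.1 nt.2 else set0)).
      rewrite preimage_bigcup; apply: countable_bigcupT_measurable => [|nt].
        exact: countableP.
      case: asboolP => _; last by rewrite preimage_set0.
      rewrite (_ : _ @^-1` _ = (f @^-1` V nt.1) `*` cylinder (iota 0 (size nt.2)) (pad nt.2))//.
      apply: measurableX; last exact: cylinder_measurable.
      by apply/mf; exact: sub_sigma_algebra.
    apply/seteqP; split=> [x Ox|x [nt _]]; last by case: asboolP => // H; exact: H.
    have [n [t [Vx xt H]]] := pb_basis VP (open_nbhs_nbhs (conj oO Ox)).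
    exists (n, t) => //=; case: asboolP => // nH; apply: nH => y [Vy yt].
    exact: H.
  split; rewrite /S /=.
  - by rewrite preimage_set0.
  - by move=> C mC; rewrite setTD preimage_setC; exact: measurableC.
  - by move=> C mC; rewrite preimage_bigcup; exact: bigcup_measurable.
pose QT := g_sigma_algebraType (@open Q).
have mg' : measurable_fun setT (g' : QT -> X * bits).
  apply: measurable_fun_pair.
    move=> _ A mA; rewrite setTI.
    have sA : <<s @open P >> (f' @^-1` A).
      by apply/mf; rewrite -comp_preimage (_ : f' \o f = id)//; apply/funext => x /=; rewrite fK.
    move=> T [sT oT]; apply: (sA [set C : set P | T ((fun y : Q => y.1) @^-1` C)]).
    split; last first.
      by move=> C oC; apply: oT; apply: open_comp => // x _; exact: pb_fst_continuous.
    have [T0 TC TU] := sT; split=> /=; first by rewrite preimage_set0.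
      by move=> C /TC; rewrite !setTD preimage_setC.
    by move=> C mC; rewrite preimage_bigcup; exact: TU.
  apply: bits_measurable_fun => n; apply: sub_sigma_algebra.
  exact (@pb_bit_open R P n true).
move=> mB; have := mg' measurableT _ mB; rewrite setTI -comp_preimage.
by rewrite (_ : g \o g' = id)//; apply/funext => x /=; rewrite g'K.
Qed.

Section ProductMeasure.
Context d1 d2 (T1 : measurableType d1) (T2 : measurableType d2) (R : realType).
Variables (P1 : probability T1 R) (P2 : probability T2 R).

(** The image of the product measure has the right values on rectangles, which characterise the
    product measure. *)
Lemma product_measure_preserving (f1 : T1 -> T1) (f2 : T2 -> T2) :
  measurable_fun setT f1 -> measurable_fun setT f2 ->
  (forall A, measurable A -> P1 (f1 @^-1` A) = P1 A) ->
  (forall A, measurable A -> P2 (f2 @^-1` A) = P2 A) ->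
  forall A, measurable A ->
  (P1 \x P2)%E ((fun x => (f1 x.1, f2 x.2)) @^-1` A) = (P1 \x P2)%E A.
Proof.
move=> mf1 mf2 f1P f2P A mA.
have mf : measurable_fun setT (fun x : T1 * T2 => (f1 x.1, f2 x.2)).
  by apply: measurable_fun_pair; apply: measurableT_comp.
pose f : {mfun (T1 * T2)%type >-> (T1 * T2)%type} := HB.pack (fun x : T1 * T2 => (f1 x.1, f2 x.2))
  (isMeasurableFun.Build _ _ _ _ _ mf).
apply/esym; apply: (@product_measure_unique _ _ _ _ R P1 P2
  (distribution ((P1 \x P2)%E : probability _ R) f)) => // B1 B2 mB1 mB2.
have m1 : measurable (f1 @^-1` B1) by rewrite -[X in measurable X]setTI; exact: mf1.
have m2 : measurable (f2 @^-1` B2) by rewrite -[X in measurable X]setTI; exact: mf2.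
transitivity (P1 (f1 @^-1` B1) * P2 (f2 @^-1` B2))%E.
  exact: (product_measure1E P1 P2 m1 m2).
by rewrite f1P// f2P.
Qed.

End ProductMeasure.

Section BernoulliExtension.
Context {R : realType} {G : groupType} (alpha : standard_space R G).
Context {s : G -> nat -> nat} (sP : index_action s).

Definition extension_act_fun (g : G) (x : ss_space alpha * bits) : ss_space alpha * bits :=
  (ss_act alpha g x.1, shift s g x.2).

Lemma extension_act1 x : extension_act_fun 1%g x = x.
Proof. by case: x => x w; rewrite /extension_act_fun act1x (shift1 sP). Qed.

Lemma extension_actM g h x :
  extension_act_fun (g * h)%g x = extension_act_fun g (extension_act_fun h x).
Proof. by rewrite /extension_act_fun actMx (shiftM sP). Qed.

Definition extension_act : group_action G (ss_space alpha * bits) :=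
  GroupAction extension_act1 extension_actM.

Lemma extension_measurable g : measurable_fun setT (extension_act g).
Proof.
apply: measurable_fun_pair; apply: measurableT_comp => //; exact: ss_measurable.
Qed.

Lemma extension_preserving g A : measurable A ->
  (ss_mu alpha \x coin_measure R)%E (extension_act g @^-1` A) =
  (ss_mu alpha \x coin_measure R)%E A.
Proof.
apply: product_measure_preserving.
- exact: ss_measurable.
- exact: shift_measurable.
- exact: ss_preserving.
- by move=> B mB; apply: (shift_preserving sP (@coin_measure_prefix R)).
Qed.

(** The diagonal action on the product with a Bernoulli shift is essentially free for every [alpha],
    and its first projection is equivariant and measure preserving. *)
Definition bernoulli_extension : standard_space R G :=
  StandardSpace (standard_borel_bits (ss_borel alpha)) extension_measurable
    (ss_mu := (ss_mu alpha \x coin_measure R)%E) extension_preserving.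

Lemma bernoulli_extension_free : countable [set: G] -> essentially_free bernoulli_extension.
Proof.
move=> countG; apply: (@ae_forall_group R G bernoulli_extension
  (fun g x => ss_act bernoulli_extension g x = x -> g = 1%g)) => // g.
have [->|g1] := eqVneq g 1%g; first exact: aeW.
have [N mN [N0 NP]] := shift_free sP (@coin_measure_prefix R) g1.
exists (setT `*` N); split.
- exact: measurableX.
- transitivity (ss_mu alpha setT * coin_measure R N)%E; last by rewrite N0 mule0.
  exact: (product_measure1E (ss_mu alpha) (coin_measure R) measurableT mN).
- move=> [x w] /= H; split=> //=; apply: NP; apply: contrapT => nw; apply: H => e.
  by exfalso; apply: nw; case: e.
Qed.

Lemma bernoulli_extension_fst A : measurable A ->
  ss_mu bernoulli_extension ((fun x : ss_space bernoulli_extension => x.1) @^-1` A) = ss_mu alpha A.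
Proof.
move=> mA; rewrite (_ : _ @^-1` A = A `*` setT).
  transitivity (ss_mu alpha A * coin_measure R setT)%E; last by rewrite probability_setT mule1.
  exact: (product_measure1E (ss_mu alpha) (coin_measure R) mA measurableT).
by apply/seteqP; split=> x //= -[].
Qed.

End BernoulliExtension.

(** * From parametrised cycles to cost *)

(** This is where integrality enters: the absolute value is at least 1 wherever the function is
    nonzero. *)
Lemma measure_support_le_Linf_norm1 (R : realType) d (X : measurableType d)
    (mu : probability X R) (f : Linf mu) :
  (mu [set x | (repr f : Linf_fun mu) x != 0%R] <= Linf_norm1 f)%E.
Proof.
have /asboolP[mf _] := Linf_valP (repr f).
have mS : measurable [set x | (repr f : Linf_fun mu) x != 0].
  exact: (mf (fun z => z != 0)).
rewrite -[X in mu X]setIT -integral_indic//; apply: ge0_le_integral => //.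
- exact: measurableT_comp (measurable_indic mS).
- by move=> mD Y mY; rewrite setTI; exact: (mf (fun z => Y (`|z|%:~R)%:E)).
move=> x _; rewrite lee_fin indicE; case: (boolP (x \in _)) => [|_]; last by rewrite ler0z.
by move/set_mem => /= fx; rewrite ler1z -gtz0_ge1 normr_gt0.
Qed.

(** In dimension 0 points are open, so a connected [M] is a single point and carries a single
    loop. *)
Lemma dim0_group_trivial (R : realType) (M : topologicalType) (x0 : M) (G : groupType)
    (phi : fundamental_group R x0 G) :
  locally_euclidean R 0 M -> connected [set: M] -> finite_set [set: G].
Proof.
move=> eucM conM.
have oM (x : M) : open [set x].
  have [U [V [f [oU Ux _ [[_ fi _] _ _]]]]] := eucM x.
  rewrite (_ : [set x] = U)//; apply/seteqP; split=> y; first by move=> ->.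
  by move=> Uy; apply: fi; rewrite ?inE//; apply/matrixP => i [].
have Mx (x : M) : x = x0.
  apply: (connected_locally_constant (P := fun y => y = x0) conM _ (x := x0)) => // y _.
  by near=> z; have -> : z = y by near: z; exact: (open_nbhs_nbhs (conj (oM y) erefl)).
have [w _ wE] := loop_class_surj phi 1%g.
apply: (@sub_finite_set _ _ [set 1%g]) (finite_set1 _) => g _ /=.
have [v _ <-] := loop_class_surj phi g; rewrite -wE; congr (loop_class _ _).
by apply/funext => t; rewrite (Mx (v t)) (Mx (w t)).
Unshelve. all: by end_near. Qed.

Section CycleCost.
Context {R : realType} {n : nat} {M : topologicalType}.
Hypothesis manM : closed_connected_manifold R n M.
Variable o : orientation R n M.
Context {x0 : M} {G : groupType} {phi : fundamental_group R x0 G}.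
Context {Mt : topologicalType}.
Variable uc : universal_covering phi Mt.
Variables (alpha beta : standard_space R G).
Variable p : ss_space beta -> ss_space alpha.
Hypothesis p_act : forall g x, p (ss_act beta g x) = ss_act alpha g (p x).
Hypothesis p_measurable : forall A, measurable A -> measurable (p @^-1` A).
Hypothesis p_preserving : forall A, measurable A ->
  ss_mu beta (p @^-1` A) = ss_mu alpha A.
Hypothesis beta_free : essentially_free beta.

(** The cycle lives over [alpha], while the generators are built over a free [beta]: configurations
    and supports pull back along [p] with unchanged measures. Both inequalities of the theorem are
    instances. *)
Lemma cycle_cost (c : param_chain uc alpha n) (r : \bar R) :
  param_fundamental_cycle o c -> param_norm1 c r -> (action_cost beta - 1 <= r)%E.
Proof.
have [hausM cM eucM _ conM] := manM; have countG := deck_group_countable uc cM.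
move=> cfund [m [f [s [[cE _] ->]]]]; rewrite leeBlDr//.
(* Simplices of dimension 0 have no edge, so that dimension is treated through the finiteness of the
   group. *)
move: (manM) => _; case: n o c cfund s cE eucM => [|n'] o' c' cfund s cE eucM.
  have finG := dim0_group_trivial phi eucM conM.
  apply: le_trans (finite_group_action_cost beta countG finG) _.
  rewrite -[leLHS]add0e leeD// sume_ge0// => j _.
  by apply: le_trans (measure_support_le_Linf_norm1 (f j)).
have [a [b [Q good]]] := fundamental_cycle_config hausM eucM countG cfund cE.
pose f' j x := (repr (f j) : Linf_fun (ss_mu alpha)) (p x).
have mf j (B : set int) : measurable ((repr (f j) : Linf_fun (ss_mu alpha)) @^-1` B).
  by have /asboolP[] := Linf_valP (repr (f j)).
have good' : {ae ss_mu beta, forall x, good_config a b Q (orbit_config f' x)}.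
  have [N [mN N0 NP]] := good; exists (p @^-1` N); split; first exact: p_measurable.
    by rewrite p_preserving.
  move=> x /= nx; apply: NP => /= gx; apply: nx.
  rewrite (_ : orbit_config f' x = fun j g => (repr (f j) : Linf_fun (ss_mu alpha))
    (ss_act alpha g^-1%g (p x)))//.
  by apply/funext => j; apply/funext => g; rewrite /orbit_config /f' p_act.
apply: le_trans (action_cost_config countG _ beta_free good') _.
  by move=> j B; exact: (p_measurable (mf j B)).
apply: leeD => //; apply: lee_sum => j _.
rewrite [leLHS](p_preserving (mf j (fun z => z != 0))).
exact: measure_support_le_Linf_norm1.
Qed.

End CycleCost.

Theorem theorem1p2 (R : realType) (n : nat) (M : topologicalType)
    (hM : closed_connected_manifold R n M) (o : orientation R n M)
    (x0 : M) (G : groupType) (phi : fundamental_group R x0 G)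
    (Mt : topologicalType) (uc : universal_covering phi Mt) :
  (forall alpha : standard_space R G,
     essentially_free alpha -> ergodic alpha ->
     (action_cost alpha - 1 <= param_simplicial_volume o uc alpha)%E) /\
  (group_cost R G - 1 <= integral_foliated_simplicial_volume o uc)%E.
Proof.
split=> [alpha free _|].
  apply: le_ereal_inf_tmp => r [c cfund cr].
  exact: (cycle_cost hM (p := id) (fun _ _ => erefl) (fun _ mA => mA) (fun _ _ => erefl)
    free cfund cr).
apply: le_ereal_inf_tmp => _ [alpha ->]; apply: le_ereal_inf_tmp => r [c cfund cr].
have countG : countable [set: G] by case: hM => _ cM _ _ _; exact: deck_group_countable uc cM.
(* The infimum on the right ranges over all actions, so each [alpha] is replaced by its essentially
   free Bernoulli extension, whose cost bounds that of the group from above. *)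
have [s sP] := index_action_ex countG.
have free := bernoulli_extension_free alpha sP countG.
have mfst A : measurable A ->
    measurable ((fun x : ss_space (bernoulli_extension alpha sP) => x.1) @^-1` A).
  by move=> mA; rewrite -[X in measurable X]setTI; exact: measurable_fst.
apply: le_trans (cycle_cost hM (p := fun x : ss_space (bernoulli_extension alpha sP) => x.1)
  (fun _ _ => erefl) mfst (@bernoulli_extension_fst _ _ alpha _ sP) free cfund cr).
by apply: leeB => //; apply: ereal_inf_lbound; exists (bernoulli_extension alpha sP).
Qed.
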